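(* Assume condition (N) holds, that $G'(0)$ exists and is finite, and that $g(s,\tau)\leq g'(0,\tau)s$ for all $s\geq0$, $\tau\in X$. Let $\zeta_1\in(0,\zeta_2)$ be a number such that $G([\zeta_1,\zeta_2])\subseteq[\zeta_1,\zeta_2]$, $\min_{s\in[\zeta_1,\zeta_2]}G(s)=G(\zeta_1)$ and $G(s)>s$ for $s\in(0,\zeta_1]$. Suppose $\chi(0)<0$ and that $\chi$ is defined on some open interval $(0,\bar\omega)$ and changes its sign on it [respectively, is defined on some $(-\bar\omega,0)$ and changes its sign on it]. Then equation (E) has at least one semi-wavefront $\varphi$ with $\varphi(-\infty)=0$, $\sup_{s\in\mathbb{R}}\varphi(s)\leq\zeta_2$ and $\liminf_{t\to+\infty}\varphi(t)>\zeta_1$ [respectively, with $\varphi(+\infty)=0$ and $\liminf_{t\to-\infty}\varphi(t)>\zeta_1$]. Moreover, if the equation $G(s)=s$ has exactly two solutions $0$ and $\kappa$ on $[0,\infty)$, and $\kappa$ is globally attracting for the map $G:(0,\zeta_2]\to(0,\zeta_2]$, then $\varphi(+\infty)=\kappa$.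
   Context: Let $(X,\mu)$ be a finite measure space. Let $K:\mathbb{R}\times X\to[0,\infty)$ be measurable and integrable on $\mathbb{R}\times X$, with $\int_{\mathbb{R}}K(s,\tau)\,ds>0$ for every $\tau$. Let $g:[0,\infty)\times X\to[0,\infty)$ be measurable, with $g(0,\tau)=0$, $g(\cdot,\tau)$ continuous for each $\tau$, and the derivative $g'(0,\tau)$ at $0$ existing and positive for each $\tau$. Equation (E): $\phi(t)=\int_X d\mu(\tau)\int_{\mathbb{R}}K(s,\tau)\,g(\phi(t-s),\tau)\,ds$, $t\in\mathbb{R}$; solutions are continuous $\phi:\mathbb{R}\to[0,\infty)$. $\chi(z)=1-\int_X\int_{\mathbb{R}}K(s,\tau)g'(0,\tau)e^{-sz}\,ds\,d\mu(\tau)$ where the integral converges. A semi-wavefront of (E) is a positive bounded solution $\varphi$ with $\lim_{t\to-\infty}\varphi(t)=0$ or $\lim_{t\to+\infty}\varphi(t)=0$. Condition (N): (N1) there is $\tau_0\in X$ with $\mu(\{\tau_0\})=1$ such that $g(v,\tau)$ is increasing in $v$ for each $\tau\neq\tau_0$ and $g(v,\tau_0)>0$ for $v>0$; $\tilde g(v)=\int_{X\setminus\{\tau_0\}}g(v,\tau)\left(\int_{\mathbb{R}}K(s,\tau)ds\right)d\mu(\tau)$. (N2) there is $\zeta_2>0$ such that $\Theta(v)=v-\tilde g(v)$ is strictly increasing on $[0,\zeta_2]$ and $\Theta(\zeta_2)>C\max_{v\geq0}g(v,\tau_0)$, $C=\int_{\mathbb{R}}K(s,\tau_0)ds$. Define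 $G(v)=\Theta^{-1}(Cg(v,\tau_0))$, $v\geq0$, with $\Theta^{-1}$ the inverse of $\Theta|_{[0,\zeta_2]}$. ''$\kappa$ globally attracting for $G:(0,\zeta_2]\to(0,\zeta_2]$'' means $G^n(s)\to\kappa$ as $n\to\infty$ for every $s\in(0,\zeta_2]$. *)

(* Defs.v *)
From HB Require Import structures.
From mathcomp Require Import all_boot all_order all_algebra.
From mathcomp Require Import all_classical all_reals all_analysis.
Set Implicit Arguments. Unset Strict Implicit. Unset Printing Implicit Defensive.
Import Order.TTheory GRing.Theory Num.Theory.
Import numFieldNormedType.Exports.
Local Open Scope classical_set_scope.
Local Open Scope ring_scope.

Section Defs.
Context {R : realType} {d : measure_display} {X : measurableType d}.
Variable mu : {finite_measure set X -> \bar R}.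
Variables (K : R -> X -> R) (g : R -> X -> R).

Local Notation leb := (@lebesgue_measure R).

Definition rhsE (phi : R -> R) (t : R) : \bar R :=
  (\int[mu]_tau \int[leb]_s (K s tau * g (phi (t - s)) tau)%:E)%E.

Definition solution_E (phi : R -> R) : Prop :=
  continuous phi /\ (forall t, 0 <= phi t) /\ (forall t, (phi t)%:E = rhsE phi t).

Definition chi_int (g' : X -> R) (z : R) : \bar R :=
  (\int[mu]_tau \int[leb]_s (K s tau * g' tau * expR (- (s * z)))%:E)%E.
Definition chi_defined (g' : X -> R) (z : R) : Prop := (chi_int g' z < +oo)%E.
Definition chi (g' : X -> R) (z : R) : R := 1 - fine (chi_int g' z).

Definition chi_defined_changes_sign_on (g' : X -> R) (I : set R) : Prop :=
  (forall z, I z -> chi_defined g' z) /\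
  exists z1 z2, I z1 /\ I z2 /\ chi g' z1 < 0 /\ 0 < chi g' z2.

Definition gtilde (tau0 : X) (v : R) : R :=
  fine (\int[mu]_(tau in ~` [set tau0])
          ((g v tau)%:E * \int[leb]_s (K s tau)%:E))%E.
Definition Theta (tau0 : X) (v : R) : R := v - gtilde tau0 v.
Definition Cconst (tau0 : X) : R := fine (\int[leb]_s (K s tau0)%:E)%E.
Definition Theta_inv (tau0 : X) (zeta2 : R) (y : R) : R :=
  xget 0 [set u | 0 <= u <= zeta2 /\ Theta tau0 u = y].
Definition Gmap (tau0 : X) (zeta2 : R) (v : R) : R :=
  Theta_inv tau0 zeta2 (Cconst tau0 * g v tau0).

Definition condN (tau0 : X) (zeta2 : R) : Prop :=
  measurable [set tau0] /\ mu [set tau0] = 1%E /\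
  (forall tau, tau <> tau0 ->
     forall u v, 0 <= u -> u <= v -> g u tau <= g v tau) /\
  (forall v, 0 < v -> 0 < g v tau0) /\
  0 < zeta2 /\
  (forall u v, 0 <= u -> u < v -> v <= zeta2 -> Theta tau0 u < Theta tau0 v) /\
  (exists M, (exists v, 0 <= v /\ g v tau0 = M) /\
             (forall v, 0 <= v -> g v tau0 <= M) /\
             Cconst tau0 * M < Theta tau0 zeta2).

Definition semi_wavefront (phi : R -> R) : Prop :=
  solution_E phi /\ (forall t, 0 < phi t) /\ (exists M, forall t, phi t <= M) /\
  ((phi t @[t --> -oo] --> 0) \/ (phi t @[t --> +oo] --> 0)).

Definition globally_attracting (G : R -> R) (zeta2 kappa : R) : Prop :=
  forall s, 0 < s <= zeta2 -> (iter n G s @[n --> \oo] --> kappa).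

End Defs.

(* Main.v *)
Require Import Defs.
From HB Require Import structures.
From mathcomp Require Import all_boot all_order all_algebra.
From mathcomp Require Import all_classical all_reals all_analysis.
From mathcomp Require Import measurable_realfun ring lra.
Import Order.TTheory GRing.Theory Num.Theory.
Import numFieldNormedType.Exports.
Local Open Scope classical_set_scope.
Local Open Scope ring_scope.
Set Implicit Arguments. Unset Strict Implicit. Unset Printing Implicit Defensive.

(** With [sg = 1] or [sg = -1] (the latter reverses time), (E) reads [phi = A phi] for
    [A phi t = \int K(s,tau) g(phi(t - sg s),tau)], and [A] maps functions with values
    in [[0, zeta2]] to an equicontinuous family.

    Let [lam] satisfy [\int K g'(0) e^{-s sg lam} < 1].  For [eps > 0], a fixed point of
    [phi |-> max (A (min (phi, eps e^{lam t})), eps min (1, max (0, 1 + lam t)))] exists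
    by Kuhn's lemma (a combinatorial form of Brouwer's theorem, applied to step
    functions) and compactness.  Such a fixed point is dominated by [eps e^{lam t}], and
    its liminf at [+oo] exceeds [zeta1]: if [[a, b]] is the range of a limit profile,
    then [a >= G v] for some [v] in [[a, b]], which fails for [a <= zeta1].
    Translating it so that it first reaches a small level at time 0 and letting
    [eps -> 0] gives a solution that stays below this level on [(-oo, 0]].

    Since [chi(0) < 0], [A] dominates near 0 a linear convolution operator whose kernel
    has compact support in [s] and mass [> 1]; since [chi] is positive at [sg lam], this
    kernel has positive first moment.  The mass makes the solution integrable near
    [-oo], hence tend to 0 there; the moment keeps it bounded away from 0 on [[0, +oo)].
    If it vanished somewhere, a Steinhaus argument would make it vanish near [-oo], so
    that it would be dominated by [B rho^n e^{lam t}] for every [n], with [rho < 1].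

    If [G] has a globally attracting fixed point, the interval [[a, b]] between the
    liminf and the limsup at [+oo] satisfies [[a, b] \subset G [a, b]], so [a = b]. *)

(** * Kuhn's combinatorial lemma *)

(** Since 0 is always a fixed point of [A], a fixed point theorem alone gives nothing: the bump
    excludes 0, and the cap [eps e^{lam t}] keeps the solution small to the left. The cap is
    inactive at the fixed point because [A] multiplies bounds [B e^{lam t}] by
    [rho = \int K g'(0) e^{-s sg lam} < 1]. Both devices degenerate as [eps -> 0], and the
    translation destroys the exponential bound; decay, positivity and persistence are therefore
    recovered from the limit equation itself. The atom of mass one at [tau0] turns the comparison of
    profiles into the scalar map [G]: with all [tau <> tau0] frozen at the lower end [a] of the
    range, [A phi <= a] yields [C g(v,tau0) <= Theta(a)], that is [G v <= a]. *)

Section Kuhn.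
Variable n : nat.
Local Notation vtx := ('I_n -> nat).
Implicit Types (x y z : vtx) (J : {set 'I_n}) (l : seq (vtx -> 'F_2)).

Definition upd x j v : vtx := fun k => if k == j then v else x k.
Local Notation inc x j := (upd x j (x j).+1).

Lemma upd_comm x j k u v : j != k -> upd (upd x j u) k v = upd (upd x k v) j u.
Proof.
move=> jk; apply/funext => i; rewrite /upd.
by case: (eqVneq i k) => [->|//]; rewrite eq_sym (negbTE jk).
Qed.

Lemma inc_comm x j k : inc (inc x j) k = inc (inc x k) j.
Proof.
have [->//|jk] := eqVneq j k.
have e i i' u : i != i' -> upd x i u i' = x i'.
  by move=> ii; rewrite /upd eq_sym (negbTE ii).
rewrite (e j k (x j).+1 jk) (e k j (x k).+1); last by rewrite eq_sym.
exact: upd_comm.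
Qed.

Lemma upd_upd x j u v : upd (upd x j u) j v = upd x j v.
Proof. by apply/funext => i; rewrite /upd; case: eqP. Qed.

(* Cup product of the coboundaries of the 0-cochains in [l], evaluated on the
   cube with base vertex [x] and directions [J]. *)
Fixpoint cup l x J : 'F_2 :=
  if l is a :: l' then
    \sum_(j in J) (a (inc x j) - a x) * cup l' (inc x j) (J :\ j)
  else 1.

Lemma cup_cons a l x J : cup (a :: l) x J =
  \sum_(j in J) (a (inc x j) - a x) * cup l (inc x j) (J :\ j).
Proof. by []. Qed.

Lemma sub_F2 (u v : 'F_2) : u - v = u + v.
Proof. by rewrite (oppr_pchar2 _) // (@pchar_Fp 2). Qed.

(** The terms [(j,k)] and [(k,j)] cancel in characteristic two: this is [d d = 0] for cubes, free of
    signs. *)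
Lemma sum_sym_F2 (f : 'I_n -> 'I_n -> 'F_2) J : (forall j k, f j k = f k j) ->
  \sum_(j in J) \sum_(k in J :\ j) f j k = 0.
Proof.
move=> fC; rewrite pair_big_dep/=.
rewrite (bigID (fun p : 'I_n * 'I_n => p.1 < p.2)%N)/=.
rewrite [X in _ + X](_ : _ =
  \sum_(p | ((p.1 \in J) && (p.2 \in J :\ p.1)) && (p.1 < p.2)%N) f p.1 p.2).
  by rewrite -sub_F2 subrr.
rewrite (reindex_inj (h := fun p : 'I_n * 'I_n => (p.2, p.1)))/=; last first.
  by move=> [a b] [c e] /= [-> ->].
apply: eq_big => [[a b]/=|[a b] _ /=]; last exact: fC.
rewrite !inE -leqNgt; have [->|ab] := eqVneq a b; first by rewrite andbF ltnn andbF.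
rewrite ltn_neqAle (inj_eq val_inj) ab /=.
by case: (b \in J); case: (a \in J).
Qed.

(** Leibniz rule; the term [a x] times the coboundary of [cup l] drops out because [cup l] is closed
    on this cube. *)
Lemma cup_coboundary a l x J :
  (\sum_(j in J) (cup l (inc x j) (J :\ j) - cup l x (J :\ j)) = 0) ->
  cup (a :: l) x J = \sum_(j in J)
    (a (inc x j) * cup l (inc x j) (J :\ j) - a x * cup l x (J :\ j)).
Proof.
move=> cl; rewrite cup_cons.
transitivity (\sum_(j in J) ((a (inc x j) - a x) * cup l (inc x j) (J :\ j)) +
    a x * (\sum_(j in J) (cup l (inc x j) (J :\ j) - cup l x (J :\ j)))).
  by rewrite cl mulr0 addr0.
rewrite mulr_sumr -big_split; apply: eq_bigr => j _ /=.
by rewrite mulrBl mulrBr addrA subrK.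
Qed.

(** By induction [cup (a :: l)] is itself the coboundary of the cochain [c], so its own coboundary
    is a sum of second differences of [c], symmetric in the two directions. *)
Lemma cup_closed l x J :
  \sum_(j in J) (cup l (inc x j) (J :\ j) - cup l x (J :\ j)) = 0.
Proof.
elim: l x J => [|a l IH] x J; first by apply: big1 => j _; rewrite subrr.
pose c y K := a y * cup l y K.
have cupE y K : cup (a :: l) y K =
    \sum_(j in K) (c (inc y j) (K :\ j) - c y (K :\ j)).
  by apply: cup_coboundary; exact: IH.
pose f j k := let K := J :\ j :\ k in
  (c (inc (inc x j) k) K - c (inc x j) K) - (c (inc x k) K - c x K).
rewrite -[RHS](@sum_sym_F2 f J) => [|j k].
  by apply: eq_bigr => j _; rewrite !cupE -sumrB.
rewrite /f inc_comm; have -> : J :\ j :\ k = J :\ k :\ j.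
  by apply/setP => i; rewrite !inE andbCA.
by rewrite !sub_F2 [LHS]addrACA.
Qed.

(** Every term of the product contains a difference of [b] along an edge of the face, and these
    vanish. This kills the boundary faces in the degree count. *)
Lemma cup_const b l x J j : b \in l -> j \notin J ->
  (forall y k, y j = x j -> k \in J -> b (inc y k) = b y) -> cup l x J = 0.
Proof.
elim: l x J => // a l IH x J; rewrite inE => bl jJ bc.
rewrite cup_cons big1 // => k kJ; case/predU1P: bl => [<-|bl].
  by rewrite bc // subrr mul0r.
rewrite (IH _ _ bl) ?mulr0 //; first by rewrite !inE (negbTE jJ) andbF.
move=> y i yx; rewrite !inE => /andP[_ iJ]; apply: bc => //.
rewrite yx /upd; case: eqP => // jk; by rewrite jk kJ in jJ.
Qed.

(** A nonzero product has a nonzero term, that is, a monotone path of edges in the cube along which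
    each cochain changes on its own edge. *)
Lemma cup_neq0 l x J : cup l x J != 0 -> forall a, a \in l ->
  exists y z, [/\ forall j, (x j <= y j <= (x j).+1)%N,
    forall j, (x j <= z j <= (x j).+1)%N & a y != a z].
Proof.
suff H l' y J' : cup l' y J' != 0 -> forall a, a \in l' ->
    exists u v, [/\ forall j, (y j <= u j <= (y j + (j \in J')))%N,
    forall j, (y j <= v j <= (y j + (j \in J')))%N & a u != a v].
  move=> /H{}H a /H[y [z [xy xz yz]]]; exists y, z; split => // j;
  [have /andP[-> h] := xy j | have /andP[-> h] := xz j];
    by rewrite (leq_trans h) // -addn1 leq_add2l leq_b1.
elim: l' y J' => // b l' IH y J' nz a.
have [/= k /andP[kJ nzk]] : exists k, (k \in J') &&
    ((b (inc y k) - b y) * cup l' (inc y k) (J' :\ k) != 0).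
  apply/existsP; apply/contraNT: nz => /existsPn h; rewrite cup_cons big1 // => k kJ.
  by have := h k; rewrite kJ /= negbK => /eqP.
move: nzk; rewrite mulf_eq0 negb_or subr_eq0 => /andP[nb nc].
rewrite inE => /predU1P[->|al].
  exists (inc y k), y; split => [j|j|]; last by [].
    rewrite /upd; case: eqP => [->|_]; last by rewrite leqnn leq_addr.
    by rewrite kJ addn1 leqnn leqnSn.
  by rewrite leqnn leq_addr.
have [u [v [yu yv uv]]] := IH _ _ nc a al.
have aux w j : (inc y k j <= w j <= inc y k j + (j \in J' :\ k))%N ->
    (y j <= w j <= y j + (j \in J'))%N.
  rewrite /upd !inE; case: eqP => [->|_] //=; rewrite addn0 => /andP[h1 h2].
  by rewrite (ltnW h1) kJ addn1.
by exists u, v; split => // j; apply: aux.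
Qed.

Variable p : nat.

(** Coordinates outside [js] keep their value in [x], so that the same sum also runs over the faces
    of the box. *)
Fixpoint box_sum (js : seq 'I_n) (f : vtx -> 'F_2) x : 'F_2 :=
  if js is j :: r then \sum_(i < p) box_sum r f (upd x j i) else f x.

Lemma box_sum_sum (I : Type) (r : seq I) (P : pred I) js (f : I -> vtx -> 'F_2) x :
  box_sum js (fun y => \sum_(i <- r | P i) f i y) x =
  \sum_(i <- r | P i) box_sum js (f i) x.
Proof.
elim: js x => //= j js IH x; rewrite exchange_big /=.
by apply: eq_bigr => i _; rewrite IH.
Qed.

Lemma box_sum0 js x : box_sum js (fun=> 0) x = 0.
Proof. by elim: js x => //= j js IH x; apply: big1 => i _; exact: IH. Qed.

Lemma box_sum_upd js f x j u : j \notin js ->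
  box_sum js f (upd x j u) = box_sum js (fun y => f (upd y j u)) x.
Proof.
elim: js x => //= k js IH x; rewrite inE negb_or => /andP[jk jjs].
by apply: eq_bigr => i _; rewrite upd_comm // IH.
Qed.

Lemma box_sum_rem js f x j : uniq js -> j \in js ->
  box_sum js f x = box_sum (rem j js) (fun y => \sum_(i < p) f (upd y j i)) x.
Proof.
elim: js x => //= k js IH x /andP[kjs ujs]; rewrite inE eq_sym.
case: eqP => [<- _|kj /= jjs].
  by rewrite box_sum_sum; apply: eq_bigr => i _; rewrite box_sum_upd.
by apply: eq_bigr => i _; rewrite IH.
Qed.

Lemma box_sum_telescope js (c : vtx -> 'F_2) x j : uniq js -> j \in js ->
  box_sum js (fun y => c (inc y j) - c y) x =
  box_sum (rem j js) (fun y => c (upd y j p) - c (upd y j 0)) x.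
Proof.
move=> ujs jjs; rewrite (box_sum_rem _ _ ujs jjs).
congr (box_sum _ _ _); apply/funext => y.
rewrite -(telescope_sumr (fun i => c (upd y j i)) (leq0n p)) big_mkord.
by apply: eq_bigr => i _; rewrite upd_upd /upd eqxx.
Qed.

Lemma box_sum_neq0 js f x : box_sum js f x != 0 ->
  exists2 y, f y != 0 & forall j, j \in js -> (y j < p)%N.
Proof.
suff H : box_sum js f x != 0 -> exists2 y, f y != 0 &
    forall j, (j \in js -> (y j < p)%N) /\ (j \notin js -> y j = x j).
  by move=> /H[y fy hy]; exists y => // j /(proj1 (hy j)).
elim: js x => /= [|k js IH] x nz; first by exists x.
have [i nzi] : exists i : 'I_p, box_sum js f (upd x k i) != 0.
  apply/existsP; apply/contraNT: nz => /existsPn h; rewrite big1 // => i _.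
  by have := h i; rewrite negbK => /eqP.
have [y fy hy] := IH _ nzi; exists y => // j; have [h1 h2] := hy j.
rewrite inE negb_or; have [jjs|njs] := boolP (j \in js).
  by rewrite orbT andbF; split=> // _; apply: h1.
rewrite orbF andbT (h2 njs) /upd; split => [/eqP ->|/negbTE -> //].
by rewrite eqxx ltn_ord.
Qed.

(* Discrete Stokes formula: only the face [x j0 = p] contributes, since every
   other face kills one of the factors. *)
Lemma box_degree (a : 'I_n -> vtx -> 'F_2) js x :
  (forall j y, y j = 0%N -> a j y = 0) -> (forall j y, y j = p -> a j y = 1) ->
  uniq js -> box_sum js (fun y => cup (map a js) y [set j in js]) x = 1.
Proof.
move=> a0 a1; elim: js x => //= j0 r IH x /andP[j0r ur].
set J := [set j in _].
pose c j y := a j0 y * cup (map a r) y (J :\ j).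
have Hj j : j \in j0 :: r ->
    \sum_(i < p) box_sum r (fun y => c j (inc y j) - c j y) (upd x j0 i) =
    (j == j0)%:R.
  move=> jr; have ujs : uniq (j0 :: r) by rewrite /= j0r.
  have := @box_sum_telescope _ (c j) x j ujs jr; rewrite /= => ->.
  have [->|jj0] := eqVneq j j0.
    rewrite -[RHS](IH (upd x j0 p) ur) box_sum_upd //.
    congr (box_sum _ _ _); apply/funext => y; rewrite /c.
    rewrite a1 ?mul1r ?a0 ?mul0r ?subr0; try by rewrite /upd eqxx.
    congr cup; apply/setP => i; rewrite !inE.
    by case: eqP => // ->; rewrite (negbTE j0r).
  move: jr; rewrite inE (negbTE jj0) /= => jr.
  have z y v : (v = 0 \/ v = p)%N -> c j (upd y j v) = 0.
    move=> hv; rewrite /c (@cup_const (a j) _ _ _ j) ?mulr0 //.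
    - exact: map_f.
    - by rewrite !inE eqxx.
    - move=> w k; rewrite {1}/upd eqxx !inE => wv /andP[kj _].
      have wk : upd w k (w k).+1 j = w j by rewrite /upd eq_sym (negbTE kj).
      by case: hv => hv; rewrite hv in wv; [rewrite !a0|rewrite !a1] => //;
        rewrite wk.
  have -> : (fun y => c j (upd y j p) - c j (upd y j 0)) = fun=> 0.
    by apply/funext => y; rewrite !z ?subrr; auto.
  by rewrite [LHS](box_sum0 (j0 :: rem j r)).
transitivity (\sum_(j in J) (j == j0)%:R : 'F_2); last first.
  rewrite (bigD1 j0) ?inE ?eqxx //= big1 ?addr0 // => j /andP[_ /negbTE ->].
  by [].
transitivity (\sum_(j in J) \sum_(i < p)
    box_sum r (fun y => c j (inc y j) - c j y) (upd x j0 i)); last first.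
  by apply: eq_bigr => j; rewrite inE; exact: Hj.
rewrite exchange_big /=; apply: eq_bigr => i _.
rewrite -box_sum_sum; congr (box_sum _ _ _); apply/funext => y.
by rewrite -(@cup_coboundary (a j0)) //; exact: cup_closed.
Qed.

End Kuhn.

(** With the labels read as 0-cochains, the cup products over all cells add up to 1 in [F_2], so
    some cell carries a nonzero product, and there every label takes both values. Parity replaces
    the orientation of degree theory. *)
Lemma kuhn_cell (n p : nat) (lab : 'I_n -> ('I_n -> nat) -> bool) :
  (forall j y, y j = 0%N -> lab j y = false) ->
  (forall j y, y j = p -> lab j y = true) ->
  exists c : 'I_n -> nat, (forall j, (c j < p)%N) /\
    forall i, exists y z, [/\ forall j, (c j <= y j <= (c j).+1)%N,
      forall j, (c j <= z j <= (c j).+1)%N, lab i y = false & lab i z = true].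
Proof.
move=> l0 l1; pose a j y : 'F_2 := (lab j y)%:R.
have H := @box_degree n p a (enum (ordinal n)) (fun=> 0%N).
have {}H : box_sum p (enum 'I_n) (fun y => cup (map a (enum 'I_n)) y
    [set j in enum 'I_n]) (fun=> 0%N) != 0.
  rewrite H ?oner_neq0 ?enum_uniq // /a => j y; first by move=> /l0 ->.
  by move=> /l1 ->.
have [c nz cp] := box_sum_neq0 H.
exists c; split => [j|i]; first by apply: cp; rewrite mem_enum.
have [|y [z [cy cz]]] := cup_neq0 nz (a := a i).
  by apply: map_f; rewrite mem_enum.
rewrite /a; case ly : (lab i y); case lz : (lab i z) => //= _.
- by exists z, y.
- by exists y, z.
Qed.

(** * Compactness and a fixed point theorem *)

Section Compactness.
Context {R : realType}.

Definition ucont (phi : R -> R) := forall e : R, 0 < e ->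
  exists2 d : R, 0 < d & forall t t', `|t - t'| < d -> `|phi t - phi t'| <= e.

Definition equicont (I : Type) (f : I -> R -> R) :=
  forall e : R, 0 < e -> exists2 d : R, 0 < d &
    forall i t t', `|t - t'| < d -> `|f i t - f i t'| <= e.

Lemma ultra_limit (U : set_system nat) (u : nat -> R) (M : R) :
  UltraFilter U -> (forall n, 0 <= u n <= M) ->
  exists l, forall e, 0 < e -> U [set n | `|u n - l| <= e].
Proof.
move=> UU uM; pose S := [set a | U [set n | a <= u n]].
have S0 : S 0.
  by rewrite /S /=; apply: filterS filterT => n _ /=; case/andP: (uM n).
have SM : ubound S M.
  move=> a Sa; have [n /= an] := filter_ex Sa.
  by rewrite (le_trans an) //; case/andP: (uM n).
have hS : has_sup S by split; [exists 0|exists M].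
exists (sup S) => e e0; have [a Sa ea] := sup_adherent e0 hS.
have nS : ~ S (sup S + e).
  by move=> h; have := sup_ubound (proj2 hS) h; rewrite leNgt ltrDl e0.
have [//|h] := in_ultra_setVsetC [set n | sup S + e <= u n] UU.
apply: filterS2 Sa h => n /= an /negP; rewrite -ltNge => un.
by rewrite ler_distl; lra.
Qed.

(** Arzela-Ascoli with pointwise limits. An ultrafilter provides the limits at all points at once;
    by equicontinuity, indices that follow [phi] along the rationals give convergence everywhere. *)
Lemma equicont_subseq (M : R) (f : nat -> R -> R) :
  (forall n t, 0 <= f n t <= M) -> equicont f ->
  exists (s : nat -> nat) (phi : R -> R), (forall n, (n <= s n)%N) /\
    forall t, f (s n) t @[n --> \oo] --> phi t.
Proof.
move=> fM fe; have [U [UU oU]] := ultraFilterLemma (@eventually_filter).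
have /choice[phi Hphi] t : exists l, forall e, 0 < e -> U [set n | `|f n t - l| <= e].
  exact: (@ultra_limit U (fun n => f n t) M).
have phie e : 0 < e -> exists2 d : R, 0 < d &
    forall t t', `|t - t'| < d -> `|phi t - phi t'| <= e.
  move=> e0; have e3 : 0 < e / 3 by lra.
  have [d d0 hd] := fe _ e3; exists d => // t t' /hd h.
  have [n /= [h1 h2]] := filter_ex (filterI (Hphi t _ e3) (Hphi t' _ e3)).
  by have := h n; move: h1 h2; rewrite !ler_norml; lra.
(* [q] enumerates the rationals; [f (s k)] will agree with [phi] up to [1/(k+1)] at the first [k] of
   them. *)
pose q i : R := if unpickle i is Some r then ratr r else 0.
have /choice[s Hs] k : exists m, (k <= m)%N /\
    forall i, (i < k)%N -> `|f m (q i) - phi (q i)| <= k.+1%:R^-1.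
  suff : U [set m | (k <= m)%N /\
      forall i, (i < k)%N -> `|f m (q i) - phi (q i)| <= k.+1%:R^-1].
    exact: filter_ex.
  apply: filterI; first by apply: oU; exists k.
  suff H j : U [set m | forall i, (i < j)%N ->
      `|f m (q i) - phi (q i)| <= k.+1%:R^-1] by exact: H.
  elim: j => [|j IH]; first exact: filterS filterT.
  have k0 : 0 < k.+1%:R^-1 :> R by rewrite invr_gt0.
  apply: filterS2 IH (Hphi (q j) _ k0) => m /= h1 h2 i.
  by rewrite ltnS leq_eqVlt => /predU1P[->|/h1].
exists s, phi; split=> [n|t]; first by case: (Hs n).
apply/cvgrPdist_le => e e0; have e3 : 0 < e / 3 by lra.
have [d1 d10 h1] := fe _ e3; have [d2 d20 h2] := phie _ e3.
have dd : 0 < Num.min d1 d2 by rewrite lt_min d10.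
have [r] : exists r, t - Num.min d1 d2 < ratr r < t.
  by have := @rat_in_itvoo R (t - Num.min d1 d2) t; rewrite gtrDl oppr_lt0 => /(_ dd)[r];
     rewrite in_itv /=; exists r.
have [m1 m2] : Num.min d1 d2 <= d1 /\ Num.min d1 d2 <= d2.
  by rewrite !ge_min !lexx orbT.
move=> /andP[r1 r2].
have qr : q (pickle r) = ratr r by rewrite /q pickleK.
near=> n.
have : `|f (s n) (ratr r) - phi (ratr r)| <= e / 3.
  rewrite -qr; apply: le_trans (proj2 (Hs n) _ _) _.
    by near: n; exists (pickle r).+1.
  by near: n; apply: filterS (near_infty_natSinv_lt (PosNum e3)) => n /ltW.
have tr : `|t - ratr r| < Num.min d1 d2.
  by rewrite ger0_norm ?subr_ge0 ?ltW //; lra.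
have := h1 (s n) _ _ (lt_le_trans tr m1); have := h2 _ _ (lt_le_trans tr m2).
by rewrite !ler_norml; lra.
Unshelve. all: by end_near. Qed.

Lemma equicont_limit (I : Type) (f : I -> R -> R) (s : nat -> I) (phi : R -> R) :
  equicont f -> (forall t, f (s n) t @[n --> \oo] --> phi t) ->
  ucont phi.
Proof.
move=> fe fphi e /fe[d d0 hd]; exists d => // t t' tt'.
have h : `|f (s n) t - f (s n) t'| @[n --> \oo] --> `|phi t - phi t'|.
  by apply: cvg_norm; apply: cvgB; exact: fphi.
have := limr_le (cvgP _ h); rewrite (cvg_lim _ h) //; apply.
by near=> n; exact: hd.
Unshelve. all: by end_near. Qed.

Lemma ucont_continuous phi : ucont phi -> continuous phi.
Proof.
move=> h t; apply/cvgrPdist_le => e /h[d d0 hd].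
by near=> t'; apply: hd; near: t'; exact: cvgr_dist_lt.
Unshelve. all: by end_near. Qed.

(** The step functions of the discretisation: for [c > 0], the value is [v i] on the [i]-th cell of
    length [1/c] counted from [-L]. Negative numbers truncate to 0, so [v 0] also extends to the
    left. *)
Lemma measurable_step (v : nat -> R) (c L : R) :
  measurable_fun setT (fun t : R => v (Num.truncn (c * (t + L)))).
Proof.
pose h t : R := c * (t + L).
have mh : measurable_fun setT h.
  by apply: measurable_funM => //; apply: measurable_funD.
move=> _ B mB; rewrite setTI.
rewrite (_ : _ @^-1` _ = \bigcup_(k in [set k | B (v k)])
    (h @^-1` [set x | Num.truncn x = k])); last first.
  apply/seteqP; split => t /=; first by move=> Bt; exists (Num.truncn (h t)).
  by move=> [k /= Bk kE]; rewrite -/(h t) kE.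
apply: bigcup_measurable => k _; rewrite -[X in measurable X]setTI; apply: mh => //.
rewrite (_ : [set x | _] =
  (if k == 0%N then `]-oo, 1[ else `[k%:R, k.+1%:R[)%classic); last first.
  apply/seteqP; split => x /=.
    move=> <-; case: ifPn => [/eqP|]; rewrite /= in_itv /=.
      move=> x0; rewrite ltNge; apply/negP => x1.
      by have := truncn_ge_nat 1 (le_trans ler01 x1); rewrite x0 x1.
    rewrite -lt0n truncn_gt0 => x1; exact: (truncn_itv (le_trans ler01 x1)).
  case: ifPn => [/eqP ->|k0]; rewrite /= in_itv /=; last exact: truncn_def.
  have [x0|x0] := leP 0 x; first by move=> x1; apply: truncn_def; rewrite x0.
  by move=> _; apply/eqP; rewrite -leqn0 leqNgt truncn_gt0 -ltNge (lt_trans x0).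
by case: ifP.
Qed.

End Compactness.

Section FixedPoint.
Context {R : realType}.
Local Notation meas := (measurable_fun [set: R]).
Variables (M : R) (T : (R -> R) -> R -> R).
Hypothesis M0 : 0 < M.
Hypothesis T_range : forall (phi : R -> R) t, meas phi -> 0 <= T phi t <= M.
Hypothesis T_equicont :
  equicont (fun phi : {phi : R -> R | meas phi} => T (sval phi)).
Hypothesis T_unif : forall e : R, 0 < e -> exists2 d : R, 0 < d &
  forall phi psi : R -> R, meas phi -> meas psi -> (forall t, `|phi t - psi t| <= d) ->
  forall t, `|T phi t - T psi t| <= e.
Hypothesis T_pointwise : forall (f : nat -> R -> R) (phi : R -> R),
  (forall n, meas (f n)) -> meas phi ->
  (forall t, f n t @[n --> \oo] --> phi t) ->
  forall t, T (f n) t @[n --> \oo] --> T phi t.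

Let T_equi (e : R) : 0 < e -> exists2 d : R, 0 < d & forall (phi : R -> R) t t', meas phi ->
  `|t - t'| < d -> `|T phi t - T phi t'| <= e.
Proof.
move=> /T_equicont[d d0 hd]; exists d => // phi t t' mphi.
exact: (hd (exist _ phi mphi)).
Qed.

(** Time is cut into cells of length [1/k] and values into multiples of [u = M / p]. Each label
    compares a value with [T phi] at the left end of its cell; where all labels change, [T phi] is
    close to [phi], up to one error from equicontinuity, one from [T_unif] and one from the rounding
    [u]. *)
Lemma approx_fixed_point (e L : R) : 0 < e -> 0 < L -> exists2 phi : R -> R, meas phi &
  forall t, `|t| <= L -> `|T phi t - phi t| <= e.
Proof.
move=> e0 L0; have e3 : 0 < e / 3 by lra.
have [d1 d10 h1] := T_equi e3; have [d2 d20 h2] := T_unif e3.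
pose k := (Num.truncn d1^-1).+1.
have k0 : 0 < k%:R :> R by [].
have kd : k%:R^-1 < d1 by rewrite invf_plt ?posrE // truncnS_gt.
pose c := Num.min d2 (e / 3); have c0 : 0 < c by rewrite lt_min d20.
pose p := (Num.truncn (M / c)).+1.
have p0 : 0 < p%:R :> R by [].
pose u := M / p%:R.
have u0 : 0 < u by rewrite divr_gt0.
have uc : u <= c.
  by rewrite ler_pdivrMr // mulrC -ler_pdivrMr // ltW // truncnS_gt.
have [ud ue] : u <= d2 /\ u <= e / 3.
  by split; apply: (le_trans uc); rewrite ge_min lexx ?orbT.
pose N := (Num.truncn (k%:R * (L + L))).+1.
pose v (x : 'I_N -> nat) (i : nat) : R :=
  if insub i is Some j then u * (x j)%:R else 0.
pose phi x t := v x (Num.truncn (k%:R * (t + L))).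
have mphi x : meas (phi x) by exact: measurable_step.
pose pt (j : 'I_N) : R := j%:R / k%:R - L.
(* The conjunct [0 < x j] makes the label false on the face [x j = 0]; on the face [x j = p] the
   value is [M], and [T_range] makes it true. *)
pose lab j x := (0 < x j)%N && (T (phi x) (pt j) <= u * (x j)%:R).
have [|j y yp|q [qp hq]] := @kuhn_cell N p lab.
- by move=> j y y0; rewrite /lab y0.
- rewrite /lab yp /=; have /andP[_ h] := T_range (pt j) (mphi y).
  by rewrite (le_trans h) // /u divfK // lt0r_neq0.
have near_q x : (forall j, (q j <= x j <= (q j).+1)%N) ->
    forall t, `|T (phi x) t - T (phi q) t| <= e / 3.
  move=> hx; apply: h2 => // t; rewrite /phi /v.
  case: insub => [j|]; last by rewrite subrr normr0 ltW.
  have /andP[a b] := hx j; rewrite -mulrBr normrM (gtr0_norm u0).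
  rewrite (le_trans _ ud) // ger_pMr // -natrB // ger0_norm //.
  by rewrite lern1 leq_subLR addn1.
exists (phi q) => // t tL.
have tL0 : 0 <= k%:R * (t + L).
  by rewrite mulr_ge0 //; move: tL; rewrite ler_norml; lra.
have iN : (Num.truncn (k%:R * (t + L)) < N)%N.
  rewrite ltnS le_truncn // ler_wpM2l //.
  by move: tL; rewrite ler_norml; lra.
pose i := Ordinal iN.
have phii : phi q t = u * (q i)%:R.
  rewrite /phi /v; case: insubP => [j _ ji|]; last by rewrite iN.
  by congr (_ * (q _)%:R); exact: val_inj.
have tpt : `|t - pt i| < d1.
  apply: le_lt_trans kd; have /andP[a b] := truncn_itv tL0.
  rewrite -[X in X <= _](mulKf (lt0r_neq0 k0)) mulrC ler_pdivrMr // mulVf ?lt0r_neq0 //.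
  rewrite -{1}(gtr0_norm k0) -normrM /pt /= opprB addrA mulrBr mulrCA divff ?lt0r_neq0 //.
  rewrite mulr1 ger0_norm ?subr_ge0 //.
  by rewrite lerBlDl; move: b; rewrite -natr1 => /ltW.
have [y [z [qy qz ly lz]]] := hq i.
have H1 := near_q _ qy (pt i); have H2 := near_q _ qz (pt i).
have H3 := h1 (phi q) t (pt i) (mphi q) tpt.
have A : u * (q i)%:R <= T (phi y) (pt i).
  move: ly; rewrite /lab lt0n => /negbT; rewrite negb_and negbK -ltNge.
  have /andP[qyi _] := qy i; case/orP => [/eqP y0|/ltW h].
    move: qyi; rewrite y0 leqn0 => /eqP ->; rewrite mulr0.
    by case/andP: (T_range (pt i) (mphi y)).
  by apply: le_trans h; rewrite ler_pM2l // ler_nat.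
have B : T (phi z) (pt i) <= u * (q i)%:R + u.
  case/andP: lz => _ h; apply: (le_trans h).
  have /andP[_ qzi] := qz i; rewrite -[X in _ + X]mulr1 -mulrDr natr1.
  by rewrite ler_pM2l // ler_nat.
by rewrite phii; move: H1 H2 H3; rewrite !ler_norml; lra.
Qed.

(** The approximate fixed points [f n] are step functions without a common modulus of continuity;
    compactness is applied to their images [T (f n)], which are close to them on growing
    intervals. *)
Lemma fixed_point : exists2 phi : R -> R, meas phi & forall t, T phi t = phi t.
Proof.
have /choice[f Hf] (n : nat) : exists phi : R -> R, meas phi /\
    forall t, `|t| <= n.+1%:R -> `|T phi t - phi t| <= n.+1%:R^-1.
  have [||phi h1 h2] := @approx_fixed_point n.+1%:R^-1 n.+1%:R; rewrite ?invr_gt0 //.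
  by exists phi.
have mf n : meas (f n) by case: (Hf n).
pose g n := T (f n).
have ge : equicont g.
  move=> e /T_equi[d d0 hd]; exists d => // n t t'; exact: hd.
have [|s [phi [sn hs]]] := @equicont_subseq R M g _ ge.
  by move=> n t; exact: T_range.
have cphi : continuous phi.
  apply: ucont_continuous; apply: (equicont_limit (s := s) ge hs).
have mphi : meas phi by exact: continuous_measurable_fun.
exists phi => // t.
have fphi u : f (s n) u @[n --> \oo] --> phi u.
  apply/cvgrPdist_le => e e0; have e2 : 0 < e / 2 by lra.
  near=> n; have : `|phi u - g (s n) u| <= e / 2.
    by near: n; move: (hs u) => /cvgrPdist_le; apply.
  have : `|g (s n) u - f (s n) u| <= e / 2.
    apply: (le_trans (proj2 (Hf (s n)) u _)).
      apply: (@le_trans _ _ n%:R); last by rewrite ler_nat (leq_trans (sn n)).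
      by near: n; exact: nbhs_infty_ger.
    apply: (@le_trans _ _ n.+1%:R^-1).
      by rewrite lef_pV2 ?posrE // ler_nat ltnS.
    by near: n; apply: filterS (near_infty_natSinv_lt (PosNum e2)) => n /ltW.
  by rewrite !ler_norml; lra.
have h := @T_pointwise (fun n => f (s n)) phi (fun n => mf (s n)) mphi fphi t.
exact: (cvg_unique _ h (hs t)).
Unshelve. all: by end_near. Qed.

End FixedPoint.

(** * Real sequences and interval maps *)

Section RealSequences.
Context {R : realType}.
Implicit Types (f g : nat -> R) (phi : R -> R).

Lemma cvg_le f g (a b : R) : (\forall n \near \oo, f n <= g n) ->
  f n @[n --> \oo] --> a -> g n @[n --> \oo] --> b -> a <= b.
Proof.
move=> fg fa gb; rewrite -(cvg_lim _ fa) // -(cvg_lim _ gb) //.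
by apply: ler_lim => //; [exact: cvgP fa|exact: cvgP gb].
Qed.

Lemma cvg_dist_le f g (a b : R) : (forall n, `|f n - a| <= `|g n - b|) ->
  g n @[n --> \oo] --> b -> f n @[n --> \oo] --> a.
Proof.
move=> fg /cvgrPdist_le gb; apply/cvgrPdist_le => e /gb; apply: filterS => n h.
by rewrite distrC (le_trans (fg n)) // distrC.
Qed.

Lemma max_lip (a b c d : R) :
  `|Num.max a b - Num.max c d| <= Num.max `|a - c| `|b - d|.
Proof.
set m := Num.max `|a - c| _.
have h1 : `|a - c| <= m by rewrite le_max lexx.
have h2 : `|b - d| <= m by rewrite le_max lexx orbT.
move: h1 h2; rewrite !ler_norml; clearbody m.
by case: (leP a b); case: (leP c d); lra.
Qed.

Lemma min_lip (a b c d : R) :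
  `|Num.min a b - Num.min c d| <= Num.max `|a - c| `|b - d|.
Proof.
set m := Num.max `|a - c| _.
have h1 : `|a - c| <= m by rewrite le_max lexx.
have h2 : `|b - d| <= m by rewrite le_max lexx orbT.
move: h1 h2; rewrite !ler_norml; clearbody m.
by case: (leP a b); case: (leP c d); lra.
Qed.

Lemma le_lin_eps (a b c : R) : 0 <= c -> (forall e, 0 < e -> a <= b + c * e) -> a <= b.
Proof.
move=> c0 h; apply/ler_addgt0Pr => e e0.
have c1 : 0 < c + 1 by lra.
apply: le_trans (h (e / (c + 1)) (divr_gt0 e0 c1)) _.
rewrite lerD2l mulrCA ger_pMr // ler_pdivrMr // mul1r; lra.
Qed.

Lemma ucont_equicont phi (T : nat -> R) : ucont phi ->
  equicont (fun n u => phi (u + T n)).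
Proof.
move=> h e /h[d d0 hd]; exists d => // n t t' tt; apply: hd.
by rewrite opprD addrACA subrr addr0.
Qed.

(** [a] and [b] are the lower and upper limits at [+oo], each with a sequence of times realising it;
    the upper one is obtained from the lower limit of [Z - phi]. *)
Lemma omega_bounds phi (Z : R) : (forall t, 0 <= phi t <= Z) ->
  exists a b, [/\ 0 <= a, a <= b & b <= Z] /\
    [/\ forall e, 0 < e -> exists T : R, forall t, T <= t -> a - e <= phi t <= b + e,
     exists T : nat -> R, (forall n, n%:R <= T n) /\ phi (T n) @[n --> \oo] --> a &
     exists T : nat -> R, (forall n, n%:R <= T n) /\ phi (T n) @[n --> \oo] --> b].
Proof.
move=> phiZ.
have half psi : (forall t, 0 <= psi t <= Z) -> exists a, [/\ 0 <= a <= Z,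
    forall e, 0 < e -> exists T : R, forall t, T <= t -> a - e <= psi t &
    exists T : nat -> R, (forall n, n%:R <= T n) /\ psi (T n) @[n --> \oo] --> a].
  move=> psiZ; pose E := [set a : R | exists T : R, forall t, T <= t -> a <= psi t].
  have E0 : E 0 by exists 0 => t _; case/andP: (psiZ t).
  have EZ : ubound E Z.
    by move=> a [T hT]; apply: le_trans (hT T (lexx T)) _; case/andP: (psiZ T).
  have hE : has_sup E by split; [exists 0|exists Z].
  have lo e : 0 < e -> exists T : R, forall t, T <= t -> sup E - e <= psi t.
    move=> e0; have [a [T hT] ha] := sup_adherent e0 hE; exists T => t /hT.
    by apply: le_trans; exact: ltW.
  exists (sup E); split => //.
    by rewrite (sup_ubound hE.2 E0) ge_sup //; exists 0.
  have /choice[T HT] (n : nat) : exists t : R, n%:R <= t /\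
      psi t <= sup E + n.+1%:R^-1.
    apply: contrapT => h.
    have : E (sup E + n.+1%:R^-1).
      exists n%:R => t nt; rewrite leNgt; apply/negP => lt.
      by apply: h; exists t; split => //; exact: ltW.
    by move=> /(sup_ubound hE.2); rewrite leNgt ltrDl invr_gt0 ltr0n.
  exists T; split=> [n|]; first by case: (HT n).
  apply/cvgrPdist_le => e e0; have [T0 hT0] := lo _ e0.
  near=> n; have [h1 h2] := HT n.
  have h3 : T0 <= T n by apply: le_trans h1; near: n; exact: nbhs_infty_ger.
  have h4 : n.+1%:R^-1 <= e.
    by near: n; apply: filterS (near_infty_natSinv_lt (PosNum e0)) => n /ltW.
  have := hT0 _ h3; have := le_trans h2 (lerD (lexx _) h4).
  by rewrite ler_distl; lra.
have [a [/andP[a0 aZ] alo [T [T1 T2]]]] := half _ phiZ.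
have [|b' [/andP[b0 bZ] blo [S [S1 S2]]]] := half (fun t => Z - phi t).
  move=> t /=; have := phiZ t; lra.
have Sb : phi (S n) @[n --> \oo] --> Z - b'.
  have : Z - (Z - phi (S n)) @[n --> \oo] --> Z - b' by apply: cvgB => //; exact: cvg_cst.
  by apply: cvg_trans; apply: near_eq_cvg; near=> n; rewrite opprB addrC subrK.
exists a, (Z - b'); split; split.
- by [].
- apply/ler_addgt0Pr => e e0; have [T0 hT0] := alo _ e0.
  rewrite -lerBlDr; apply: (cvg_le (f := fun=> a - e) _ _ Sb); last exact: cvg_cst.
  near=> n; apply: hT0; apply: le_trans (S1 n); near: n; exact: nbhs_infty_ger.
- lra.
- move=> e e0; have [T0 h0] := alo _ e0; have [T3 h3] := blo _ e0.
  exists (Num.max T0 T3) => t; rewrite ge_max => /andP[/h0 A /h3 B].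
  by apply/andP; split => //; lra.
- by exists T.
- by exists S.
Unshelve. all: by end_near. Qed.

End RealSequences.

Section IntervalMap.
Context {R : realType}.
Variables (G : R -> R) (p q k : R).
Hypothesis pq : p < q.
Hypothesis Gc : continuous G.
Hypothesis G_in : forall x, p <= G x <= q.
Hypothesis Gp : p < G p.
Hypothesis G_attr : forall x, p <= x <= q -> iter n G x @[n --> \oo] --> k.

(** A periodic point recurs along its own orbit, which converges to [k]. *)
Let fix_k n x : p <= x <= q -> iter n.+1 G x = x -> x = k.
Proof.
move=> xpq xE; apply/esym/eqP; rewrite -subr_eq0 -normr_eq0 eq_le normr_ge0 andbT.
have E m : iter (m * n.+1) G x = x.
  by elim: m => // m IH; rewrite mulSn iterD IH xE.
apply/ler_addgt0Pr => e e0; rewrite add0r.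
have /cvgrPdist_le/(_ _ e0)[N _ HN] := G_attr xpq.
by rewrite -(E N); apply: HN => /=; rewrite leq_pmulr.
Qed.

Let ivt_sub (f : R -> R) a b : continuous f -> a <= b ->
  (a <= f a) -> (f b <= b) -> exists2 x, a <= x <= b & f x = x.
Proof.
move=> fc ab fa fb.
have hc : continuous (fun x => f x - x).
  by move=> x; apply: cvgB; [exact: fc|exact: cvg_id].
have := @IVT R (fun x => f x - x) a b 0 ab (continuous_subspaceT hc).
case; first by rewrite ge_min le_max; apply/andP; split; apply/orP; [right|left]; lra.
by move=> x; rewrite in_itv /= => xab /eqP; rewrite subr_eq0 => /eqP; exists x.
Qed.

Let k_in : p <= k <= q.
Proof.
have [||x xpq xE] := @ivt_sub G p q Gc (ltW pq); first exact: ltW.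
  by case/andP: (G_in q).
by rewrite -(@fix_k 0 x xpq xE).
Qed.

Let below x : p <= x -> x < k -> x < G x.
Proof.
move=> px xk; rewrite ltNge; apply/negP => h.
have [y yb yE] := ivt_sub Gc px (ltW Gp) h.
have : y = k by apply: (@fix_k 0) => //; have := k_in; lra.
by lra.
Qed.

Let above x : x <= q -> k < x -> G x < x.
Proof.
move=> xq kx; rewrite ltNge; apply/negP => h.
have [y yb yE] := ivt_sub Gc xq h (proj2 (andP (G_in q))).
have : y = k by apply: (@fix_k 0) => //; have := k_in; lra.
by lra.
Qed.

(** Otherwise [G o G], which maps [p] to a point [>= p], would have a fixed point in [[p, x]],
    whereas periodic points all equal [k]. *)
Let below2 x : p <= x -> x < k -> x < G (G x).
Proof.
move=> px xk; rewrite ltNge; apply/negP => h.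
have [||y yb yE] := @ivt_sub (G \o G) p x _ px _ h.
- by move=> z; apply: continuous_comp; exact: Gc.
- by case/andP: (G_in (G p)).
have : y = k by apply: (@fix_k 1) => //; have := k_in; lra.
by lra.
Qed.

(* A point of [[a, k)] mapped above [b] would, by the intermediate value
   theorem, give [x < k] with [G (G x) <= a <= x]. *)
Lemma attracting_expanded_interval a b v w : p <= a -> b <= q ->
  a <= v <= b -> a <= w <= b -> G v <= a -> b <= G w -> a = k /\ b = k.
Proof.
move=> pa bq vab wab Gv Gw.
have vk : k <= v by rewrite leNgt; apply/negP => h; have := @below v; lra.
have wk : w <= k by rewrite leNgt; apply/negP => h; have := @above w; lra.
have Gk : G k = k.
  have [||x xpq xE] := @ivt_sub G p q Gc (ltW pq); first exact: ltW.
    by case/andP: (G_in q).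
  by rewrite -(@fix_k 0 x xpq xE).
have ak : a = k.
  apply/eqP; rewrite eq_le (le_trans _ wk) ?(andP wab).1 //= leNgt; apply/negP => ak.
  have [vE|vk'] := eqVneq v k; first by move: Gv; rewrite vE Gk leNgt ak.
  have {vk'}vk : k < v by rewrite lt_neqAle eq_sym vk'.
  have [x xwk xE] : exists2 x, x \in `[w, k] & G x = v.
    apply: IVT => //; first exact: continuous_subspaceT.
    by rewrite Gk ge_min le_max; lra.
  move: xwk; rewrite in_itv /= => xwk.
  have [xk|xk] := eqVneq x k; first by move: xE; rewrite xk Gk; lra.
  have {xk}xk : x < k by rewrite lt_neqAle xk; lra.
  by have := @below2 x; rewrite xE; lra.
split=> //; apply/eqP; rewrite eq_le (le_trans vk) ?(andP vab).2 // andbT.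
have wE : w = k by lra.
by move: Gw; rewrite wE Gk.
Qed.

End IntervalMap.

(** * Wavefronts of an abstract monostable operator *)

Section WaveFront.
Context {R : realType}.
Local Notation meas := (measurable_fun [set: R]).
Variables (A : (R -> R) -> R -> R) (Z z1 lam rho S vs F m1 : R) (G : R -> R).
Implicit Types (phi psi : R -> R) (f : nat -> R -> R).
Hypothesis z1Z : 0 < z1 < Z.
Hypothesis lam0 : 0 < lam.
Hypothesis rho01 : 0 <= rho < 1.
Hypothesis S0 : 0 < S.
Hypothesis vs0 : 0 < vs.
Hypothesis F1 : 1 < F.
Hypothesis m10 : 0 < m1.

Hypothesis A_shift : forall phi c t, A (fun u => phi (u + c)) t = A phi (t + c).
Hypothesis A_range : forall phi t, meas phi -> 0 <= A phi t <= Z.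
Hypothesis A_equicont :
  equicont (fun phi : {phi : R -> R | meas phi} => A (sval phi)).
Hypothesis A_unif : forall e : R, 0 < e -> exists2 d : R, 0 < d &
  forall phi psi, meas phi -> meas psi -> (forall t, `|phi t - psi t| <= d) ->
  forall t, `|A phi t - A psi t| <= e.
Hypothesis A_pointwise : forall f phi, (forall n, meas (f n)) -> meas phi ->
  (forall t, f n t @[n --> \oo] --> phi t) ->
  forall t, A (f n) t @[n --> \oo] --> A phi t.
Hypothesis A_exp : forall phi (B t : R), meas phi -> 0 <= B ->
  (forall u, phi u <= B * expR (lam * u)) -> A phi t <= rho * B * expR (lam * t).
Hypothesis A_low : forall phi (c mu t : R), meas phi -> 0 <= c -> 0 <= mu ->
  c + mu * S <= vs -> (forall x : R, `|x| <= S -> c + mu * x <= phi (t - x)) ->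
  F * c + m1 * mu <= A phi t.
Hypothesis A_env_low : forall phi (a b t : R), continuous phi -> 0 <= a -> b <= Z ->
  (forall u, a <= phi u <= b) -> A phi t <= a -> exists2 v, a <= v <= b & G v <= a.
Hypothesis A_env_up : forall phi (a b t : R), continuous phi -> 0 <= a -> b <= Z ->
  (forall u, a <= phi u <= b) -> b <= A phi t -> exists2 v, a <= v <= b & b <= G v.
Hypothesis A_decay : forall phi, ucont phi -> (forall t, 0 <= phi t <= Z) ->
  (forall t, A phi t <= phi t) -> (forall t : R, t < 0 -> phi t <= vs) ->
  forall e : R, 0 < e -> exists T : R, forall t, t <= T -> phi t <= e.
Hypothesis A_zero : forall phi t, continuous phi -> (forall t, 0 <= phi t <= Z) ->
  (forall t, A phi t = phi t) -> phi t = 0 ->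
  exists T : R, forall u, u <= T -> phi u = 0.

Hypothesis Gz1 : z1 < G z1.
Hypothesis Gmin : forall s : R, z1 <= s <= Z -> G z1 <= G s.
Hypothesis Ggt : forall s : R, 0 < s <= z1 -> s < G s.

Let z10 : 0 < z1. Proof. by case/andP: z1Z. Qed.
Let z1ltZ : z1 < Z. Proof. by case/andP: z1Z. Qed.
Let Z0 : 0 < Z. Proof. exact: lt_trans z1ltZ. Qed.

Let ucont_meas phi : ucont phi -> meas phi.
Proof.
by move=> h; have /continuous_measurable_fun := ucont_continuous h.
Qed.

(** The shape of [phi] near the times [T n]: a limit of translates inherits the asymptotic bounds,
    and [A] passes to the limit because it commutes with translations. *)
Lemma profile phi (a b : R) (T : nat -> R) : ucont phi ->
  (forall t, 0 <= phi t <= Z) ->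
  (forall e, 0 < e -> exists T0 : R, forall t, T0 <= t -> a - e <= phi t <= b + e) ->
  (forall n, n%:R <= T n) ->
  exists s psi, [/\ (forall n, (n <= s n)%N), continuous psi,
    (forall u, a <= psi u <= b),
    (forall u, phi (u + T (s n)) @[n --> \oo] --> psi u) &
    (A phi (T (s n)) @[n --> \oo] --> A psi 0)].
Proof.
move=> uc phiZ ab Tn.
have ec := ucont_equicont T uc.
have [|s [psi [sn hs]]] := @equicont_subseq R Z (fun n u => phi (u + T n)) _ ec.
  by move=> n t; exact: phiZ.
have cpsi : continuous psi by apply: ucont_continuous; exact: equicont_limit ec hs.
have far u (T0 : R) : \forall n \near \oo, T0 <= u + T (s n).
  near=> n; rewrite -lerBlDl (le_trans _ (Tn _)) //.
  apply: (@le_trans _ _ n%:R); last by rewrite ler_nat.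
  by near: n; exact: nbhs_infty_ger.
exists s, psi; split => // [u|].
  apply/andP; split; apply/ler_addgt0Pr => e /ab[T0 hT0].
    rewrite -lerBlDr; apply: (cvg_le (f := fun=> a - e) _ _ (hs u)); last exact: cvg_cst.
    near=> n; have : T0 <= u + T (s n) by near: n; exact: far.
    by move=> /hT0 /andP[].
  apply: (cvg_le (g := fun=> b + e) _ (hs u)); last exact: cvg_cst.
  near=> n; have : T0 <= u + T (s n) by near: n; exact: far.
  by move=> /hT0 /andP[].
have E n : A (fun u => phi (u + T (s n))) 0 = A phi (T (s n)).
  by rewrite A_shift add0r.
rewrite -(eq_cvg _ _ E).
apply: (@A_pointwise (fun n u => phi (u + T (s n)))) => //.
  move=> n; apply: ucont_meas => e /uc[d d0 hd]; exists d => // t t' tt; apply: hd.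
  by rewrite opprD addrACA subrr addr0.
exact: continuous_measurable_fun.
Unshelve. all: by end_near. Qed.

(** The lower limit [a] is a value of a limit profile, to which [A_env_low] applies; [a >= c > 0]
    places the resulting [v] where [G v > v] is known if [v <= z1]. Stated for [A phi <= phi], so
    that it covers the perturbed solutions as well as the exact one. *)
Lemma liminf_gt phi (c T0 : R) : ucont phi -> (forall t, 0 <= phi t <= Z) ->
  (forall t, A phi t <= phi t) -> 0 < c -> (forall t, T0 <= t -> c <= phi t) ->
  exists a T : R, z1 < a /\ forall t, T <= t -> a <= phi t.
Proof.
move=> uc phiZ Aphi c0 cphi.
have [a [b [[a0 ab bZ] [hab [T [Tn Ta]] _]]]] := omega_bounds phiZ.
have ca : c <= a.
  apply: (cvg_le (f := fun=> c) _ _ Ta); last exact: cvg_cst.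
  near=> n; apply: cphi; apply: le_trans (Tn n); near: n; exact: nbhs_infty_ger.
have [s [psi [sn cpsi psiab hs hA]]] := profile uc phiZ hab Tn.
have psi0 : psi 0 = a.
  have E n : phi (0 + T (s n)) = phi (T (s n)) by rewrite add0r.
  have h : phi (T (s n)) @[n --> \oo] --> a.
    apply/cvgrPdist_le => e e0; move: Ta => /cvgrPdist_le/(_ _ e0)[N _ hN].
    by exists N => // n /= Nn; apply: hN => /=; rewrite (leq_trans Nn).
  by have := hs 0; rewrite (eq_cvg _ _ E) => h'; exact: (cvg_unique _ h' h).
have Apsi : A psi 0 <= a.
  rewrite -psi0; apply: (cvg_le _ hA (hs 0)).
  by near=> n; rewrite add0r.
have [v /andP[av vb] Gv] := A_env_low cpsi a0 bZ psiab Apsi.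
have z1a : z1 < a.
  rewrite ltNge; apply/negP => az1; have [vz|zv] := leP v z1.
    have : v < G v by apply: Ggt; lra.
    by lra.
  have : G z1 <= G v by apply: Gmin; lra.
  by move: Gz1; lra.
have e0 : 0 < (a - z1) / 2 by lra.
have [T1 hT1] := hab _ e0; exists (a - (a - z1) / 2), T1; split; first lra.
by move=> t /hT1 /andP[].
Unshelve. all: by end_near. Qed.

(** A profile below the cap by [1 + x <= e^x], Lipschitz with a constant that does not depend on
    [eps <= Z]; it equals [eps] on [[0, +oo)], which gives the positive lower bound needed for the
    lower limit. *)
Let bump (eps t : R) := eps * Num.min 1 (Num.max 0 (1 + lam * t)).

(** The last clause controls the modulus of continuity independently of [eps], so that these
    solutions stay in a compact family as [eps -> 0]. *)
Lemma perturbed_solution (eps : R) : 0 < eps <= Z -> exists phi,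
  [/\ meas phi, (forall t, 0 <= phi t <= Z),
    (forall t, A phi t <= phi t <= A phi t + eps),
    (forall t, phi t <= eps * expR (lam * t)) /\ (forall t, 0 <= t -> eps <= phi t) &
    (forall t t', `|phi t - phi t'| <=
       Num.max `|A phi t - A phi t'| (Z * lam * `|t - t'|))].
Proof.
move=> /andP[e0 eZ]; pose cap phi u := Num.min (phi u) (eps * expR (lam * u)).
have mcap phi : meas phi -> meas (cap phi).
  move=> mphi; apply: measurable_minr => //; apply: measurable_funM => //.
  apply: measurableT_comp => //; exact: measurable_funM.
pose T phi t := Num.max (A (cap phi) t) (bump eps t).
have be t : bump eps t <= eps * expR (lam * t).
  rewrite ler_pM2l // ge_min; apply/orP; right.
  by rewrite ge_max expR_ge0 expR_ge1Dx.
have b0 t : 0 <= bump eps t <= eps.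
  rewrite mulr_ge0 ?ger_pMr ?ge_min ?lexx // ?(ltW e0) //.
  by rewrite le_min ler01 le_max lexx.
have bL t t' : `|bump eps t - bump eps t'| <= Z * lam * `|t - t'|.
  rewrite -mulrBr normrM (gtr0_norm e0) -mulrA ler_pM ?(ltW e0) //.
  have -> : lam * `|t - t'| = `|lam * t - lam * t'|.
    by rewrite -mulrBr normrM gtr0_norm.
  set x := lam * t; set y := lam * t'.
  have h1 : `|Num.max 0 (1 + x) - Num.max 0 (1 + y)| <= `|x - y|.
    apply: le_trans (max_lip _ _ _ _) _; rewrite subrr normr0 ge_max normr_ge0 /=.
    by rewrite opprD addrACA subrr add0r.
  apply: le_trans (min_lip _ _ _ _) _.
  by rewrite subrr normr0 ge_max normr_ge0.
have TA phi t : meas phi -> A (cap phi) t <= T phi t <= A (cap phi) t + eps.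
  move=> /mcap/(A_range t)/andP[a0 aZ]; have /andP[c0 c1] := b0 t.
  by rewrite le_max lexx ge_max; lra.
have Tlip phi t t' : `|T phi t - T phi t'| <=
    Num.max `|A (cap phi) t - A (cap phi) t'| (Z * lam * `|t - t'|).
  apply: le_trans (max_lip _ _ _ _) _; rewrite ge_max le_max lexx /=.
  by rewrite le_max bL orbT.
have Zl : 0 < Z * lam by rewrite mulr_gt0.
have [|||||phi mphi phiE] := @fixed_point R Z T.
- lra.
- move=> phi t mphi; have /andP[a0 aZ] := A_range t (mcap _ mphi).
  have /andP[c0 c1] := b0 t; rewrite le_max a0 ge_max aZ /=; lra.
- move=> e e1; have [d d0 hd] := A_equicont e1.
  have d1 : 0 < Num.min d (e / (Z * lam)) by rewrite lt_min d0 divr_gt0.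
  exists (Num.min d (e / (Z * lam))) => // -[phi mphi] t t' /=.
  rewrite lt_min => /andP[h1 h2]; apply: le_trans (Tlip _ _ _) _.
  rewrite ge_max (hd (exist _ _ (mcap _ mphi))) //=.
  by rewrite mulrC -ler_pdivlMr // ltW.
- move=> e e1; have [d d0 hd] := A_unif e1; exists d => // phi psi mphi mpsi h t.
  apply: le_trans (max_lip _ _ _ _) _; rewrite subrr normr0 ge_max (ltW e1) andbT.
  apply: hd; [exact: mcap|exact: mcap|] => u.
  apply: le_trans (min_lip _ _ _ _) _.
  by rewrite subrr normr0 ge_max h (le_trans (normr_ge0 _) (h u)).
- move=> f phi mf mphi fphi t.
  have h : A (cap (f n)) t @[n --> \oo] --> A (cap phi) t.
    apply: A_pointwise => [n||u]; [exact: mcap|exact: mcap|].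
    apply: cvg_dist_le (fphi u) => n; apply: le_trans (min_lip _ _ _ _) _.
    by rewrite subrr normr0 ge_max lexx normr_ge0.
  apply: cvg_dist_le h => n; apply: le_trans (max_lip _ _ _ _) _.
  by rewrite subrr normr0 ge_max lexx normr_ge0.
have phie u : phi u <= eps * expR (lam * u).
  rewrite -phiE ge_max be andbT.
  apply: le_trans (A_exp u (mcap _ mphi) (ltW e0) _) _.
    by move=> v; rewrite /cap ge_min lexx orbT.
  rewrite ler_wpM2r ?expR_ge0 //; case/andP: rho01 => r0 r1.
  by rewrite ger_pMl // ltW.
have capE : cap phi = phi.
  by apply/funext => u; rewrite /cap; apply/min_idPl; exact: phie.
have /= Tphi t := TA phi t mphi; rewrite capE in Tphi.
exists phi; split => // [t|t||t t'].
- rewrite -phiE; have /andP[a0 aZ] := A_range t mphi.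
  rewrite /T capE; have /andP[c0 c1] := b0 t; rewrite le_max a0 ge_max aZ /=; lra.
- by have := Tphi t; rewrite phiE.
- split=> // t t0; rewrite -phiE /T le_max; apply/orP; right.
  rewrite /bump max_r; last by rewrite addr_ge0 // mulr_ge0 // ltW.
  by rewrite min_l ?mulr1 // lerDl mulr_ge0 // ltW.
- by have := Tlip phi t t'; rewrite capE !phiE.
Qed.

Let modulus_equicont (I : Type) (f : I -> R -> R) : (forall i, meas (f i)) ->
  (forall i t t', `|f i t - f i t'| <=
     Num.max `|A (f i) t - A (f i) t'| (Z * lam * `|t - t'|)) -> equicont f.
Proof.
move=> mf hf e e0; have [d d0 hd] := A_equicont e0.
have Zl : 0 < Z * lam by rewrite mulr_gt0.
exists (Num.min d (e / (Z * lam))); first by rewrite lt_min d0 divr_gt0.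
move=> i t t'; rewrite lt_min => /andP[h1 h2]; apply: le_trans (hf _ _ _) _.
rewrite ge_max (hd (exist _ _ (mf i))) //=.
by rewrite mulrC -ler_pdivlMr // ltW.
Qed.

(* Translate the perturbed solution so that it first reaches [v0] at time 0. *)
Lemma shifted_solution (eps v0 : R) : 0 < eps < v0 -> v0 <= z1 -> exists phi,
  [/\ meas phi, (forall t, 0 <= phi t <= Z),
    (forall t, A phi t <= phi t <= A phi t + eps),
    (v0 <= phi 0) /\ (forall t : R, t < 0 -> phi t <= v0) &
    (forall t t', `|phi t - phi t'| <=
       Num.max `|A phi t - A phi t'| (Z * lam * `|t - t'|))].
Proof.
move=> /andP[e0 ev] vz.
have [|phi [mphi phiZ phiA [phie phi0] phil]] := @perturbed_solution eps.
  by have := z1ltZ; lra.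
have uc : ucont phi.
  move=> e e1; have [||d d0 hd] := @modulus_equicont unit (fun _ => phi) _ _ e e1.
  - by [].
  - by [].
  by exists d => // t t'; exact: (hd tt).
have [a [T1 [z1a hT1]]] : exists a T : R, z1 < a /\ forall t, T <= t -> a <= phi t.
  apply: (liminf_gt uc phiZ _ e0 phi0) => t; by case/andP: (phiA t).
(* The level is reached, because the lower limit at [+oo] exceeds [z1 >= v0], and not before time 0,
   because [phi <= eps < v0] on [(-oo, 0]]. *)
pose H := [set t : R | v0 <= phi t].
have H0 : H T1 by rewrite /H /=; have := hT1 T1 (lexx _); lra.
have Hlb : lbound H 0.
  move=> t /= vt; rewrite leNgt; apply/negP => t0.
  have : phi t <= eps.
    apply: le_trans (phie t) _; rewrite ger_pMr // -expR0 ler_expR.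
    by rewrite mulr_ge0_le0 // ltW.
  by move: vt; rewrite /H /=; lra.
have hH : has_inf H by split; [exists T1|exists 0].
pose T := inf H.
have lo t : t < T -> phi t < v0.
  move=> tT; rewrite ltNge; apply/negP => vt.
  by have := ge_inf hH.2 vt; rewrite leNgt tT.
have phiT : v0 <= phi T.
  apply/ler_addgt0Pr => e e1; have [d d0 hd] := uc _ e1.
  have [t Ht tT] := inf_adherent d0 hH.
  have Tt : T <= t := ge_inf hH.2 Ht.
  have : `|t - T| < d by rewrite ger0_norm ?subr_ge0 // ltrBlDl.
  by move=> /hd; rewrite ler_norml; move: Ht; rewrite /H /=; lra.
exists (fun t => phi (t + T)); split.
- by apply: measurableT_comp => //; exact: measurable_funD.
- by move=> t; exact: phiZ.
- by move=> t; rewrite A_shift; exact: phiA.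
- split; first by rewrite add0r.
  by move=> t t0; apply/ltW/lo; rewrite gtrDr.
- by move=> t t'; rewrite !A_shift; have := phil (t + T) (t' + T);
    rewrite opprD addrACA subrr addr0.
Qed.

Lemma nontrivial_solution (v0 : R) : 0 < v0 -> v0 <= z1 -> exists phi,
  [/\ ucont phi, (forall t, 0 <= phi t <= Z), (forall t, A phi t = phi t),
    v0 <= phi 0 & (forall t : R, t < 0 -> phi t <= v0)].
Proof.
move=> v00 vz.
(* The denominator [n + 2] makes already the first perturbation smaller than [v0]. *)
have /choice[f Hf] (n : nat) : exists phi,
  [/\ meas phi, (forall t, 0 <= phi t <= Z),
    (forall t, A phi t <= phi t <= A phi t + v0 / n.+2%:R),
    (v0 <= phi 0) /\ (forall t : R, t < 0 -> phi t <= v0) &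
    (forall t t', `|phi t - phi t'| <=
       Num.max `|A phi t - A phi t'| (Z * lam * `|t - t'|))].
  apply: shifted_solution => //; rewrite divr_gt0 //=.
  by rewrite ltr_pdivrMr // ltr_pMr // ltr1n.
have fe : equicont f.
  by apply: modulus_equicont => n; case: (Hf n).
have [|s [phi [sn hs]]] := @equicont_subseq R Z f _ fe; first by move=> n; case: (Hf n).
have uc : ucont phi by exact: equicont_limit fe hs.
have mphi := ucont_meas uc.
have fA t : A (f (s n)) t @[n --> \oo] --> A phi t.
  by apply: A_pointwise => // n; case: (Hf (s n)).
have z0 : v0 / (s n).+2%:R @[n --> \oo] --> 0.
  apply: (@cvg_dist_le _ _ (fun n => v0 * n.+1%:R^-1) _ 0) => [n|].
    rewrite !subr0 !ger0_norm ?divr_ge0 ?ltW // ltr_pM2l // ltf_pV2 ?posrE //.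
    by rewrite ltr_nat ltnS ltnS sn.
  by rewrite -[X in _ --> X](mulr0 v0); apply: cvgMr; exact: cvg_harmonic.
exists phi; split => // [t|t||t t0].
- apply/andP; split.
    by apply: (cvg_le _ (cvg_cst 0) (hs t)); near=> n; case: (Hf (s n)) => _ /(_ t)/andP[].
  by apply: (cvg_le _ (hs t) (cvg_cst Z)); near=> n; case: (Hf (s n)) => _ /(_ t)/andP[].
- apply/eqP; rewrite eq_le; apply/andP; split.
    by apply: (cvg_le _ (fA t) (hs t)); near=> n; case: (Hf (s n)) => _ _ /(_ t)/andP[].
  rewrite -[leRHS]addr0; apply: (cvg_le _ (hs t) (cvgD (fA t) z0)).
  by near=> n; case: (Hf (s n)) => _ _ /(_ t)/andP[].
- by apply: (cvg_le _ (cvg_cst v0) (hs 0)); near=> n; case: (Hf (s n)) => _ _ _ [].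
- by apply: (cvg_le _ (hs t) (cvg_cst v0)); near=> n; case: (Hf (s n)) => _ _ _ [_ /(_ t t0)].
Unshelve. all: by end_near. Qed.

(* A bounded solution dominated by [B e^{lam t}] vanishes, since [A] contracts
   such bounds by the factor [rho]. *)
Lemma solution_gt0 phi : ucont phi -> (forall t, 0 <= phi t <= Z) ->
  (forall t, A phi t = phi t) -> 0 < phi 0 -> forall t, 0 < phi t.
Proof.
move=> uc phiZ Aphi phi0 t; have mphi := ucont_meas uc.
have /andP[t0 _] := phiZ t; rewrite lt_neqAle t0 andbT; apply/eqP => /esym tE.
have [T hT] := A_zero (ucont_continuous uc) phiZ Aphi tE.
(* [B e^{lam u}] is at least [Z] from [T] on, and before [T] the solution vanishes. *)
pose B := Z * expR (- (lam * T)).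
have B0 : 0 <= B by rewrite mulr_ge0 ?expR_ge0 // ltW.
have hB n : forall u, phi u <= rho ^+ n * B * expR (lam * u).
  elim: n => [u|n IH u].
    rewrite expr0 mul1r; have [uT|Tu] := leP u T.
      by rewrite hT // mulr_ge0 // expR_ge0.
    apply: (@le_trans _ _ Z); first by case/andP: (phiZ u).
    rewrite /B -mulrA -expRD -[X in X <= _]mulr1 ler_pM2l // -expR0 ler_expR.
    by rewrite addrC -mulrBr mulr_ge0 ?subr_ge0 // ltW.
  rewrite -Aphi exprS -(mulrA rho); apply: A_exp => //.
  by rewrite mulr_ge0 // exprn_ge0 //; case/andP: rho01.
have : rho ^+ n * B @[n --> \oo] --> 0 * B.
  apply: cvgMl; apply: cvg_expr; rewrite ger0_norm //; by case/andP: rho01.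
rewrite mul0r => /(cvg_le _ (cvg_cst (phi 0)))/wrap[].
  by near=> n; have := hB n 0; rewrite mulr0 expR0 mulr1.
by rewrite leNgt phi0.
Unshelve. all: by end_near. Qed.

(* At a minimum point [t] of [phi u + mu u], the hypothesis [A_low] would give
   [A phi t > phi t] unless [t < S] or [phi t > vs / 2]. *)
Lemma persistence phi (c : R) : ucont phi -> (forall t, 0 <= phi t <= Z) ->
  (forall t, A phi t <= phi t) -> c <= vs / 2 ->
  (forall t, 0 <= t <= S -> c <= phi t) -> forall t, 0 <= t -> c <= phi t.
Proof.
move=> uc phiZ Aphi cv cS t t0; apply: (@le_lin_eps _ _ _ t) => // e e0.
(* [mu <= e] makes the slope disappear in the limit; [mu S <= vs / 2] together with [c <= vs / 2]
   keeps the affine minorant below [vs], as [A_low] demands. *)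
pose mu := Num.min e (vs / 2 / S).
have mu0 : 0 < mu by rewrite lt_min e0 !divr_gt0.
have mue : mu <= e by rewrite ge_min lexx.
have muS : mu * S <= vs / 2 by rewrite -ler_pdivlMr // ge_min lexx orbT.
pose h u := phi u + mu * u.
have hc : continuous h.
  by move=> u; apply: cvgD; [exact: ucont_continuous uc u|apply: cvgMr; exact: cvg_id].
(* From [T] on, [mu u >= Z >= phi 0], so the minimum of [h] over [[0, T]] is its minimum over
   [[0, +oo)]. *)
pose T := Z / mu + t.
have T0 : 0 <= T by rewrite addr_ge0 // divr_ge0 // ltW.
have muT : Z <= mu * T.
  by rewrite mulrDr mulrCA divff ?lt0r_neq0 // mulr1 lerDl mulr_ge0 // ltW.
have [x xT hx] := EVT_min T0 (continuous_subspaceT hc).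
move: xT; rewrite in_itv /= => /andP[x0 xT].
have hmin u : 0 <= u -> h x <= h u.
  move=> u0; have [uT|Tu] := leP u T; first by apply: hx; rewrite in_itv /= u0.
  apply: le_trans (hx 0 _) _; first by rewrite in_itv /= lexx.
  rewrite /h mulr0 addr0; have /andP[_ h1] := phiZ 0; have /andP[h2 _] := phiZ u.
  have : mu * T <= mu * u by rewrite ler_pM2l // ltW.
  by lra.
have cx : c <= phi x.
  have [xS|Sx] := ltP x S; first by apply: cS; rewrite x0 ltW.
  rewrite leNgt; apply/negP => xc; have /andP[px _] := phiZ x.
  have : F * phi x + m1 * mu <= phi x.
    apply: le_trans (Aphi x); apply: A_low => //; [exact: ucont_meas|exact: ltW|lra|].
    move=> y; rewrite ler_norml => /andP[_ yS].
    have := @hmin (x - y); rewrite /h subr_ge0 (le_trans yS) // => /(_ isT).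
    by rewrite mulrBr; lra.
  have : phi x <= F * phi x by rewrite ler_peMl // ltW.
  have : 0 < m1 * mu by rewrite mulr_gt0.
  by lra.
have := hmin _ t0; rewrite /h => h1; have h2 : 0 <= mu * x by rewrite mulr_ge0 // ltW.
have h3 : mu * t <= t * e by rewrite mulrC ler_wpM2l.
by lra.
Qed.

Theorem wavefront_exists : exists phi,
  [/\ ucont phi, (forall t, 0 < phi t <= Z), (forall t, A phi t = phi t),
    (forall e : R, 0 < e -> exists T : R, forall t, t <= T -> phi t <= e) &
    (exists a T : R, z1 < a /\ forall t, T <= t -> a <= phi t)].
Proof.
(* Below [vs] for the decay at [-oo], and below [z1] so that the level is certainly reached. *)
pose v0 := Num.min vs z1.
have v00 : 0 < v0 by rewrite lt_min vs0.
have [vv vz] : v0 <= vs /\ v0 <= z1 by rewrite !ge_min !lexx orbT.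
have [phi [uc phiZ Aphi phi0 phin]] := nontrivial_solution v00 vz.
have phip := solution_gt0 uc phiZ Aphi (lt_le_trans v00 phi0).
have Ale t : A phi t <= phi t by rewrite Aphi.
exists phi; split => //.
- by move=> t; rewrite phip; case/andP: (phiZ t).
- by apply: A_decay => // t /phin /le_trans; apply.
have [x _ hx] := EVT_min (ltW S0) (continuous_subspaceT (ucont_continuous uc)).
pose c := Num.min (vs / 2) (phi x).
have c0 : 0 < c by rewrite lt_min phip divr_gt0.
apply: (liminf_gt uc phiZ Ale c0 (T0 := 0)); apply: persistence => //.
  by rewrite ge_min lexx.
by move=> t tS; rewrite ge_min hx ?orbT // in_itv.
Qed.

(** [H] extends [G] from [[z1, Z]] to a continuous map of the line into [[z1, Z]], as the results on
    interval maps require. Both limits [a] and [b] are values of limit profiles, whose envelopes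
    give [G v <= a] and [b <= G w]. *)
Theorem wavefront_limit phi (H : R -> R) (k a0 T0 : R) : ucont phi ->
  (forall t, 0 <= phi t <= Z) -> (forall t, A phi t = phi t) ->
  z1 < a0 -> (forall t, T0 <= t -> a0 <= phi t) ->
  continuous H -> (forall x, z1 <= H x <= Z) ->
  (forall x, z1 <= x <= Z -> H x = G x) ->
  (forall x, z1 <= x <= Z -> iter n G x @[n --> \oo] --> k) ->
  phi t @[t --> +oo] --> k.
Proof.
move=> uc phiZ Aphi z1a ha Hc Hin HG Gk.
have [a [b [[a00 ab bZ] [hab [Ta [Tan Tac]] [Tb [Tbn Tbc]]]]]] := omega_bounds phiZ.
have aa : a0 <= a.
  apply: (cvg_le (f := fun=> a0) _ _ Tac); last exact: cvg_cst.
  near=> n; apply: ha; apply: le_trans (Tan n); near: n; exact: nbhs_infty_ger.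
have at_limit T c : (forall n, n%:R <= T n) -> phi (T n) @[n --> \oo] --> c ->
    exists psi, [/\ continuous psi, (forall u, a <= psi u <= b) & A psi 0 = c].
  move=> Tn Tc; have [s [psi [sn cpsi psiab hs hA]]] := profile uc phiZ hab Tn.
  exists psi; split => //; have E n : A phi (T (s n)) = phi (T (s n)) by [].
  rewrite (eq_cvg _ _ E) in hA.
  have h : phi (T (s n)) @[n --> \oo] --> c.
    apply/cvgrPdist_le => e e0; move: Tc => /cvgrPdist_le/(_ _ e0)[N _ hN].
    by exists N => // n /= Nn; apply: hN => /=; rewrite (leq_trans Nn).
  exact: (cvg_unique _ hA h).
have [psi [cpsi psiab psia]] := at_limit _ _ Tan Tac.
have [|v vab Gv] := A_env_low (t := 0) cpsi a00 bZ psiab; first by rewrite psia.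
have [xi [cxi xiab xib]] := at_limit _ _ Tbn Tbc.
have [|w wab Gw] := A_env_up (t := 0) cxi a00 bZ xiab; first by rewrite xib.
have iterE n x : z1 <= x <= Z -> iter n H x = iter n G x /\ z1 <= iter n H x <= Z.
  move=> hx; elim: n => //= n [IH1 IH2]; split; last exact: Hin.
  by rewrite HG // IH1.
have [|||||||||ak bk] := @attracting_expanded_interval R H z1 Z k _ Hc Hin _ _ a b v w.
- exact: z1ltZ.
- by rewrite HG //; lra.
- move=> x hx; rewrite (eq_cvg _ _ (fun n => (iterE n x hx).1)); exact: Gk.
- by lra.
- by [].
- by [].
- by [].
- by rewrite HG //; lra.
- by rewrite HG //; lra.
apply/cvgrPdist_le => e e0; have [T hT] := hab _ e0.
near=> t; have : T <= t by near: t; apply: nbhs_pinfty_ge; exact: num_real.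
by move=> /hT; rewrite ak bk ler_distl; lra.
Unshelve. all: by end_near. Qed.

End WaveFront.

(** * Continuity of translations in L1 *)

Section LebesgueShift.
Context {R : realType}.
Local Notation leb := (@lebesgue_measure R).

Lemma measurable_shift (c : R) : measurable_fun [set: R] (fun x : R => x + c).
Proof. exact: measurable_funD. Qed.

Lemma lebesgue_measure_shift (c : R) (A : set R) : measurable A ->
  pushforward leb ((fun x => x + c) : R -> measurableTypeR R) A = leb A.
Proof.
move=> mA; apply/esym/lebesgue_measure_unique => //=.
  exact: measurable_shift.
move=> ? _ [[a b]] _ <-; rewrite /pushforward.
rewrite (_ : _ @^-1` _ = `](a - c), (b - c)]%classic); last first.
  by apply/seteqP; split => x /=; rewrite !in_itv /= ltrBlDr lerBrDr.
rewrite !lebesgue_measure_itv /= !lte_fin ltrD2r.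
by case: ifP => // _; rewrite -!EFinB opprB addrA subrK.
Qed.

Lemma ge0_integral_shift (c : R) (f : R -> \bar R) :
  measurable_fun [set: R] f -> (forall x, 0 <= f x)%E ->
  (\int[leb]_x f (x + c)%R = \int[leb]_x f x)%E.
Proof.
move=> mf f0.
pose h : measurableTypeR R -> measurableTypeR R := fun x => x + c.
have := @ge0_integral_pushforward _ _ (measurableTypeR R) (measurableTypeR R) R h
  (measurable_shift c) leb setT f
  measurableT mf (fun x _ => f0 x).
rewrite preimage_setT => <-.
apply: eq_measure_integral; first exact: measurable_shift.
by move=> ? A mA _; exact: lebesgue_measure_shift.
Qed.

End LebesgueShift.

Section L1.
Context d (T : measurableType d) (R : realType) (m : {measure set T -> \bar R}).
Implicit Types (f g h : T -> R).
Local Notation meas := (measurable_fun [set: T]).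

Definition L1dist f g : \bar R := (\int[m]_x (`|f x - g x|%R)%:E)%E.

Lemma L1distC f g : L1dist f g = L1dist g f.
Proof. by apply: eq_integral => x _; rewrite distrC. Qed.

Lemma measurable_dist f g : meas f -> meas g -> meas (fun x => `|f x - g x|).
Proof. by move=> mf mg; apply: measurableT_comp => //; exact: measurable_funB. Qed.

Lemma L1dist_triangle g f h : meas f -> meas g -> meas h ->
  (L1dist f h <= L1dist f g + L1dist g h)%E.
Proof.
move=> mf mg mh; have md := fun f g mf mg => (measurable_EFinP _ _).2 (@measurable_dist f g mf mg).
rewrite /L1dist -ge0_integralD //; [|exact: md|exact: md].
apply: ge0_le_integral => //.
- exact: md.
- by apply: emeasurable_funD; exact: md.
- by move=> x _; rewrite -EFinD lee_fin ler_distD.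
Qed.

Lemma dominated_cvg0 (h : nat -> T -> R) (B : T -> R) :
  (forall n, meas (h n)) -> m.-integrable setT (EFin \o B) ->
  {ae m, forall x, h n x @[n --> \oo] --> (0 : R)} -> (forall n x, `|h n x| <= B x) ->
  forall e : R, 0 < e -> \forall n \near \oo, (\int[m]_x (`|h n x|%R)%:E <= e%:E)%E.
Proof.
move=> mh iB h0 hB e e0.
have [||||| _ + _] := @dominated_convergence _ _ _ m setT measurableT
    (fun n => EFin \o h n) (cst 0) (EFin \o B).
- by move=> n; apply/measurable_EFinP.
- exact: measurable_cst.
- by apply: filterS h0 => x hx _; apply: cvg_EFin => //; exact: nearW.
- by [].
- by apply: aeW => x n _; rewrite /= lee_fin.
move=> /fine_cvgP[fn]; move=> /cvgrPdist_le/(_ _ e0).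
apply: filterS2 fn => n /= fn; rewrite sub0r normrN.
have E : (\int[m]_x `|(h n x)%:E - 0| = \int[m]_x (`|h n x|%R)%:E)%E.
  by apply: eq_integral => x _; rewrite sube0.
rewrite E in fn *; move=> /(le_trans (ler_norm _)).
by rewrite -lee_fin fineK.
Qed.

End L1.

Section Translation.
Context {R : realType}.
Local Notation leb := (@lebesgue_measure R).
Implicit Types f : R -> R.

(** Cut off to [[-N, N]], then approximate by a continuous function there. The approximant keeps the
    sharp cut-off: it is bounded and discontinuous at most at [-N] and [N], which suffices for
    dominated convergence of its translates. *)
Lemma L1_approx f (e : R) : leb.-integrable setT (EFin \o f) -> 0 < e ->
  exists (g : R -> R) (N M : R), [/\ continuous g, measurable_fun setT g,
    forall x, `|x| <= N -> `|g x| <= M &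
    (L1dist leb f (fun x => g x * \1_(`[- N, N]%classic) x)%R <= e%:E)%E].
Proof.
move=> intf e0; have mf : measurable_fun setT f.
  by case/integrableP : intf => /measurable_EFinP.
have e2 : 0 < e / 2 by lra.
pose E (n : nat) : set R := `[- n%:R, n%:R]%classic.
have mE' n : measurable (E n) by exact: measurable_itv.
have mE n : measurable (E n : set (measurableTypeR R)) := mE' n.
have m1 n : measurable_fun setT (\1_(E n) : R -> R) by exact: measurable_indic.
have [n hn] : exists n, (L1dist leb f (fun x => f x * \1_(E n) x)%R <= (e / 2)%:E)%E.
  apply: (@filter_ex _ \oo).
  apply: (@dominated_cvg0 _ _ _ leb (fun n x => f x - f x * \1_(E n) x)
    (fun x => `|f x|)) => //.
  - by move=> n; apply: measurable_funB => //; exact: (measurable_funM mf (m1 n)).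
  - exact: integrable_abse intf.
  - apply: aeW => x; apply/cvgrPdist_le => r r0; near=> n.
    rewrite indicE mem_set ?mulr1 ?subrr ?subr0 ?normr0 ?ltW //.
    rewrite /E /= in_itv /= -ler_norml; near: n; exact: nbhs_infty_ger.
  - move=> n x; rewrite indicE; case: (_ \in _); rewrite ?mulr1 ?mulr0 ?subrr ?subr0 //.
    by rewrite normr0.
have Efin : (leb (E n) < +oo)%E.
  by rewrite lebesgue_measure_itv /=; case: ifP; rewrite ?ltry.
have intE : leb.-integrable (E n) (EFin \o f).
  by exact: (integrableS measurableT (mE n) (@subsetT _ _) intf).
have [g_ [gc gi g0]] := approximation_continuous_integrable (mE n) Efin intE.
have [k hk] : exists k, (\int[leb]_(z in E n) `|(f z - g_ k z)%:E| <= (e / 2)%:E)%E.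
  apply: (@filter_ex _ \oo); move/fine_cvgP: g0 => [fn /cvgrPdist_le/(_ _ e2)].
  apply: filterS2 fn => k fn; rewrite sub0r normrN => /(le_trans (ler_norm _)).
  by rewrite -lee_fin fineK.
have mg : measurable_fun setT (g_ k) by exact: continuous_measurable_fun.
have nn : - n%:R <= n%:R :> R by apply: le_trans (ler0n _ _); rewrite oppr_le0.
have [x1 _ hx1] := @EVT_max R (fun x => `|g_ k x|) (- n%:R) n%:R nn
  (continuous_subspaceT (fun x => continuous_comp (gc k x) (@norm_continuous _ _ _))).
exists (g_ k), n%:R, `|g_ k x1|; split => //.
  by move=> x xn; apply: hx1; rewrite in_itv /= -ler_norml.
have mf1 := measurable_funM mf (m1 n); have mg1 := measurable_funM mg (m1 n).
apply: le_trans (L1dist_triangle leb mf mf1 mg1) _.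
rewrite [e in leRHS](_ : e = e / 2 + e / 2); last lra.
rewrite EFinD leeD //; apply: le_trans hk; rewrite integral_mkcond /L1dist.
apply: ge0_le_integral => //.
- by apply/measurable_EFinP; exact: (measurable_dist mf1 mg1).
- apply/(measurable_restrictT _ (mE n)); apply: measurable_funTS.
  by apply: measurableT_comp => //; apply/measurable_EFinP; exact: measurable_funB.
- move=> x _; rewrite /patch /= !indicE.
  by case: ifP => _; rewrite /= ?mulr1 ?mulr0 ?subrr ?normr0.
Unshelve. all: by end_near. Qed.

Lemma L1dist_shift f g (c : R) : measurable_fun setT f -> measurable_fun setT g ->
  L1dist leb (fun x => f (x + c)) (fun x => g (x + c)) = L1dist leb f g.
Proof.
move=> mf mg; rewrite /L1dist.
rewrite (ge0_integral_shift c (f := fun x => (`|f x - g x|)%:E)) //.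
  by apply/measurable_EFinP; exact: measurable_dist.
Qed.

(** Translations are isometries of L1, so it is enough to move the truncated continuous
    approximant. *)
Lemma L1_translation f (c : nat -> R) : leb.-integrable setT (EFin \o f) ->
  c n @[n --> \oo] --> 0 -> forall e : R, 0 < e ->
  \forall n \near \oo, (L1dist leb (fun x => f (x + c n))%R f <= e%:E)%E.
Proof.
move=> intf c0 e e0; have mf : measurable_fun setT f.
  by case/integrableP : intf => /measurable_EFinP.
have e3 : 0 < e / 3 by lra.
have [g [N [M [gc mg gM fg]]]] := L1_approx intf e3.
pose k x := g x * \1_(`[- N, N]%classic) x.
have mk : measurable_fun setT k.
  by apply: measurable_funM => //; apply: measurable_indic; exact: measurable_itv.
have ms h r : measurable_fun setT h -> measurable_fun setT (fun x : R => h (x + r) : R).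
  by move=> mh; apply: measurableT_comp => //; exact: measurable_shift.
have [C HC] := cvg_has_ub (cvgP _ c0).
have hC n : `|c n| <= C by apply: HC; exists n.
have kM x : `|k x| <= `|M| * \1_(`[- N, N]%classic) x.
  rewrite /k normrM indicE; have [xN|xN] := boolP (x \in _); last by rewrite normr0 !mulr0.
  rewrite normr1 !mulr1; apply: le_trans (ler_norm M); apply: gM.
  by move: xN; rewrite inE /= in_itv /= ler_norml.
have kk : \forall n \near \oo, (L1dist leb (fun x => k (x + c n))%R k <= (e / 3)%:E)%E.
  (* [C] bounds the shifts, so all the translates of [k] vanish outside [[-L, L]]. *)
  pose L := N + C.
  apply: (@dominated_cvg0 _ _ _ leb (fun n x => k (x + c n) - k x)
    (fun x => (`|M| + `|M|) * \1_(`[- L, L]%classic) x)) => //.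
  - by move=> n; apply: measurable_funB => //; exact: ms.
  - rewrite (_ : EFin \o _ = fun x => ((`|M| + `|M|)%:E * (\1_(`[- L, L]%classic) x)%:E)%E) //.
    apply: integrableZl => //; apply: integrable_indic_itv.
  - exists [set - N; N]; split.
    + have : measurable ([set - N; N] : set R) by apply: measurableU; exact: measurable_set1.
      by [].
    + by apply: countable_lebesgue_measure0; apply/finite_set_countable/finite_set2.
    move=> x /=; apply: contra_notP => /not_orP[xN1 xN2].
    have xc : x + c n @[n --> \oo] --> x.
      by rewrite -[X in _ --> X]addr0; apply: cvgD => //; exact: cvg_cst.
    have xcn : `|x + c n| @[n --> \oo] --> `|x| by exact: cvg_norm.
    have [xN|xN|xN] := ltgtP `|x| N.
    - have gx : g (x + c n) - g x @[n --> \oo] --> 0.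
        rewrite -(subrr (g x)); apply: cvgB; last exact: cvg_cst.
        exact: (cvg_comp _ _ xc (gc x)).
      apply: cvg_trans gx; apply: near_eq_cvg; near=> n.
      rewrite /k !indicE !mem_set ?mulr1 //= in_itv /= -ler_norml ltW //.
      by near: n; exact: (cvgr_lt _ xcn).
    - apply: cvg_near_cst; near=> n.
      have hn : N < `|x + c n| by near: n; exact: (cvgr_gt _ xcn).
      rewrite /k !indicE !memNset ?mulr0 ?subrr //= in_itv /= -ler_norml;
      by apply/negP; rewrite -ltNge.
    - exfalso; have [x0|x0] := leP 0 x.
        by apply: xN2; rewrite -xN ger0_norm.
      by apply: xN1; rewrite -xN ltr0_norm // opprK.
  - move=> n x; apply: le_trans (ler_normB _ _) _; rewrite mulrDl lerD //.
      apply: le_trans (kM _) _; rewrite ler_wpM2l // !indicE.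
      case: (boolP (x + c n \in _)) => // h; rewrite mem_set //.
      move: h; rewrite inE /= !in_itv /=; have := hC n; rewrite ler_norml /L; lra.
    apply: le_trans (kM _) _; rewrite ler_wpM2l // !indicE.
    case: (boolP (x \in _)) => // h; rewrite mem_set //.
    move: h; rewrite inE /= !in_itv /=; have := hC n; rewrite ler_norml /L; lra.
near=> n.
apply: le_trans (L1dist_triangle leb (ms _ (c n) mf) (ms _ (c n) mk) mf) _.
rewrite [e in leRHS](_ : e = e / 3 + (e / 3 + e / 3)); last lra.
rewrite EFinD leeD // ?L1dist_shift //.
apply: le_trans (L1dist_triangle leb (ms _ (c n) mk) mk mf) _.
rewrite EFinD leeD //; first by near: n.
by rewrite L1distC.
Unshelve. all: by end_near. Qed.

End Translation.

(** * A Steinhaus argument *)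

Section Steinhaus.
Context {R : realType}.
Local Notation leb := (@lebesgue_measure R).
Local Notation RM := (measurableTypeR R).

Lemma measurable_reflect (y : R) : measurable_fun [set: RM] (fun x : RM => (y - x : RM)).
Proof.
have : measurable_fun [set: R] (fun x : R => y - x) by exact: measurable_funB.
by [].
Qed.

Lemma lebesgue_measure_reflect (y : R) (A : set RM) : measurable A ->
  leb ((fun x : R => y - x) @^-1` A) = leb A.
Proof.
move=> mA; rewrite -(lebesgue_measure_shift y mA) -[RHS]lebesgue_measureN //.
  by congr (leb _); apply/seteqP; split => x /=; rewrite addrC.
rewrite -[X in measurable X]setTI.
have m : measurable_fun [set: R] (fun x : R => x + y) by exact: measurable_shift.
exact: (m measurableT).
Qed.

Lemma ae_exists (A : set R) (P : R -> Prop) : measurable (A : set RM) ->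
  (0 < leb A)%E -> {ae leb, forall x, A x -> P x} -> exists2 x, A x & P x.
Proof.
move=> mA A0 [N [mN N0 hN]]; apply: contrapT => h.
have : (leb A <= 0)%E.
  rewrite -N0; apply: le_measure; rewrite ?inE // => x Ax; apply: hN => /= hP.
  by apply: h; exists x => //; exact: hP.
by rewrite leNgt A0.
Qed.

Let mball (x r : R) : measurable (ball x r : set RM).
Proof. by have := measurable_ball x r. Qed.

Let le_leb (A B : set R) : measurable (A : set RM) -> measurable (B : set RM) ->
  A `<=` B -> (leb A <= leb B)%E.
Proof. by move=> mA mB AB; apply: le_measure => //; rewrite inE. Qed.

(** The ball has length [2 r], so this is density above three quarters: two such sets inside a ball
    of radius [3 r / 2] must meet. *)
Lemma density_half (E : set R) : measurable (E : set RM) ->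
  {ae leb, forall x, E x -> exists2 r0 : R, 0 < r0 & forall r : R, 0 < r < r0 ->
    ((3 / 2 * r)%:E < leb (E `&` ball x r))%E}.
Proof.
move=> mE; have := lebesgue_density mE.
apply: (@filterS _ _ (ae_filter_ringOfSetsType leb)) => x + Ex.
rewrite indicE mem_set //= => /fine_cvgP[fn].
move=> /cvgrPdist_lt/(_ (1 / 4)) /(_ ltac:(lra)) near4.
have [r0 /= r00 hr] := filterI fn near4.
exists r0 => // r /andP[r0' rr].
have [||_] := hr r; rewrite /= ?sub0r ?normrN ?(gtr0_norm r0') //.
have lB : leb (ball x r) = (r *+ 2)%:E by apply: lebesgue_measure_ball; exact: ltW.
have bfin : leb (E `&` ball x r) \is a fin_num.
  rewrite ge0_fin_numE //; apply: le_lt_trans (ltry (r *+ 2)); rewrite -lB.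
  apply: le_leb => //.
  by apply: measurableI; [exact: mE|exact: mball].
rewrite lB inver; have -> : (r *+ 2 == 0) = false by rewrite mulrn_eq0 /= gt_eqF.
rewrite -(fineK bfin) -EFinM /= lte_fin.
set u := fine _; rewrite ltr_norml => /andP[_]; rewrite ltrBlDl -ltrBlDr => h.
have r2 : 0 < r *+ 2 by rewrite pmulrn_lgt0.
have : (1 - 1 / 4) * (r *+ 2) < u by rewrite -ltr_pdivlMr.
by rewrite -mulr_natr; lra.
Qed.

(* Steinhaus: [E + E] contains an interval around twice a density point of [E];
   the points of density of [E] suffice because [Zs] is closed. *)
Lemma closed_absorbing (E Zs : set R) : measurable (E : set RM) -> (0 < leb E)%E ->
  (forall x, E x -> 0 < x) -> closed Zs ->
  (forall t, Zs t -> {ae leb, forall x, E x -> Zs (t - x)}) ->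
  exists V : R, forall t v, Zs t -> V <= v -> Zs (t - v).
Proof.
move=> mE E0 Epos cZ hZ.
have [c Ec [r0 r00 hr0]] := ae_exists mE E0 (density_half mE).
have c0 := Epos c Ec.
pose r := Num.min r0 c / 2.
have m0 : 0 < Num.min r0 c by rewrite lt_min r00.
have r_gt0 : 0 < r by rewrite divr_gt0.
have [rr0 rc] : r < r0 /\ r < c.
  have [h1 h2] : Num.min r0 c <= r0 /\ Num.min r0 c <= c by rewrite !ge_min !lexx orbT.
  by rewrite /r; lra.
have hr := hr0 r; rewrite r_gt0 rr0 in hr; have {}hr := hr isT.
have [N [mN N0 hN]] := density_half mE.
pose D := (E `\` N) `&` ball c r.
have mB : measurable (ball c r : set RM) by exact: mball.
have mD : measurable (D : set RM) by apply: measurableI => //; exact: measurableD.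
(* For any given [t], admissible points of [E] lie arbitrarily close to a density point [x];
   closedness of [Zs] carries the property over to [x], which turns almost every into every. *)
have DE x : D x -> E x /\ forall t, Zs t -> Zs (t - x).
  move=> [[Ex Nx] _]; split=> // t Zt.
  have [r1 r10 hr1] : exists2 r0 : R, 0 < r0 & forall r : R, 0 < r < r0 ->
      ((3 / 2 * r)%:E < leb (E `&` ball x r))%E.
    by apply: contrapT => h; apply: Nx; apply: hN => /= h'; apply: h; exact: h'.
  apply: cZ => U /nbhs_ballP[e /= e0 eU].
  pose s := Num.min e r1 / 2.
  have me : 0 < Num.min e r1 by rewrite lt_min e0.
  have [se sr] : s < e /\ s < r1.
    have [h1 h2] : Num.min e r1 <= e /\ Num.min e r1 <= r1 by rewrite !ge_min !lexx orbT.
    by rewrite /s; lra.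
  have s0 : 0 < s by rewrite divr_gt0.
  have mS : measurable (E `&` ball x s : set RM).
    by apply: measurableI; [exact: mE|exact: mball].
  have Spos : (0 < leb (E `&` ball x s))%E.
    apply: lt_trans (hr1 s _); last by rewrite s0.
    by rewrite lte_fin mulr_gt0.
  have [|z [Ez xz] Zz] := @ae_exists _ (fun z => Zs (t - z)) mS Spos.
    by apply: (@filterS _ _ (ae_filter_ringOfSetsType leb)) (hZ t Zt) => z h [/h].
  exists (t - z); split=> //; apply: eU.
  rewrite /ball /= in xz *; have -> : t - x - (t - z) = - (x - z) by ring.
  by rewrite normrN; exact: lt_trans se.
have lD : ((3 / 2 * r)%:E < leb D)%E.
  apply: lt_le_trans hr _.
  apply: (@le_trans _ _ (leb D + leb N)%E); last by rewrite [X in (_ + X)%E]N0 adde0.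
  apply: le_trans _ (measureU2 _ mD mN); apply: le_leb.
  - exact: measurableI.
  - exact: measurableU.
  - by move=> x [Ex Bx]; have [Nx|Nx] := pselect (N x); [right|left].
pose J y := `|y - c *+ 2| < r / 2.
(* [D] and its reflection [y - D] lie in the ball of radius [3 r / 2] around [c], of length [3 r],
   and each has measure above [3 r / 2], so they intersect. *)
have DJ y : J y -> exists2 x, D x & D (y - x).
  move=> Jy; apply: contrapT => h.
  pose D' := (fun x : R => y - x) @^-1` D.
  have mD' : measurable (D' : set RM).
    by rewrite -[X in measurable X]setTI; exact: (measurable_reflect y measurableT mD).
  have DD : D `&` D' = set0.
    by apply/seteqP; split => // x [Dx Dyx]; apply: h; exists x.
  have : (leb (D `|` D') <= leb (ball c (3 / 2 * r)))%E.
    apply: le_leb => //; first exact: measurableU.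
    move=> x [[_ xb]|[_ xb]]; move: xb; rewrite /ball /= => xb.
      by apply: lt_le_trans xb _; lra.
    move: Jy xb; rewrite /J !ltr_norml -mulr_natr; lra.
  rewrite lebesgue_measure_ball; last by rewrite mulr_ge0 // ltW.
  have lD' : leb D' = leb D := lebesgue_measure_reflect y mD.
  have DU : (leb (D `|` D') = leb D + leb D')%E by exact: measureU.
  rewrite DU lD'; apply/negP; rewrite -ltNge.
  apply: le_lt_trans (lteD lD lD); rewrite -EFinD lee_fin -mulr_natr; lra.
have ZJ t y : Zs t -> J y -> Zs (t - y).
  move=> Zt /DJ[x /DE[_ h1] /DE[_ h2]].
  have -> : t - y = t - x - (y - x) by ring.
  by apply: h2; exact: h1.
have ZJk k t y : Zs t -> J y -> Zs (t - y *+ k).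
  move=> Zt Jy; elim: k => [|k IH]; first by rewrite mulr0n subr0.
  by rewrite mulrSr opprD addrA; exact: ZJ.
pose c2 := c *+ 2; have c20 : 0 < c2 by rewrite pmulrn_lgt0.
(* For [k] the integer part of [v / (2 c)] and [k >= n0], the quotient [v / k] exceeds [2 c] by less
   than [r / 2], so [v] is a sum of [k] admissible shifts. *)
pose n0 := (Num.truncn (c2 / (r / 2))).+1.
exists (c2 * n0%:R) => t v Zt Vv.
pose k := Num.truncn (v / c2).
have v0 : 0 <= v / c2.
  by rewrite divr_ge0 // ?(ltW c20) //; apply: le_trans Vv; rewrite mulr_ge0 // ltW.
have nk : (n0 <= k)%N.
  by rewrite truncn_ge_nat // ler_pdivlMr // mulrC.
have k0 : 0 < k%:R :> R by rewrite ltr0n (leq_trans _ nk).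
have -> : v = (v / k%:R) *+ k by rewrite -mulr_natr divfK // lt0r_neq0.
apply: ZJk => //; rewrite /J -/c2.
have /andP[h1 h2] := truncn_itv v0.
rewrite ger0_norm; last first.
  by rewrite subr_ge0 ler_pdivlMr // mulrC -ler_pdivlMr.
have h3 : c2 / k%:R < r / 2.
  rewrite ltr_pdivrMr // mulrC -ltr_pdivrMr ?divr_gt0 //.
  by apply: lt_le_trans (truncnS_gt _) _; rewrite ler_nat.
apply: le_lt_trans h3; rewrite lerBlDl ler_pdivrMr // mulrDl divfK ?lt0r_neq0 //.
by move: h2; rewrite ltr_pdivrMr // -natr1 mulrDl mul1r mulrC => /ltW.
Qed.

End Steinhaus.

(** * The integral operator *)

Section Rint.
Context d (T : measurableType d) (R : realType) (m : {measure set T -> \bar R}).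
Implicit Types (f g : T -> R).

Lemma Rintegral_dist f g : m.-integrable setT (EFin \o f) ->
  m.-integrable setT (EFin \o g) ->
  ((`|\int[m]_x f x - \int[m]_x g x|%R)%:E <= L1dist m f g)%E.
Proof.
move=> fi gi.
have fgi : m.-integrable setT (EFin \o (fun x => f x - g x)).
  by have := integrableB measurableT fi gi.
rewrite -RintegralB //; apply: le_trans (_ : (_ <= (\int[m]_x `|f x - g x|)%:E)%E) _.
  by rewrite lee_fin; exact: le_normr_Rintegral.
rewrite /Rintegral /L1dist fineK // integrable_fin_num //.
exact: (integrable_abse fgi).
Qed.

Lemma ge0_integrable f g : measurable_fun setT f -> (forall x, 0 <= f x <= g x) ->
  m.-integrable setT (EFin \o g) -> m.-integrable setT (EFin \o f).
Proof.
move=> mf fg; apply: le_integrable => //; first exact/measurable_EFinP.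
move=> x _ /=; rewrite lee_fin; have /andP[f0 fgx] := fg x.
by rewrite !ger0_norm // (le_trans f0).
Qed.

End Rint.

Lemma compact_ucont {R : realType} (h : R -> R) (a b : R) : continuous h ->
  forall e : R, 0 < e -> exists2 d : R, 0 < d &
    forall x y, a <= x <= b -> `|x - y| < d -> `|h x - h y| <= e.
Proof.
move=> hc e e0; have e2 : 0 < e / 2 by lra.
have := (compact_near_coveringP _).1 (@segment_compact R a b).
move=> /(_ R 0^'+ (fun d x => forall y, `|x - y| < d -> `|h x - h y| <= e)).
case => [x xab|d /= d0 H].
- have := hc x => /cvgrPdist_le/(_ _ e2)[r /= r0 hr].
  exists (ball x (r / 2), [set d | 0 < d < r / 2]) => /=.
    split; first by apply: nbhsx_ballx; rewrite divr_gt0.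
    exists (r / 2); first by rewrite /= divr_gt0.
    move=> d /=; rewrite sub0r normrN => dr d0; rewrite d0 /=.
    by rewrite gtr0_norm in dr.
  move=> [x' d] [/= xx' /andP[d0 dr]] y xy.
  have h1 : `|h x - h x'| <= e / 2.
    by apply: hr; rewrite /ball /= in xx' *; lra.
  have h2 : `|h x - h y| <= e / 2.
    apply: hr; rewrite /ball_ /= in xx' *.
    have := ler_distD x' x y; rewrite /ball /= in xx'; lra.
  by move: h1 h2; rewrite !ler_norml; lra.
exists (d / 2); first by rewrite divr_gt0.
move=> x y xab xy; apply: (H (d / 2)) => //.
- by rewrite /= sub0r normrN gtr0_norm ?divr_gt0 // ltr_pdivrMr // ltr_pMr // ltr1n.
- by rewrite divr_gt0.
Qed.

Section Operator.
Context (R : realType) (d : measure_display) (X : measurableType d)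
  (mu : {finite_measure set X -> \bar R}).
Local Notation leb := (@lebesgue_measure R).
Local Notation RM := (measurableTypeR R).
Local Notation Y := (RM * X)%type.
Local Notation m := (leb \x mu)%E.
Local Notation meas := (measurable_fun [set: R]).
Variables (K g : R -> X -> R) (g' : X -> R) (Z sg : R).
Hypothesis HK0 : forall s tau, 0 <= K s tau.
Hypothesis HKint : m.-integrable setT (fun p : R * X => (K p.1 p.2)%:E).
Hypothesis Hgmeas : measurable_fun ([set v : R | 0 <= v] `*` [set: X])
  (fun p : R * X => g p.1 p.2).
Hypothesis Hg0 : forall v tau, 0 <= v -> 0 <= g v tau.
Hypothesis Hgzero : forall tau, g 0 tau = 0.
Hypothesis Hgcont : forall tau,
  {within [set v : R | 0 <= v], continuous (fun v => g v tau)}.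
Hypothesis Hgder : forall tau, (g h tau - g 0 tau) / h @[h --> 0^'+] --> g' tau.
Hypothesis Hgderpos : forall tau, 0 < g' tau.
Hypothesis Hglin : forall s tau, 0 <= s -> g s tau <= g' tau * s.
Hypothesis Hchi0 : (chi_int mu K g' 0 < +oo)%E.
Hypothesis Z0 : 0 < Z.
Hypothesis sg1 : sg * sg = 1.

(** [g] is controlled only at nonnegative arguments; clamping lets the operator act on every
    measurable function, as the fixed point theorem requires, and changes nothing for values in
    [[0, Z]]. *)
Definition clamp (v : R) : R := Num.min Z (Num.max 0 v).
Definition gclamp v tau := g (clamp v) tau.
Definition integrand (phi : R -> R) (t : R) (y : Y) : R :=
  K y.1 y.2 * gclamp (phi (t - sg * y.1)) y.2.
Definition opA (phi : R -> R) (t : R) : R := \int[m]_y integrand phi t y.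
(** Kernel of the linearisation of (E) at 0; its mass is [1 - chi(0)]. *)
Definition qker (y : Y) : R := K y.1 y.2 * g' y.2.

Lemma clamp_in v : 0 <= clamp v <= Z.
Proof. by rewrite /clamp le_min ltW //= le_max lexx ge_min lexx. Qed.

Lemma clamp_id v : 0 <= v <= Z -> clamp v = v.
Proof. by move=> /andP[v0 vZ]; rewrite /clamp max_r // min_r. Qed.

Lemma clamp_le v : clamp v <= Num.max 0 v.
Proof. by rewrite ge_min lexx orbT. Qed.

Lemma clamp_lip u v : `|clamp u - clamp v| <= `|u - v|.
Proof.
apply: le_trans (min_lip _ _ _ _) _; rewrite subrr normr0 ge_max normr_ge0 /=.
by apply: le_trans (max_lip _ _ _ _) _; rewrite subrr normr0 ge_max normr_ge0 lexx.
Qed.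

Lemma clamp_continuous : continuous clamp.
Proof.
by apply: ucont_continuous => e e0; exists e => // t t' /ltW; apply: le_trans (clamp_lip _ _).
Qed.

Lemma clamp_measurable : meas clamp.
Proof. by have /continuous_measurable_fun := clamp_continuous. Qed.

Lemma gclamp_ge0 v tau : 0 <= gclamp v tau.
Proof. by apply: Hg0; case/andP: (clamp_in v). Qed.

Lemma gclamp_lin v tau : gclamp v tau <= g' tau * clamp v.
Proof. by apply: Hglin; case/andP: (clamp_in v). Qed.

Lemma gclamp_le v tau : gclamp v tau <= g' tau * Z.
Proof.
apply: le_trans (gclamp_lin _ _) _; rewrite ler_pM2l //.
by case/andP: (clamp_in v).
Qed.

Lemma gclamp_continuous tau : continuous (gclamp^~ tau).
Proof.
move=> v; have cv : [set v : R | 0 <= v] (clamp v) by case/andP: (clamp_in v).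
have h := (subspace_continuousP _ _).1 (@Hgcont tau) (clamp v) cv.
apply: (@cvg_comp _ _ _ clamp (fun u => g u tau)) h.
move=> U; rewrite /within /= => hU.
have := clamp_continuous hU; rewrite /= nbhs_simpl /=.
apply: filterS => u; apply; by case/andP: (clamp_in u).
Qed.

Lemma gclamp_ucont tau (e : R) : 0 < e -> exists2 r : R, 0 < r &
  forall u v, `|u - v| < r -> `|gclamp u tau - gclamp v tau| <= e.
Proof.
move=> e0; have [r r0 hr] := @compact_ucont _ _ 0 Z (gclamp_continuous (tau := tau)) _ e0.
have clK v : clamp (clamp v) = clamp v by rewrite (clamp_id (clamp_in v)).
exists r => // u v uv; rewrite /gclamp -(clK u) -(clK v); apply: hr.
  exact: clamp_in.
exact: le_lt_trans (clamp_lip u v) uv.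
Qed.

Lemma gclamp_measurable : measurable_fun [set: Y] (fun y : Y => gclamp y.1 y.2).
Proof.
have mc : measurable_fun [set: Y] (fun y : Y => (clamp y.1, y.2) : R * X).
  apply: measurable_fun_pair => //.
  by apply: measurableT_comp measurable_fst; exact: clamp_measurable.
apply: (measurable_comp _ _ Hgmeas mc).
  by apply: measurableX => //; rewrite -set_itvcy.
by move=> _ [y _ <-] /=; split => //=; case/andP: (clamp_in y.1).
Qed.

Lemma K_measurable : measurable_fun [set: Y] (fun y : Y => K y.1 y.2).
Proof. by case/integrableP: HKint => /measurable_EFinP. Qed.

Lemma integrand_measurable phi t : meas phi -> measurable_fun [set: Y] (integrand phi t).
Proof.
move=> mphi; apply: measurable_funM; first exact: K_measurable.
have mp : measurable_fun [set: Y] (fun y : Y => (phi (t - sg * y.1), y.2) : Y).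
  apply: measurable_fun_pair => //; apply: measurableT_comp mphi _.
  apply: measurable_funB => //; apply: measurable_funM => //; exact: measurable_fst.
exact: (measurableT_comp gclamp_measurable mp).
Qed.

Lemma g_measurable v : 0 <= v -> measurable_fun [set: X] (g v).
Proof.
move=> v0; have mp : measurable_fun [set: X] (fun tau => (v, tau) : R * X).
  by apply: measurable_fun_pair => //; exact: measurable_cst.
apply: (measurable_comp _ _ Hgmeas mp) => //.
  by apply: measurableX => //; rewrite -set_itvcy.
by move=> _ [tau _ <-].
Qed.

Lemma g'_measurable : measurable_fun [set: X] g'.
Proof.
apply: (measurable_fun_cvg (h := fun n tau => (g n.+1%:R^-1 tau - g 0 tau) / n.+1%:R^-1)).
  move=> n; apply: measurable_funM => //; apply: measurable_funB; exact: g_measurable.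
move=> tau _; have H : n.+1%:R^-1 @[n --> \oo] --> (0^'+ : set_system R).
  move=> U [e /= e0 hU]; suff : \forall n \near \oo, U n.+1%:R^-1 by [].
  near=> n; apply: hU => /=; rewrite ?invr_gt0 // sub0r normrN ger0_norm //.
  by near: n; exact: (near_infty_natSinv_lt (PosNum e0)).
exact: (cvg_comp _ _ H (@Hgder tau)).
Unshelve. all: by end_near. Qed.

Lemma qker_ge0 y : 0 <= qker y.
Proof. by rewrite mulr_ge0 // ltW. Qed.

Lemma qker_measurable : measurable_fun [set: Y] qker.
Proof.
apply: measurable_funM; first exact: K_measurable.
exact: measurableT_comp g'_measurable measurable_snd.
Qed.

Lemma chi_intE z : chi_int mu K g' z = (\int[m]_y (qker y * expR (- (y.1 * z)))%:E)%E.
Proof.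
rewrite fubini_tonelli2 //; last first.
  by move=> y; rewrite lee_fin mulr_ge0 ?expR_ge0 ?qker_ge0.
apply/measurable_EFinP; apply: measurable_funM; first exact: qker_measurable.
apply: measurableT_comp => //; apply: measurableT_comp => //.
apply: measurable_funM => //; exact: measurable_fst.
Qed.

Lemma qker_integrable : m.-integrable setT (EFin \o qker).
Proof.
apply/integrableP; split; first by apply/measurable_EFinP; exact: qker_measurable.
rewrite (_ : (\int[m]_y _)%E = chi_int mu K g' 0) //.
rewrite chi_intE; apply: eq_integral => y _.
by rewrite mulr0 oppr0 expR0 mulr1 /= ger0_norm // qker_ge0.
Qed.

Lemma integrand_ge0 phi t y : 0 <= integrand phi t y.
Proof. by rewrite mulr_ge0 // gclamp_ge0. Qed.

Lemma integrand_lin phi t y :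
  integrand phi t y <= qker y * Num.max 0 (phi (t - sg * y.1)).
Proof.
rewrite -mulrA ler_wpM2l //; apply: le_trans (gclamp_lin _ _) _.
by rewrite ler_pM2l // clamp_le.
Qed.

Lemma integrand_le phi t y : integrand phi t y <= qker y * Z.
Proof. by rewrite -mulrA ler_wpM2l // gclamp_le. Qed.

Lemma qkerZ_integrable r : m.-integrable setT (EFin \o (fun y => qker y * r)).
Proof.
have := integrableZl measurableT r qker_integrable.
by apply: eq_integrable => // y _ /=; rewrite mulrC EFinM.
Qed.

Lemma integrand_integrable phi t : meas phi -> m.-integrable setT (EFin \o integrand phi t).
Proof.
move=> mphi; apply: (ge0_integrable _ _ (qkerZ_integrable Z)).
  exact: integrand_measurable.
by move=> y; rewrite integrand_ge0 integrand_le.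
Qed.

Lemma opA_shift phi c t : opA (fun u => phi (u + c)) t = opA phi (t + c).
Proof.
by congr fine; apply: eq_integral => y _; rewrite /integrand addrAC.
Qed.

Lemma opA_ge0 phi t : 0 <= opA phi t.
Proof. by apply: Rintegral_ge0 => y _; exact: integrand_ge0. Qed.

(** Dominated convergence with majorant [Z K g']. The modulus of continuity of [g(., tau)] depends
    on [tau], so bounds uniform in [phi] and [t] are reached through sequences; the evaluation
    points move along with the functions to serve the argument by contradiction in [opA_unif]. *)
Lemma opA_cvg (phi psi : nat -> R -> R) (t u : nat -> R) :
  (forall n, meas (phi n)) -> (forall n, meas (psi n)) ->
  (forall s, phi n (t n - s) - psi n (u n - s) @[n --> \oo] --> 0) ->
  forall e : R, 0 < e -> \forall n \near \oo, `|opA (phi n) (t n) - opA (psi n) (u n)| <= e.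
Proof.
move=> mphi mpsi h e e0.
have := @dominated_cvg0 _ _ _ m
  (fun n y => integrand (phi n) (t n) y - integrand (psi n) (u n) y)
  (fun y => qker y * Z).
move=> /(_ _ (qkerZ_integrable Z) _ _ e e0) H.
have {}H : \forall n \near \oo,
    (L1dist m (integrand (phi n) (t n)) (integrand (psi n) (u n)) <= e%:E)%E.
  apply: H.
  - by move=> n; apply: measurable_funB; exact: integrand_measurable.
  - apply: aeW => y; apply/cvgrPdist_le => r r0.
    have K1 : 0 < K y.1 y.2 + 1 by rewrite ltr_wpDl.
    have [r1 r10 hr1] := @gclamp_ucont y.2 _ (divr_gt0 r0 K1).
    have /cvgrPdist_lt/(_ _ r10) := h (sg * y.1).
    apply: filterS => n; rewrite !sub0r !normrN => /hr1 hn.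
    rewrite -mulrBr normrM ger0_norm //; apply: le_trans (ler_wpM2l _ hn) _ => //.
    by rewrite mulrCA ger_pMr // ler_pdivrMr // mul1r lerDl.
  - move=> n y; have h1 := integrand_ge0 (phi n) (t n) y.
    have h2 := integrand_ge0 (psi n) (u n) y.
    have h3 := integrand_le (phi n) (t n) y.
    have h4 := integrand_le (psi n) (u n) y.
    by rewrite ler_norml; lra.
apply: filterS H => n hn; rewrite -lee_fin; apply: le_trans hn.
by apply: Rintegral_dist; exact: integrand_integrable.
Qed.

Lemma opA_pointwise (f : nat -> R -> R) (phi : R -> R) : (forall n, meas (f n)) -> meas phi ->
  (forall t, f n t @[n --> \oo] --> phi t) ->
  forall t, opA (f n) t @[n --> \oo] --> opA phi t.
Proof.
move=> mf mphi h t; apply/cvgrPdist_le => e e0.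
have := @opA_cvg f (fun=> phi) (fun=> t) (fun=> t) mf (fun=> mphi).
move=> H; apply: filterS (H _ e e0) => [n|s]; first by rewrite distrC.
by rewrite -(subrr (phi (t - s))); apply: cvgB; [exact: h|exact: cvg_cst].
Qed.

Lemma opA_unif (e : R) : 0 < e -> exists2 r : R, 0 < r &
  forall phi psi : R -> R, meas phi -> meas psi -> (forall t, `|phi t - psi t| <= r) ->
  forall t, `|opA phi t - opA psi t| <= e.
Proof.
move=> e0; apply: contrapT => h.
have /choice[w Hw] (n : nat) : exists w : (R -> R) * (R -> R) * R,
    [/\ meas w.1.1, meas w.1.2, (forall t, `|w.1.1 t - w.1.2 t| <= n.+1%:R^-1) &
    e < `|opA w.1.1 w.2 - opA w.1.2 w.2|].
  apply: contrapT => hn; apply: h; exists n.+1%:R^-1; first by rewrite invr_gt0.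
  move=> phi psi mphi mpsi hd t; rewrite leNgt; apply/negP => ht.
  by apply: hn; exists (phi, psi, t).
have [|||N _ hN] := @opA_cvg (fun n => (w n).1.1) (fun n => (w n).1.2)
  (fun n => (w n).2) (fun n => (w n).2) _ _ _ e e0.
- by move=> n; case: (Hw n).
- by move=> n; case: (Hw n).
- move=> s; apply: (cvg_dist_le (b := 0) (g := fun n => n.+1%:R^-1)) => [n|].
    by rewrite !subr0 [leRHS]ger0_norm //; case: (Hw n).
  exact: cvg_harmonic.
have := hN N (leqnn N); case: (Hw N) => _ _ _ h'.
by rewrite /= leNgt h'.
Qed.

Lemma opA_exp (phi : R -> R) (lam B t : R) : meas phi -> 0 <= B ->
  (chi_int mu K g' (sg * lam) < +oo)%E ->
  (forall u, phi u <= B * expR (lam * u)) ->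
  opA phi t <= fine (chi_int mu K g' (sg * lam)) * B * expR (lam * t).
Proof.
move=> mphi B0 cfin hphi.
pose qe (y : Y) := qker y * expR (- (y.1 * (sg * lam))).
have iq : m.-integrable setT (EFin \o qe).
  apply/integrableP; split.
    apply/measurable_EFinP; apply: measurable_funM; first exact: qker_measurable.
    apply: measurableT_comp => //; apply: measurableT_comp => //.
    apply: measurable_funM => //; exact: measurable_fst.
  rewrite (_ : (\int[m]_y _)%E = chi_int mu K g' (sg * lam)) //.
  rewrite chi_intE; apply: eq_integral => y _ /=.
  by rewrite ger0_norm // mulr_ge0 ?expR_ge0 ?qker_ge0.
rewrite chi_intE -mulrA mulrC -/(Rintegral m setT qe) -RintegralZl //.
apply: le_Rintegral => //; first exact: integrand_integrable.
  have := integrableZl measurableT (B * expR (lam * t)) iq.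
  by apply: eq_integrable.
move=> y _; apply: le_trans (integrand_lin _ _ _) _.
rewrite /qe mulrCA; apply: ler_wpM2l; first exact: qker_ge0.
rewrite -mulrA -expRD (_ : lam * t + _ = lam * (t - sg * y.1)); last by ring.
by rewrite ge_max hphi mulr_ge0 // expR_ge0.
Qed.

(** * Equicontinuity of the images of the operator *)

Lemma shift_measurable (c : R) : measurable_fun [set: Y] (fun y : Y => (y.1 + c, y.2) : Y).
Proof.
apply: measurable_fun_pair => //.
exact: (measurableT_comp (measurable_shift c) measurable_fst).
Qed.

Lemma product_shift (c : R) (F : Y -> \bar R) : measurable_fun [set: Y] F ->
  (forall y, 0 <= F y)%E -> (\int[m]_y F (y.1 + c, y.2)%R = \int[m]_y F y)%E.
Proof.
move=> mF F0; rewrite fubini_tonelli2 //; last first.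
  exact: (measurableT_comp mF (shift_measurable c)).
rewrite [RHS]fubini_tonelli2 //; apply: eq_integral => tau _; rewrite /fubini_G /=.
apply: (ge0_integral_shift c (f := fun s => F (s, tau))) => //.
exact: (measurableT_comp mF (measurable_pair2 tau)).
Qed.

(** Continuity of translations in L1 for almost every [tau], then dominated convergence in [tau],
    the distance being at most twice the mass of the fibre. *)
Lemma qker_translation (c : nat -> R) : c n @[n --> \oo] --> 0 ->
  forall e : R, 0 < e -> \forall n \near \oo,
    (L1dist m (fun y => qker (y.1 + c n, y.2)%R) qker <= e%:E)%E.
Proof.
move=> c0 e e0; have mq := qker_measurable.
have mqs n : measurable_fun [set: Y] (fun y : Y => qker (y.1 + c n, y.2)).
  exact: (measurableT_comp mq (shift_measurable (c n))).
pose I n tau := L1dist leb (fun s => qker (s + c n, tau)) (fun s => qker (s, tau)).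
pose J tau := (\int[leb]_s (qker (s, tau))%:E)%E.
have IE n : L1dist m (fun y => qker (y.1 + c n, y.2)) qker = (\int[mu]_tau I n tau)%E.
  rewrite /L1dist fubini_tonelli2 //.
  by apply/measurable_EFinP; exact: measurable_dist.
have mI n : measurable_fun [set: X] (I n).
  apply: (measurable_fun_fubini_tonelli_G (m1 := leb)
    (fun y => (`|qker (y.1 + c n, y.2) - qker y|)%:E)) => //.
  by apply/measurable_EFinP; exact: measurable_dist.
have mJ : measurable_fun [set: X] J.
  apply: (measurable_fun_fubini_tonelli_G (m1 := leb) (fun y => (qker y)%:E)) => //.
    exact/measurable_EFinP.
  by move=> y; rewrite lee_fin qker_ge0.
have mqt tau : measurable_fun [set: RM] (fun s : RM => qker (s, tau)).
  exact: (measurableT_comp mq (measurable_pair2 tau)).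
have mqst r tau : measurable_fun [set: RM] (fun s : RM => qker (s + r, tau)).
  exact: (measurableT_comp (mqt tau) (measurable_shift r)).
have IJ n tau : (I n tau <= J tau + J tau)%E.
  have -> : J tau = L1dist leb (fun s => qker (s, tau)) (fun=> 0).
    by apply: eq_integral => s _; rewrite subr0 ger0_norm // qker_ge0.
  have m0 : measurable_fun [set: RM] (fun=> 0 : R) by exact: measurable_cst.
  have := L1dist_triangle leb (mqst (c n) tau) m0 (mqt tau).
  have -> := L1dist_shift (c n) (mqt tau) m0.
  by rewrite [X in (_ <= _ + X)%E]L1distC.
have I0 n tau : (0 <= I n tau)%E by apply: integral_ge0 => s _; rewrite lee_fin.
have iJ : mu.-integrable setT J.
  apply/integrableP; split => //.
  have /integrableP[_] := qker_integrable; rewrite fubini_tonelli2 //; last first.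
    by apply: measurableT_comp => //; exact/measurable_EFinP.
  apply: le_lt_trans; apply: ge0_le_integral => //.
  - exact: measurableT_comp.
  - apply: (measurable_fun_fubini_tonelli_G (m1 := leb)) => //.
    by apply: measurableT_comp => //; exact/measurable_EFinP.
  - move=> tau _; rewrite gee0_abs; last by apply: integral_ge0 => s _; rewrite lee_fin qker_ge0.
    apply: ge0_le_integral => //.
    + by move=> s _; rewrite lee_fin qker_ge0.
    + exact/measurable_EFinP.
    + by apply: measurableT_comp => //; exact/measurable_EFinP.
    + by move=> s _; exact: lee_abs.
have aeI : {ae mu, forall tau, I n tau @[n --> \oo] --> 0%E}.
  have := ae_integrable2 qker_integrable.
  apply: filterS => tau itau; apply/fine_cvgP; split.
    near=> n; rewrite ge0_fin_numE //.
    have h : (I n tau <= 1%:E)%E.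
      by near: n; exact: (L1_translation (f := fun s => qker (s, tau)) itau c0 ltr01).
    exact: le_lt_trans h (ltry _).
  apply/cvgrPdist_le => r r0; near=> n.
  have h : (I n tau <= r%:E)%E.
    by near: n; exact: (L1_translation (f := fun s => qker (s, tau)) itau c0 r0).
  rewrite sub0r normrN ger0_norm ?fine_ge0 // -lee_fin fineK //.
  by rewrite ge0_fin_numE // (le_lt_trans h) // ltry.
have [|||||_ + _] := @dominated_convergence _ _ _ mu setT measurableT I (cst 0%E)
    (fun tau => J tau + J tau)%E.
- exact: mI.
- exact: measurable_cst.
- by apply: filterS aeI.
- exact: integrableD.
- by apply: aeW => tau n _; rewrite gee0_abs.
move=> /fine_cvgP[fn]; move=> /cvgrPdist_le/(_ _ e0).
apply: filterS2 fn => n /= fn; rewrite sub0r normrN IE.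
have E : (\int[mu]_tau `|I n tau - 0| = \int[mu]_tau I n tau)%E.
  by apply: eq_integral => x _; rewrite sube0 gee0_abs.
rewrite E in fn *; move=> /(le_trans (ler_norm _)).
by rewrite -lee_fin fineK.
Unshelve. all: by end_near. Qed.

(** Moves the time shift from [phi] to the kernel; [sg * sg = 1] cancels the sign in the change of
    variable. *)
Lemma opA_translate (phi : R -> R) (t t' : R) : meas phi ->
  opA phi t = \int[m]_y (K (y.1 + sg * (t - t')) y.2 * gclamp (phi (t' - sg * y.1)) y.2).
Proof.
move=> mphi; congr fine.
rewrite -(product_shift (sg * (t - t')) (F := fun y => (integrand phi t y)%:E)).
- apply: eq_integral => y _; congr (_%:E); rewrite /integrand /=.
  congr (_ * gclamp (phi _) _); rewrite mulrDr mulrA sg1 mul1r; ring.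
- by apply/measurable_EFinP; exact: integrand_measurable.
- by move=> y; rewrite lee_fin integrand_ge0.
Qed.

(** Clamped values satisfy [g(v, tau) <= Z g'(tau)], so the difference of the kernels [K] is
    weighted by at most [Z g']. The bound does not depend on [phi]: all images share one modulus. *)
Lemma opA_dist_translate (phi : R -> R) (t t' : R) : meas phi ->
  ((`|opA phi t - opA phi t'|)%:E <=
    Z%:E * L1dist m (fun y => qker (y.1 + sg * (t - t'), y.2)%R) qker)%E.
Proof.
move=> mphi; set c := sg * (t - t').
pose F (y : Y) := K (y.1 + c) y.2 * gclamp (phi (t' - sg * y.1)) y.2.
have iF : m.-integrable setT (EFin \o F).
  have mKc : measurable_fun [set: Y] (fun y : Y => K (y.1 + c) y.2).
    exact: (measurableT_comp K_measurable (shift_measurable c)).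
  have mp : measurable_fun [set: Y] (fun y : Y => (phi (t' - sg * y.1), y.2) : Y).
    apply: measurable_fun_pair => //; apply: measurableT_comp mphi _.
    apply: measurable_funB => //; apply: measurable_funM => //; exact: measurable_fst.
  apply: (@ge0_integrable _ _ _ _ F (fun y => qker (y.1 + c, y.2) * Z)).
  - apply: measurable_funM => //; exact: (measurableT_comp gclamp_measurable mp).
  - move=> y; rewrite mulr_ge0 ?gclamp_ge0 //= -mulrA ler_wpM2l //; exact: gclamp_le.
  - apply/integrableP; split.
      apply/measurable_EFinP; apply: measurable_funM => //.
      exact: (measurableT_comp qker_measurable (shift_measurable c)).
    have /integrableP[_] := qkerZ_integrable Z.
    rewrite -(product_shift c) //; apply: measurableT_comp => //.
    apply/measurable_EFinP; apply: measurable_funM => //; exact: qker_measurable.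
rewrite (opA_translate t t' mphi) -/c.
apply: le_trans (Rintegral_dist iF (integrand_integrable t' mphi)) _.
rewrite /L1dist -ge0_integralZl_EFin //; last 2 first.
- apply/measurable_EFinP; apply: measurable_dist; last exact: qker_measurable.
  exact: (measurableT_comp qker_measurable (shift_measurable c)).
- exact: ltW.
apply: ge0_le_integral => //.
- apply/measurable_EFinP; apply: measurable_dist; last exact: integrand_measurable.
  by case/integrableP: iF => /measurable_EFinP.
- apply: emeasurable_funM => //; apply/measurable_EFinP; apply: measurable_dist.
    exact: (measurableT_comp qker_measurable (shift_measurable c)).
  exact: qker_measurable.
move=> y _; rewrite -EFinM lee_fin.
have -> : F y - integrand phi t' y =
    (K (y.1 + c) y.2 - K y.1 y.2) * gclamp (phi (t' - sg * y.1)) y.2 by rewrite mulrBl.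
have -> : qker (y.1 + c, y.2) - qker y = (K (y.1 + c) y.2 - K y.1 y.2) * g' y.2.
  by rewrite mulrBl.
rewrite !normrM (ger0_norm (gclamp_ge0 _ _)) (gtr0_norm (Hgderpos _)).
by rewrite [leRHS]mulrCA ler_wpM2l // [leRHS]mulrC gclamp_le.
Qed.

Lemma opA_equicont : equicont (fun phi : {phi : R -> R | meas phi} => opA (sval phi)).
Proof.
move=> e e0; apply: contrapT => h.
have /choice[w Hw] (n : nat) : exists w : (R -> R) * R * R,
    [/\ meas w.1.1, `|w.1.2 - w.2| < n.+1%:R^-1 &
    e < `|opA w.1.1 w.1.2 - opA w.1.1 w.2|].
  apply: contrapT => hn; apply: h; exists n.+1%:R^-1; first by rewrite invr_gt0.
  move=> [phi mphi] t t' tt; rewrite leNgt; apply/negP => ht.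
  by apply: hn; exists (phi, t, t').
have c0 : sg * ((w n).1.2 - (w n).2) @[n --> \oo] --> 0.
  rewrite -(mulr0 sg); apply: cvgMr.
  apply: (cvg_dist_le (b := 0) (g := fun n => n.+1%:R^-1)) => [n|].
    by rewrite !subr0 [leRHS]ger0_norm // ltW //; case: (Hw n).
  exact: cvg_harmonic.
have eZ : 0 < e / Z by rewrite divr_gt0.
have [N _ hN] := qker_translation c0 eZ.
have [mw _ hw] := Hw N; have := hN N (leqnn N) => /= h1.
have h2 := le_trans (opA_dist_translate (w N).1.2 (w N).2 mw)
  (lee_wpmul2l (ltW Z0 : (0 <= Z%:E)%E) h1).
by move: h2; rewrite -EFinM lee_fin mulrCA divff ?lt0r_neq0 // mulr1 leNgt hw.
Qed.


(** * Comparison with the scalar map [G] *)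

Variable tau0 : X.
Hypothesis mtau0 : measurable [set tau0].
Hypothesis mu_tau0 : mu [set tau0] = 1%E.
Hypothesis g_mono : forall tau, tau <> tau0 ->
  forall u v, 0 <= u -> u <= v -> g u tau <= g v tau.
Local Notation C := (Cconst K tau0).
Local Notation gt := (gtilde mu K g tau0).

(** Freezes the [tau <> tau0], where [g] is monotone, at one end [a] of the range, and [tau0] at a
    chosen point [v]; such integrands bound that of [A phi] from either side. *)
Definition gmix (a v : R) (tau : X) : R :=
  \1_[set tau0] tau * g v tau0 + \1_(~` [set tau0]) tau * g a tau.

Lemma gmix_tau0 a v : gmix a v tau0 = g v tau0.
Proof. by rewrite /gmix !indicE mem_set // memNset ?mul1r ?mul0r ?addr0 //; exact. Qed.

Lemma gmix_neq a v tau : tau <> tau0 -> gmix a v tau = g a tau.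
Proof. by move=> h; rewrite /gmix !indicE memNset // mem_set ?mul1r ?mul0r ?add0r. Qed.

Lemma gmix_measurable a v : 0 <= a -> 0 <= v -> measurable_fun [set: X] (gmix a v).
Proof.
move=> a0 v0; apply: measurable_funD.
  by apply: measurable_funM => //; exact: measurable_indic.
apply: measurable_funM; last exact: g_measurable.
by apply: measurable_indic; exact: measurableC.
Qed.

Lemma gmix_bounds a v tau : 0 <= a -> 0 <= v ->
  0 <= gmix a v tau <= g' tau * Num.max a v.
Proof.
move=> a0 v0; have [->|/eqP ne] := eqVneq tau tau0.
  rewrite gmix_tau0 Hg0 //= (le_trans (Hglin _ _)) // ler_pM2l //.
  by rewrite le_max lexx orbT.
rewrite gmix_neq // Hg0 //= (le_trans (Hglin _ _)) // ler_pM2l //.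
by rewrite le_max lexx.
Qed.

Definition mixI (a v : R) : R := \int[m]_y (K y.1 y.2 * gmix a v y.2).

Lemma mix_integrable a v : 0 <= a -> 0 <= v ->
  m.-integrable setT (EFin \o (fun y => K y.1 y.2 * gmix a v y.2)).
Proof.
move=> a0 v0; apply: (ge0_integrable _ _ (qkerZ_integrable (Num.max a v))).
  apply: measurable_funM; first exact: K_measurable.
  exact: (measurableT_comp (gmix_measurable a0 v0) measurable_snd).
move=> y; have /andP[h1 h2] := gmix_bounds y.2 a0 v0.
by rewrite mulr_ge0 //= -mulrA ler_wpM2l.
Qed.

(** The atom at [tau0] has mass one, hence contributes exactly [C g(v, tau0)]. So [mixI a v <= a]
    says [C g(v, tau0) <= Theta a], which for [a] in [[0, Z]] gives [G v <= a]. *)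
Lemma mixIE a v : 0 <= a -> 0 <= v -> mixI a v = gt a + C * g v tau0.
Proof.
move=> a0 v0; pose J tau := (\int[leb]_s (K s tau)%:E)%E.
have J0 tau : (0 <= J tau)%E by apply: integral_ge0 => s _; rewrite lee_fin.
have mK := K_measurable.
have mJ : measurable_fun [set: X] J.
  apply: (measurable_fun_fubini_tonelli_G (m1 := leb) (fun y => (K y.1 y.2)%:E)) => //.
    exact/measurable_EFinP.
  by move=> y; rewrite lee_fin.
have mKt tau : measurable_fun [set: RM] (K^~ tau).
  exact: (measurableT_comp mK (measurable_pair2 tau)).
have gm0 tau : 0 <= gmix a v tau by case/andP: (gmix_bounds tau a0 v0).
have mgm := gmix_measurable a0 v0.
pose W tau := ((gmix a v tau)%:E * J tau)%E.
have W0 tau : (0 <= W tau)%E by rewrite mule_ge0 // lee_fin.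
have mW : measurable_fun [set: X] W.
  by apply: emeasurable_funM => //; exact/measurable_EFinP.
have E1 : (\int[m]_y (K y.1 y.2 * gmix a v y.2)%:E = \int[mu]_tau W tau)%E.
  rewrite fubini_tonelli2 //.
  - apply: eq_integral => tau _; rewrite /fubini_G /W /J /=.
    rewrite -ge0_integralZl_EFin //.
    + by apply: eq_integral => s _; rewrite mulrC EFinM.
    + by move=> s _; rewrite lee_fin.
    + exact/measurable_EFinP.
  - apply/measurable_EFinP; apply: measurable_funM => //.
    exact: (measurableT_comp mgm measurable_snd).
  - by move=> y; rewrite lee_fin mulr_ge0.
have E2 : (\int[mu]_tau W tau = \int[mu]_(tau in [set tau0]) W tau +
    \int[mu]_(tau in ~` [set tau0]) W tau)%E.
  rewrite -ge0_integral_setU ?setUv //; first exact: measurableC.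
  by apply/disj_setPCl.
have E3 : (\int[mu]_(tau in [set tau0]) W tau = (g v tau0)%:E * J tau0)%E.
  rewrite (eq_integral (fun=> ((g v tau0)%:E * J tau0)%E)); last first.
    by move=> tau; rewrite inE => ->; rewrite /W gmix_tau0.
  by rewrite integral_cst // [X in (_ * X)%E](_ : _ = 1%E) ?mule1.
have E4 : (\int[mu]_(tau in ~` [set tau0]) W tau =
    \int[mu]_(tau in ~` [set tau0]) ((g a tau)%:E * J tau))%E.
  by apply: eq_integral => tau; rewrite inE => h; rewrite /W gmix_neq.
have fin : (\int[mu]_tau W tau)%E \is a fin_num.
  by rewrite -E1; exact: (integrable_fin_num measurableT (mix_integrable a0 v0)).
have Jfin : J tau0 \is a fin_num.
  rewrite ge0_fin_numE //; have /integrableP[_] := HKint.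
  rewrite fubini_tonelli2 //; last by apply: measurableT_comp => //; exact/measurable_EFinP.
  apply: le_lt_trans; rewrite -[leLHS]mule1 -mu_tau0 -integral_cst //.
  apply: (@le_trans _ _ (\int[mu]_(x in [set tau0]) J x)%E).
    by rewrite le_eqVlt; apply/orP; left; apply/eqP; apply: eq_integral => x; rewrite inE => ->.
  rewrite (_ : (\int[mu]_y _)%E = \int[mu]_y J y)%E; last first.
    apply: eq_integral => tau _; apply: eq_integral => s _ /=.
    by rewrite ger0_norm.
  exact: ge0_subset_integral.
rewrite /mixI /Rintegral E1 E2 fineD.
- by rewrite addrC E4 E3 fineM //= mulrC.
- by rewrite E3 fin_numM.
- move: fin; rewrite E2 fin_numD => /andP[_]; exact.
Qed.

Variables (M vM : R).
Local Notation Th := (Theta mu K g tau0).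
Local Notation G := (Gmap mu K g tau0 Z).
Hypothesis g_tau0_gt0 : forall v, 0 < v -> 0 < g v tau0.
Hypothesis Theta_incr : forall u v, 0 <= u -> u < v -> v <= Z -> Th u < Th v.
Hypothesis vM0 : 0 <= vM.
Hypothesis g_vM : g vM tau0 = M.
Hypothesis g_le_M : forall v, 0 <= v -> g v tau0 <= M.
Hypothesis CM_lt : C * M < Th Z.

Lemma C_ge0 : 0 <= C.
Proof. by rewrite fine_ge0 // integral_ge0 // => s _; rewrite lee_fin. Qed.

Lemma opA_le_mixI phi t b w : meas phi -> 0 <= b -> 0 <= w ->
  (forall y : Y, gclamp (phi (t - sg * y.1)) y.2 <= gmix b w y.2) -> opA phi t <= mixI b w.
Proof.
move=> mphi b0 w0 h; apply: le_Rintegral => //.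
- exact: integrand_integrable.
- exact: mix_integrable.
- by move=> y _; rewrite ler_wpM2l.
Qed.

Lemma mixI_le_opA phi t a v : meas phi -> 0 <= a -> 0 <= v ->
  (forall y : Y, gmix a v y.2 <= gclamp (phi (t - sg * y.1)) y.2) -> mixI a v <= opA phi t.
Proof.
move=> mphi a0 v0 h; apply: le_Rintegral => //.
- exact: mix_integrable.
- exact: integrand_integrable.
- by move=> y _; rewrite ler_wpM2l.
Qed.

(** The upper bound [mixI Z vM] equals [gtilde Z + C M], and [C M < Theta Z] makes it smaller than
    [Z]. *)
Lemma opA_range phi t : meas phi -> 0 <= opA phi t <= Z.
Proof.
move=> mphi; rewrite opA_ge0 /=; apply: (@le_trans _ _ (mixI Z vM)).
  apply: opA_le_mixI => //; first exact: ltW.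
  move=> y; have /andP[c0 cZ] := clamp_in (phi (t - sg * y.1)).
  have [->|/eqP ne] := eqVneq y.2 tau0; first by rewrite gmix_tau0 g_vM; exact: g_le_M.
  by rewrite gmix_neq //; exact: g_mono.
rewrite (mixIE (ltW Z0) vM0) g_vM; move: CM_lt; rewrite /Theta; lra.
Qed.

Lemma opA_cst a t : 0 <= a <= Z -> opA (fun=> a) t = gt a + C * g a tau0.
Proof.
move=> /andP[a0 aZ]; rewrite -mixIE //; congr fine; apply: eq_integral => y _.
rewrite /integrand /gclamp clamp_id ?a0 //; congr ((_ * _)%:E).
by have [->|/eqP ne] := eqVneq y.2 tau0; rewrite ?gmix_tau0 ?gmix_neq.
Qed.

(** Writes [gtilde] through the operator on constants, so that the continuity of [Theta] follows
    from that of [opA]. *)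
Lemma Theta_clampE x : Th (clamp x) =
  clamp x - (opA (fun=> clamp x) 0 - C * gclamp x tau0).
Proof. by rewrite opA_cst ?clamp_in // addrK. Qed.

Lemma Theta_clamp_continuous : continuous (fun x => Th (clamp x)).
Proof.
rewrite (_ : (fun x => _) = fun x =>
  clamp x - (opA (fun=> clamp x) 0 - C * gclamp x tau0)); last first.
  by apply/funext => x; exact: Theta_clampE.
move=> x; apply: cvgB; first exact: clamp_continuous.
apply: cvgB; last by apply: cvgMr; exact: gclamp_continuous.
have uc : ucont (fun x => opA (fun=> clamp x) 0).
  move=> e e0; have [r r0 hr] := opA_unif e0; exists r => // u v uv.
  apply: hr; [exact: measurable_cst|exact: measurable_cst|] => _.
  exact: le_trans (clamp_lip _ _) (ltW uv).
exact: (ucont_continuous uc).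
Qed.

Lemma Theta0 : Th 0 = 0.
Proof.
have h : 0 <= (0 : R) <= Z by rewrite lexx ltW.
have := opA_cst 0 h; rewrite Hgzero mulr0 addr0 /Theta => <-; rewrite sub0r.
apply/eqP; rewrite oppr_eq0 eq_le opA_ge0 andbT.
have h0 : opA (fun=> 0) 0 <= \int[m]_y (0 : R).
  apply: le_Rintegral => //.
  - have m0 : meas (fun=> 0 : R) by exact: measurable_cst.
    exact: (integrand_integrable 0 m0).
  - exact: integrable0.
  - move=> y _; apply: le_trans (integrand_lin _ _ _) _.
    by rewrite max_l ?mulr0.
by apply: le_trans h0 _; rewrite Rintegral_cst ?mul0r.
Qed.

(** Ensures that [xget] in [Theta_inv] does not fall back on its default: [Theta] is continuous on
    [[0, Z]], and [C g(v, tau0)] lies between [Theta 0 = 0] and [Theta Z > C M]. *)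
Lemma G_spec v : 0 <= v -> 0 <= G v <= Z /\ Th (G v) = C * g v tau0.
Proof.
move=> v0; rewrite /Gmap /Theta_inv.
set y := C * g v tau0; set P := [set u | _].
suff [u Pu] : P !=set0.
  by have := @xgetPex _ 0 P (ex_intro _ u Pu).
have y0 : 0 <= y by rewrite mulr_ge0 ?C_ge0 ?Hg0.
have yZ : y < Th Z.
  by apply: le_lt_trans CM_lt; rewrite ler_wpM2l ?C_ge0 ?g_le_M.
have c0 : clamp 0 = 0 by rewrite clamp_id // lexx ltW.
have cZ : clamp Z = Z by rewrite clamp_id // lexx ltW.
have [u uZ uE] := @IVT _ (fun x => Th (clamp x)) 0 Z y (ltW Z0)
  (continuous_subspaceT Theta_clamp_continuous)
  (ltac:(rewrite /= c0 cZ Theta0 ge_min le_max y0 (ltW yZ) orbT //)).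
by exists u; rewrite /P /= -uE clamp_id.
Qed.

Lemma G_le u v : 0 <= v -> 0 <= u <= Z -> C * g v tau0 <= Th u -> G v <= u.
Proof.
move=> v0 /andP[u0 uZ] h; have [/andP[G0 GZ] GE] := G_spec v0.
rewrite leNgt; apply/negP => uG; have := Theta_incr u0 uG GZ.
by rewrite GE ltNge h.
Qed.

Lemma le_G u v : 0 <= v -> 0 <= u <= Z -> Th u <= C * g v tau0 -> u <= G v.
Proof.
move=> v0 /andP[u0 uZ] h; have [/andP[G0 GZ] GE] := G_spec v0.
rewrite leNgt; apply/negP => uG; have := Theta_incr G0 uG uZ.
by rewrite GE ltNge h.
Qed.

(** Strict monotonicity gives [Theta (G x + e) > C g(x, tau0)], hence [G z <= G x + e] for [z] near
    [x] by continuity of [g]; likewise from below. The case splits treat [G x + e] or [G x - e]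
    leaving [[0, Z]]. *)
Lemma G_clamp_continuous : continuous (fun x => G (clamp x)).
Proof.
move=> x; have cx v : 0 <= clamp v by case/andP: (clamp_in v).
have yc : continuous (fun x => C * gclamp x tau0).
  by move=> z; apply: cvgMr; exact: gclamp_continuous.
have [/andP[G0 GZ] GE] := G_spec (cx x).
apply/cvgrPdist_le => e e0.
have up : \forall z \near x, G (clamp z) <= G (clamp x) + e.
  have [h|h] := ltP Z (G (clamp x) + e).
    by near=> z; have [/andP[_ HZ] _] := G_spec (cx z); exact: le_trans HZ (ltW h).
  near=> z; apply: G_le => //; first by rewrite h addr_ge0 // ltW.
  apply: ltW; near: z; apply: (cvgr_lt _ (yc x)).
  by rewrite -[ltLHS]GE; apply: Theta_incr => //; rewrite ltrDl.
have lo : \forall z \near x, G (clamp x) - e <= G (clamp z).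
  have [h|h] := ltP (G (clamp x) - e) 0.
    by near=> z; have [/andP[H0 _] _] := G_spec (cx z); exact: le_trans (ltW h) H0.
  near=> z; apply: le_G => //.
    by rewrite h /= (le_trans _ GZ) // gerBl ltW.
  apply: ltW; near: z; apply: (cvgr_gt _ (yc x)).
  by rewrite -[ltRHS]GE; apply: Theta_incr => //; rewrite gtrBl.
near=> z; rewrite ler_distl; apply/andP; split.
  by rewrite lerBlDr; near: z.
by rewrite -lerBlDr; near: z.
Unshelve. all: by end_near. Qed.

(** With [v] a minimum point of [g(., tau0)] on [[a, b]], the integrand dominates the one of
    [gmix a v], so [mixI a v <= a]. *)
Lemma opA_env_low phi (a b t : R) : continuous phi -> 0 <= a -> b <= Z ->
  (forall u, a <= phi u <= b) -> opA phi t <= a -> exists2 v, a <= v <= b & G v <= a.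
Proof.
move=> cphi a0 bZ ab hA; have ab' : a <= b by have /andP[h1 h2] := ab 0; exact: le_trans h2.
have mphi : meas phi by have /continuous_measurable_fun := cphi.
have [v vab hv] := EVT_min ab' (continuous_subspaceT (gclamp_continuous (tau := tau0))).
rewrite in_itv /= in vab; exists v => //; have v0 : 0 <= v by lra.
apply: G_le => //; first lra.
have : mixI a v <= a.
  apply: le_trans hA; apply: mixI_le_opA => // y.
  have [h1 h2] := andP (ab (t - sg * y.1)).
  have cE : clamp (phi (t - sg * y.1)) = phi (t - sg * y.1) by apply: clamp_id; lra.
  have [->|/eqP ne] := eqVneq y.2 tau0.
    rewrite gmix_tau0; have := hv (phi (t - sg * y.1)); rewrite in_itv /= h1 h2 => /(_ isT).
    by rewrite {1}/gclamp clamp_id //; lra.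
  by rewrite gmix_neq // /gclamp cE; exact: g_mono.
rewrite mixIE // /Theta; lra.
Qed.

(** The mirror image, with a maximum point of [g(., tau0)] and the other [tau] frozen at [b]. *)
Lemma opA_env_up phi (a b t : R) : continuous phi -> 0 <= a -> b <= Z ->
  (forall u, a <= phi u <= b) -> b <= opA phi t -> exists2 v, a <= v <= b & b <= G v.
Proof.
move=> cphi a0 bZ ab hA; have ab' : a <= b by have /andP[h1 h2] := ab 0; exact: le_trans h2.
have mphi : meas phi by have /continuous_measurable_fun := cphi.
have [v vab hv] := EVT_max ab' (continuous_subspaceT (gclamp_continuous (tau := tau0))).
rewrite in_itv /= in vab; exists v => //; have v0 : 0 <= v by lra.
apply: le_G => //; first lra.
have b0 : 0 <= b by lra.
have : b <= mixI b v.
  apply: (le_trans hA); apply: opA_le_mixI => // y.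
  have [h1 h2] := andP (ab (t - sg * y.1)).
  have cE : clamp (phi (t - sg * y.1)) = phi (t - sg * y.1) by apply: clamp_id; lra.
  have [->|/eqP ne] := eqVneq y.2 tau0.
    rewrite gmix_tau0; have := hv (phi (t - sg * y.1)); rewrite in_itv /= h1 h2 => /(_ isT).
    by rewrite {2}/gclamp clamp_id //; lra.
  by rewrite gmix_neq // /gclamp cE; apply: g_mono => //; lra.
rewrite mixIE // /Theta; lra.
Qed.

(** * A linear minorant near zero *)

Hypothesis chi0_gt1 : 1 < fine (chi_int mu K g' 0).

Let mass_gt1 : 1 < \int[m]_y qker y.
Proof.
move: chi0_gt1; rewrite chi_intE.
by rewrite (eq_integral (EFin \o qker)) // => y _; rewrite mulr0 oppr0 expR0 mulr1.
Qed.

Let ratpt (i : nat) : R := if unpickle i is Some r then ratr r else 0.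

(** Tested at rational points only, which makes the set measurable; continuity of [g(., tau)]
    extends the inequality to real arguments. *)
Let good (r : R) (n : nat) : set X :=
  [set tau | forall i, 0 < ratpt i <= n.+1%:R^-1 -> r * g' tau * ratpt i <= g (ratpt i) tau].

Let good_measurable r n : measurable (good r n).
Proof.
have -> : good r n = \bigcap_i [set tau |
    0 < ratpt i <= n.+1%:R^-1 -> r * g' tau * ratpt i <= g (ratpt i) tau].
  by apply/seteqP; split => tau h i //; [move=> _|]; exact: h.
apply: bigcapT_measurable => i.
have [/andP[i0 i1]|h] := boolP (0 < ratpt i <= n.+1%:R^-1); last first.
  rewrite (_ : [set tau | _] = setT) //; apply/seteqP; split => // tau _ /=.
rewrite (_ : [set tau | _] =
    (fun tau => r * g' tau * ratpt i <= g (ratpt i) tau) @^-1` [set true]).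
  rewrite -[X in measurable X]setTI; apply: measurable_fun_ler => //.
    apply: measurable_funM => //; apply: measurable_funM => //; exact: g'_measurable.
  by apply: g_measurable; exact: ltW.
by apply/seteqP; split => tau /=; [move=> /(_ isT) ->|move=> ->].
Qed.

Let good_near r tau : r < 1 -> \forall n \near \oo, good r n tau.
Proof.
move=> r1; have g'0 := Hgderpos tau.
have : r * g' tau < g' tau by rewrite gtr_pMl.
move=> /(cvgr_gt _ (@Hgder tau)) [e /= e0 he].
near=> n => i /andP[v0 vn]; have := he (ratpt i).
rewrite /= sub0r normrN (gtr0_norm v0) => /(_ _ v0)/wrap[].
  apply: le_lt_trans vn _; near: n; exact: (near_infty_natSinv_lt (PosNum e0)).
by rewrite Hgzero subr0 ltr_pdivlMr // => /ltW.
Unshelve. all: by end_near. Qed.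

Let good_all r n tau v : good r n tau -> 0 <= v < n.+1%:R^-1 -> v <= Z ->
  r * g' tau * v <= g v tau.
Proof.
move=> gd /andP[v0 vn] vZ; have [->|vne] := eqVneq v 0; first by rewrite mulr0 Hgzero.
have {vne}v0' : 0 < v by rewrite lt_neqAle eq_sym vne.
have fc : continuous (fun v => gclamp v tau - r * g' tau * clamp v).
  move=> u; apply: cvgB; first exact: gclamp_continuous.
  by apply: cvgMr; exact: clamp_continuous.
rewrite leNgt; apply/negP => lt.
have := fc v => /cvgr_lt/(_ 0).
rewrite /gclamp clamp_id ?v0 // subr_lt0 lt => /(_ isT)[e /= e0 he].
have [q] : exists q, Num.max 0 (v - e) < q < v /\ exists i, ratpt i = q.
  have : Num.max 0 (v - e) < v by rewrite gt_max v0' gtrBl.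
  move=> /rat_in_itvoo[q]; rewrite in_itv /= => hq; exists (ratr q); split => //.
  by exists (pickle q); rewrite /ratpt pickleK.
rewrite gt_max => -[/andP[/andP[q0 qe] qv] [i iE]].
have := he q; rewrite /ball_ /= gtr0_norm ?subr_gt0 // => /(_ _)/wrap[]; first lra.
rewrite clamp_id; last by rewrite ltW //= (le_trans (ltW qv)).
have := gd i; rewrite iE q0 (le_trans (ltW qv) (ltW vn)) => /(_ isT).
by rewrite subr_lt0 ltNge => ->.
Qed.

(* On the set [good r n] of the [tau] with [g(v,tau) >= r g'(0,tau) v] for small [v], take
   [qh = r K g'], truncated to bounded [s]; the mass of [qh] tends to that of [K g'] as
   [r -> 1] and [n -> oo]. *)
Lemma minorant : exists (qh : Y -> R) (S vs : R),
  [/\ 0 < S, 0 < vs, measurable_fun [set: Y] qh & forall y, 0 <= qh y <= qker y] /\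
  [/\ forall y, S < `|y.1| -> qh y = 0, 1 < \int[m]_y qh y &
    forall v y, qh y * Num.min v vs <= K y.1 y.2 * gclamp v y.2].
Proof.
(* This [r] is below 1 and satisfies [r I = (1 + I) / 2 > 1]: half of the excess mass is kept. *)
set I := \int[m]_y qker y; pose r := (1 + I) / (2 * I).
have I0 : 0 < I by apply: lt_trans mass_gt1.
have rI : 1 < r * I by rewrite /r invfM mulrA divfK ?lt0r_neq0 //; move: mass_gt1; rewrite -/I; lra.
have [r0 r1] : 0 < r /\ r < 1.
  split; first by rewrite divr_gt0 ?mulr_gt0 // addr_gt0.
  rewrite ltr_pdivrMr ?mulr_gt0 // mul1r; move: mass_gt1; rewrite -/I; lra.
pose D n : set Y := [set y | good r n y.2 /\ `|y.1| <= n%:R].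
have mD n : measurable (D n).
  rewrite (_ : D n = (snd @^-1` good r n) `&` (fst @^-1` [set s : R | `|s| <= n%:R])) //.
  apply: measurableI.
    by rewrite -[X in measurable X]setTI; apply: measurable_snd => //; exact: good_measurable.
  rewrite -[X in measurable X]setTI; apply: measurable_fst => //.
  have : measurable (`[- n%:R, n%:R]%classic : set R) by exact: measurable_itv.
  congr measurable; apply/seteqP; split => s; rewrite /= in_itv /= ler_norml //.
pose qn n y := r * qker y * \1_(D n) y.
have qn0 n y : 0 <= qn n y <= r * qker y.
  have h : 0 <= r * qker y by rewrite mulr_ge0 ?qker_ge0 // ltW.
  by rewrite /qn indicE; case: (_ \in _); rewrite ?mulr1 ?mulr0 ?h ?lexx.
have mrq : measurable_fun [set: Y] (fun y => r * qker y).
  by apply: measurable_funM => //; exact: qker_measurable.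
have irq : m.-integrable setT (EFin \o (fun y => r * qker y)).
  exact: (integrableZl measurableT r qker_integrable).
have mqn n : measurable_fun [set: Y] (qn n).
  by apply: measurable_funM => //; exact: measurable_indic.
have iqn n : m.-integrable setT (EFin \o qn n) by exact: (ge0_integrable (mqn n) (qn0 n) irq).
have e0 : 0 < (r * I - 1) / 2 by lra.
have [n hn] : exists n, (L1dist m (qn n) (fun y => r * qker y)%R <= ((r * I - 1) / 2)%:E)%E.
  apply: (@filter_ex _ \oo).
  apply: (@dominated_cvg0 _ _ _ m (fun n y => qn n y - r * qker y) (fun y => r * qker y)) => //.
  - by move=> n; exact: measurable_funB.
  - apply: aeW => y; apply: cvg_near_cst; near=> n.
    rewrite /qn indicE mem_set ?mulr1 ?subrr //; split; near: n; first exact: good_near.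
    exact: nbhs_infty_ger.
  - by move=> n y; have := qn0 n y; rewrite ler_norml; lra.
have Iqn : 1 < \int[m]_y qn n y.
  have := le_trans (Rintegral_dist (iqn n) irq) hn.
  have -> : \int[m]_y (r * qker y) = r * I.
    by rewrite RintegralZl //; exact: qker_integrable.
  rewrite lee_fin ler_norml; lra.
pose a := Num.min (n.+1%:R^-1 / 2) Z.
have a0 : 0 < a by rewrite lt_min divr_gt0 // invr_gt0.
have [an aZ] : a < n.+1%:R^-1 /\ a <= Z.
  split; last by rewrite ge_min lexx orbT.
  apply: (@le_lt_trans _ _ (n.+1%:R^-1 / 2)); first by rewrite ge_min lexx.
  by rewrite ltr_pdivrMr // ltr_pMr ?invr_gt0 // ltr1n.
have [u uI hu] := EVT_min aZ (continuous_subspaceT (gclamp_continuous (tau := tau0))).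
rewrite in_itv /= in uI.
have c0 : 0 < g u tau0 by apply: g_tau0_gt0; lra.
(* For clamped values up to [a] the set [good r n] gives the linear bound. Above [a], monotonicity
   reduces [tau <> tau0] to the value [vs], and at [tau0] the positive minimum of [g(., tau0)] on
   [[a, Z]] takes over, whence the second bound on [vs]. *)
pose vs := Num.min a (g u tau0 / g' tau0).
have vs0 : 0 < vs by rewrite lt_min a0 divr_gt0.
have va : vs <= a by rewrite /vs ge_min lexx.
have vc : vs <= g u tau0 / g' tau0 by rewrite /vs ge_min lexx orbT.
(* [n + 1] rather than [n], as [S] has to be positive even for [n = 0]. *)
exists (qn n), (n%:R + 1), vs; split; split => //.
- move=> y; have /andP[h1 h2] := qn0 n y; rewrite h1 (le_trans h2) //.
  by rewrite ler_piMl ?qker_ge0 // ltW.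
- move=> y; rewrite /qn indicE => h; rewrite memNset ?mulr0 // => -[_ h2]; lra.
move=> v y; rewrite /qn indicE; have [yD|] := boolP (y \in D n); last first.
  by move=> _; rewrite mulr0 mul0r mulr_ge0 // gclamp_ge0.
rewrite mulr1 /qker; move: yD; rewrite inE => -[gd _].
rewrite (_ : r * _ * _ = K y.1 y.2 * (r * g' y.2 * Num.min v vs)); last by ring.
apply: ler_wpM2l => //.
have [v0|v0] := leP v 0.
  apply: le_trans (gclamp_ge0 _ _); rewrite min_l ?(le_trans v0 (ltW vs0)) //.
  by rewrite mulr_ge0_le0 // mulr_ge0 // ltW.
have rg0 : 0 < r * g' y.2 by rewrite mulr_gt0.
have /andP[w0 wZ] := clamp_in v.
have vw : Num.min v vs <= clamp v.
  rewrite /clamp max_r ?(ltW v0) // le_min [X in _ && X]ge_min lexx andbT.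
  by apply: le_trans (le_trans va aZ); rewrite ge_min lexx orbT.
have [wa|aw] := leP (clamp v) a.
  apply: le_trans (_ : r * g' y.2 * clamp v <= _); first by rewrite ler_pM2l.
  by apply: (good_all gd) => //; rewrite w0 (le_lt_trans wa).
have le_vs : r * g' y.2 * Num.min v vs <= r * g' y.2 * vs.
  by rewrite ler_pM2l // ge_min lexx orbT.
apply: (le_trans le_vs); have [yE|/eqP ne] := eqVneq y.2 tau0.
  rewrite yE; apply: (@le_trans _ _ (g u tau0)).
    apply: (@le_trans _ _ (g' tau0 * vs)).
      by rewrite -mulrA ger_pMl ?mulr_gt0 // ltW.
    by rewrite mulrC -ler_pdivlMr.
  have := hu (clamp v); rewrite in_itv /= (ltW aw) wZ => /(_ isT).
  by rewrite {1}/gclamp clamp_id; [rewrite /gclamp (clamp_id (clamp_in v))|lra].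
apply: (@le_trans _ _ (g vs y.2)).
  by apply: (good_all gd); [rewrite (ltW vs0) (le_lt_trans va)|exact: le_trans aZ].
by apply: g_mono => //; [exact: ltW|exact: le_trans (ltW aw)].
Unshelve. all: by end_near. Qed.

(** * Consequences of the minorant: mass, first moment and affine test functions *)

Section Minorized.
Variables (qh : Y -> R) (S vs lam : R).
Hypothesis S0 : 0 < S.
Hypothesis vs0 : 0 < vs.
Hypothesis qh_measurable : measurable_fun [set: Y] qh.
Hypothesis qh_bounds : forall y, 0 <= qh y <= qker y.
Hypothesis qh_supp : forall y, S < `|y.1| -> qh y = 0.
Hypothesis qh_mass : 1 < \int[m]_y qh y.
Hypothesis qh_min : forall v y, qh y * Num.min v vs <= K y.1 y.2 * gclamp v y.2.
Hypothesis lam0 : 0 < lam.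
Hypothesis chi_lam : (chi_int mu K g' (sg * lam) < +oo)%E.
Hypothesis chi_lt1 : fine (chi_int mu K g' (sg * lam)) < 1.

Let qh_ge0 y : 0 <= qh y. Proof. by case/andP: (qh_bounds y). Qed.

Lemma sg_norm x : `|sg * x| = `|x|.
Proof.
have : (`|sg| - 1) * (`|sg| + 1) = 0.
  by rewrite -subr_sqr expr1n expr2 -normrM sg1 normr1 subrr.
move/eqP; rewrite mulf_eq0 subr_eq0 => /orP[/eqP h|/eqP h].
  by rewrite normrM h mul1r.
by have := normr_ge0 sg; lra.
Qed.

Lemma qh_integrable (f : Y -> R) (B : R) : measurable_fun [set: Y] f -> 0 <= B ->
  (forall y, `|y.1| <= S -> `|f y| <= B) ->
  m.-integrable setT (EFin \o (fun y => qh y * f y)).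
Proof.
move=> mf B0 hf; apply: le_integrable (qkerZ_integrable B) => //.
  by apply/measurable_EFinP; exact: measurable_funM.
move=> y _ /=; rewrite lee_fin [leRHS]ger0_norm ?(mulr_ge0 (qker_ge0 y) B0) //.
have /andP[q0 qq] := qh_bounds y; rewrite normrM ger0_norm //.
have [yS|yS] := leP `|y.1| S; first by rewrite ler_pM // hf.
by rewrite qh_supp // mul0r mulr_ge0 // qker_ge0.
Qed.

Let iqh : m.-integrable setT (EFin \o qh).
Proof. exact: (ge0_integrable qh_measurable qh_bounds qker_integrable). Qed.

Let msg : measurable_fun [set: Y] (fun y : Y => sg * y.1 : R).
Proof. by apply: measurable_funM => //; exact: measurable_fst. Qed.

Let iqs : m.-integrable setT (EFin \o (fun y => qh y * (sg * y.1))).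
Proof. by apply: (qh_integrable msg (ltW S0)) => y; rewrite sg_norm. Qed.

Local Notation F := (\int[m]_y qh y).
Local Notation m1 := (\int[m]_y (qh y * (sg * y.1))).

(** On an affine function the minorant acts explicitly: mass times the constant plus first moment
    times the slope. The bound [c + nu S <= vs] keeps the truncation at [vs] inactive on the support
    of [qh]. *)
Lemma opA_low (phi : R -> R) (c nu t : R) : meas phi -> 0 <= c -> 0 <= nu ->
  c + nu * S <= vs -> (forall x, `|x| <= S -> c + nu * x <= phi (t - x)) ->
  F * c + m1 * nu <= opA phi t.
Proof.
move=> mphi c0 nu0 hvs hx.
have icq := integrableZl measurableT c iqh.
have inq := integrableZl measurableT nu iqs.
have -> : F * c + m1 * nu = \int[m]_y (c * qh y + nu * (qh y * (sg * y.1))).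
  by rewrite RintegralD // !RintegralZl // [F * c]mulrC [m1 * nu]mulrC.
apply: le_Rintegral => //.
- by have := integrableD measurableT icq inq.
- exact: integrand_integrable.
move=> y _; rewrite /integrand; apply: le_trans (qh_min _ _).
rewrite mulrCA [c * _]mulrC -mulrDr; have [yS|yS] := leP `|y.1| S; last by rewrite qh_supp // !mul0r.
rewrite ler_wpM2l // le_min hx ?sg_norm //=; apply: le_trans hvs.
rewrite lerD2l ler_wpM2l // (le_trans (ler_norm _)) // sg_norm //.
Qed.

(** [1 - x <= e^{-x}] with [x = lam sg s] gives [F - lam m1 <= \int K g' e^{-s sg lam} < 1 < F]. *)
Lemma moment_gt0 : 0 < m1.
Proof.
have iql := integrableZl measurableT lam iqs.
have mexp : measurable_fun [set: Y] (fun y : Y => expR (- (y.1 * (sg * lam)))).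
  apply: measurableT_comp => //; apply: measurableT_comp => //.
  by apply: measurable_funM => //; exact: measurable_fst.
have iqe : m.-integrable setT (EFin \o (fun y => qker y * expR (- (y.1 * (sg * lam))))).
  apply/integrableP; split.
    by apply/measurable_EFinP; apply: measurable_funM => //; exact: qker_measurable.
  rewrite (_ : (\int[m]_y _)%E = chi_int mu K g' (sg * lam)) //.
  rewrite chi_intE; apply: eq_integral => y _ /=.
  by rewrite ger0_norm // mulr_ge0 ?expR_ge0 ?qker_ge0.
have : F - lam * m1 <= fine (chi_int mu K g' (sg * lam)).
  rewrite chi_intE -/(Rintegral m setT _) -RintegralZl // -RintegralB //.
  apply: le_Rintegral => //; first by have := integrableB measurableT iqh iql.
  move=> y _; have /andP[q0 qq] := qh_bounds y.
  apply: (@le_trans _ _ (qh y * expR (- (y.1 * (sg * lam))))); last by rewrite ler_wpM2r ?expR_ge0.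
  have -> : qh y - lam * (qh y * (sg * y.1)) = qh y * (1 + - (y.1 * (sg * lam))) by ring.
  by rewrite ler_wpM2l // expR_ge1Dx.
move=> h; have : 0 < lam * m1 by move: qh_mass chi_lt1 h; lra.
by rewrite pmulr_rgt0.
Qed.

Let ind_int (a b : R) : a <= b ->
  (\int[leb]_t (\1_(`[a, b[%classic) t)%:E = (b - a)%:E)%E.
Proof.
move=> ab; transitivity (leb `[a, b[%classic); first by rewrite integral_indic // setIT.
rewrite lebesgue_measure_itv /= lte_fin.
by case: ltP => // ba; rewrite (_ : b = a) ?subrr //; apply/eqP; rewrite eq_le ab ba.
Qed.

Lemma product_sigma_finite : sigma_finite setT m.
Proof.
have [F UF Foo] := sigma_finiteT leb.
exists (fun n => F n `*` setT) => [|n].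
  by apply/seteqP; split => // -[x y] _; have [n _ Fx] : (\bigcup_n F n) x; [rewrite -UF|exists n].
have [mF Fn] := Foo n; split; first exact: measurableX.
by rewrite product_measure1E // lte_mul_pinfty // ?ge0_fin_numE // -ge0_fin_numE // fin_num_measure.
Qed.

(* The canonical instances of the library make a product measure sigma-finite only when
   both factors are finite. *)
Definition product_sf : {sigma_finite_measure set Y -> \bar R} :=
  HB.pack (m : set Y -> \bar R) (m : {measure set Y -> \bar R})
    (Measure_isSigmaFinite.Build _ _ _ m product_sigma_finite).

(** * Decay of supersolutions at [-oo] *)

Section Decay.
Variable phi : R -> R.
Hypothesis uc : ucont phi.
Hypothesis phiZ : forall t, 0 <= phi t <= Z.
Hypothesis phi_super : forall t, opA phi t <= phi t.
Hypothesis phi_vs : forall t : R, t < 0 -> phi t <= vs.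

Let mphi : meas phi.
Proof. by have /continuous_measurable_fun := ucont_continuous uc. Qed.

Let phi0 t : 0 <= phi t. Proof. by case/andP: (phiZ t). Qed.

Let L (a b : R) : \bar R := (\int[leb]_t (\1_(`[a, b[%classic) t * phi t)%:E)%E.

Let mL (a b : R) : measurable_fun [set: RM] (fun t : RM => \1_(`[a, b[%classic) t * phi t : R).
Proof.
have : measurable_fun [set: R] (fun t : R => \1_(`[a, b[%classic) t * phi t : R).
  by apply: measurable_funM => //; apply: measurable_indic; exact: measurable_itv.
by [].
Qed.

Let ind0 (a b t : R) : 0 <= \1_(`[a, b[%classic) t :> R.
Proof. by rewrite indicE. Qed.

Let Lge0 a b : (0 <= L a b)%E.
Proof. by apply: integral_ge0 => t _; rewrite lee_fin mulr_ge0. Qed.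

Let mprod : measurable_fun [set: (RM * Y)%type]
  (fun p : RM * Y => qh p.2 * phi (p.1 - sg * p.2.1)).
Proof.
apply: measurable_funM; first exact: (measurableT_comp qh_measurable measurable_snd).
apply: measurableT_comp mphi _; apply: measurable_funB; first exact: measurable_fst.
exact: (measurableT_comp msg measurable_snd).
Qed.

(** The condition on [b] keeps the arguments [t - sg s] negative on the support of [qh], where
    [phi <= vs] makes the truncation inactive. After exchanging the integrals, every window shifted
    by at most [S] still contains [[a + S, b - S[]. *)
Let mass_shift a b : b <= - S ->
  (F%:E * L (a + S)%R (b - S)%R <= L a b)%E.
Proof.
move=> bS.
pose H (p : RM * Y) := \1_(`[a, b[%classic) p.1 * (qh p.2 * phi (p.1 - sg * p.2.1)) : R.
have mind : measurable_fun [set: RM] (fun t : RM => \1_(`[a, b[%classic) t : R).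
  have : measurable_fun [set: R] (fun t : R => \1_(`[a, b[%classic) t : R).
    by apply: measurable_indic; exact: measurable_itv.
  by [].
have mH : measurable_fun [set: (RM * Y)%type] H.
  by apply: measurable_funM => //; exact: (measurableT_comp mind measurable_fst).
have H0 p : 0 <= H p by rewrite mulr_ge0 // mulr_ge0.
have mHE : measurable_fun [set: (RM * Y)%type] (EFin \o H) by exact/measurable_EFinP.
apply: (@le_trans _ _ (\int[leb]_t \int[m]_y (H (t, y))%:E)%E); last first.
  apply: ge0_le_integral => //.
  - by move=> t _; apply: integral_ge0 => y _; rewrite lee_fin.
  - apply: (measurable_fun_fubini_tonelli_F (m2 := product_sf) (EFin \o H)) => //.
  - exact/measurable_EFinP.
  move=> t _; rewrite /H /= indicE; have [tI|tI] := boolP (t \in _); last first.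
    by rewrite mul0r; under eq_integral do rewrite mul0r; rewrite integral0.
  rewrite mul1r; under eq_integral do rewrite mul1r.
  move: tI; rewrite inE /= in_itv /= => /andP[_ tb].
  apply: (@le_trans _ _ (opA phi t)%:E); last by rewrite lee_fin.
  rewrite /opA /Rintegral fineK; last first.
    exact: (integrable_fin_num measurableT (integrand_integrable t mphi)).
  apply: ge0_le_integral => //.
  - by move=> y _; rewrite lee_fin mulr_ge0.
  - apply/measurable_EFinP; apply: (measurableT_comp mprod (measurable_pair1 t)).
  - apply/measurable_EFinP; exact: integrand_measurable.
  move=> y _; rewrite lee_fin; apply: le_trans (qh_min _ _).
  have [yS|yS] := leP `|y.1| S; last by rewrite qh_supp // !mul0r.
  rewrite ler_wpM2l // le_min lexx /=; apply: phi_vs.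
  by move: yS; rewrite -sg_norm ler_norml; lra.
have -> : (\int[leb]_t \int[m]_y (H (t, y))%:E = \int[m]_y \int[leb]_t (H (t, y))%:E)%E.
  by apply: (fubini_tonelli (m1 := leb) (m2 := product_sf) (EFin \o H)) => // p; rewrite /= lee_fin.
have -> : (F%:E * L (a + S)%R (b - S)%R = \int[m]_y ((qh y)%:E * L (a + S)%R (b - S)%R))%E.
  rewrite ge0_integralZr //; last 2 first.
  - exact/measurable_EFinP.
  - by move=> y _; rewrite lee_fin.
  by rewrite fineK //; exact: (integrable_fin_num measurableT iqh).
apply: ge0_le_integral => //.
- by move=> y _; rewrite mule_ge0 // lee_fin.
- by apply: emeasurable_funM => //; exact/measurable_EFinP.
- apply: (measurable_fun_fubini_tonelli_G (m1 := leb) (EFin \o H)) => //.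
move=> y _.
rewrite -(ge0_integral_shift (sg * y.1) (f := fun t => (H (t, y))%:E)); last 2 first.
- exact: (measurableT_comp mHE (measurable_pair2 y)).
- by move=> t; rewrite lee_fin.
rewrite -ge0_integralZl_EFin //; last 2 first.
- by move=> t _; rewrite lee_fin mulr_ge0.
- exact/measurable_EFinP.
apply: ge0_le_integral => //.
- by move=> t _; rewrite mule_ge0 // lee_fin ?mulr_ge0.
- by apply: emeasurable_funM => //; exact/measurable_EFinP.
- have ms := measurable_shift (sg * y.1).
  exact: (measurableT_comp (measurableT_comp mHE (measurable_pair2 y)) ms).
move=> t _; rewrite -EFinM lee_fin /H /= addrK.
have [yS|yS] := leP `|y.1| S; last by rewrite qh_supp // !mul0r mulr0.
rewrite mulrCA ler_wpM2r ?mulr_ge0 // !indicE.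
have [tI|] := boolP (t \in _) => //; rewrite mem_set //=.
move: tI yS; rewrite inE /= !in_itv /= -sg_norm ler_norml; lra.
Qed.
Let L_split a b c : a <= b -> b <= c -> L a c = (L a b + L b c)%E.
Proof.
move=> ab bc; rewrite /L -ge0_integralD //; last 4 first.
- by move=> t _; rewrite lee_fin mulr_ge0.
- exact/measurable_EFinP.
- by move=> t _; rewrite lee_fin mulr_ge0.
- exact/measurable_EFinP.
apply: eq_integral => t _; rewrite -EFinD -mulrDl; congr (_ * _)%:E.
rewrite !indicE !mem_setE !in_itv /=.
have [at_|ta] := leP a t; have [bt|tb] := leP b t; have [ct|tc] := leP c t => /=;
  rewrite ?addr0 ?add0r //; lra.
Qed.

Let indL (a b x : R) : a <= b -> 0 <= x ->
  (\int[leb]_t (x * \1_(`[a, b[%classic) t)%:E = (x * (b - a))%:E)%E.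
Proof.
move=> ab x0; under eq_integral do rewrite EFinM.
rewrite ge0_integralZl_EFin // ?ind_int //.
by apply/measurable_EFinP; apply: measurable_indic; exact: measurable_itv.
Qed.

Let mindx (a b x : R) : measurable_fun [set: RM] (fun t : RM => x * \1_(`[a, b[%classic) t : R).
Proof.
have : measurable_fun [set: R] (fun t : R => x * \1_(`[a, b[%classic) t : R).
  by apply: measurable_funM => //; apply: measurable_indic; exact: measurable_itv.
by [].
Qed.

Let L_le a b x : a <= b -> 0 <= x -> (forall t, t < b -> phi t <= x) ->
  (L a b <= (x * (b - a))%:E)%E.
Proof.
move=> ab x0 hx; rewrite -indL //; apply: ge0_le_integral => //.
- by move=> t _; rewrite lee_fin mulr_ge0.
- exact/measurable_EFinP.
- exact/measurable_EFinP.
move=> t _; rewrite lee_fin indicE mem_setE in_itv /=.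
by have [_|_] := leP a t; have [tb|_] := ltP t b; rewrite ?mul0r ?mulr0 // mul1r mulr1 hx.
Qed.

Let L_ge a b x : a <= b -> 0 <= x -> (forall t, a <= t < b -> x <= phi t) ->
  ((x * (b - a))%:E <= L a b)%E.
Proof.
move=> ab x0 hx; rewrite -indL //; apply: ge0_le_integral => //.
- by move=> t _; rewrite lee_fin mulr_ge0.
- exact/measurable_EFinP.
- exact/measurable_EFinP.
move=> t _; rewrite lee_fin indicE mem_setE in_itv /=.
by case: (boolP (a <= t < b)) => [/hx|]; rewrite ?mul0r ?mulr0 // mul1r mulr1.
Qed.

Let L_fin a b : a <= b -> L a b \is a fin_num.
Proof.
move=> ab; rewrite ge0_fin_numE //.
apply: le_lt_trans (ltry (Z * (b - a))).
by apply: L_le (ltW Z0) _ => // t _; case/andP: (phiZ t).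
Qed.

(** On [[a - S, -S[] the mass inequality costs only two edge pieces of length [S], where
    [phi <= vs]: it reads [F x <= x + 2 S vs] for the integral [x]. *)
Let L_bounded a : a <= - (S + S) ->
  fine (L a (- (S + S))) <= 2 * S * vs / (F - 1).
Proof.
move=> aS; have F1 : 0 < F - 1 by rewrite subr_gt0.
have [S0' vs0'] : 0 <= S /\ 0 <= vs by rewrite !ltW.
have := @mass_shift (a - S) (- S) (lexx _).
rewrite subrK (_ : - S - S = - (S + S)); last by ring.
have aS1 : a - S <= a by lra.
have SS : - (S + S) <= - S by lra.
rewrite (L_split aS1 (le_trans aS SS)) (L_split aS SS).
have vsL x y : x <= y -> y <= 0 -> (L x y <= (vs * (y - x))%:E)%E.
  by move=> xy y0; apply: L_le => // t ty; apply: phi_vs; exact: lt_le_trans ty y0.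
have h1 : (L (a - S) a <= (vs * (a - (a - S)))%:E)%E by apply: vsL => //; lra.
have h2 : (L (- (S + S)) (- S) <= (vs * (- S - (- (S + S))))%:E)%E by apply: vsL => //; lra.
rewrite -(fineK (L_fin aS)) => h.
have : ((F * fine (L a (- (S + S))))%:E <=
        (vs * (a - (a - S)) + (fine (L a (- (S + S))) + vs * (- S - (- (S + S)))))%:E)%E.
  by rewrite EFinM; apply: le_trans h _; rewrite !EFinD leeD // leeD.
by rewrite lee_fin ler_pdivlMr //; nra.
Qed.

(* Integrating [A phi <= phi] over [[a - S, - S[] gives
   [F * \int_a^{-2S} phi <= \int_{a - S}^{-S} phi], so [\int_a^{-2S} phi] is bounded uniformly
   in [a]. *)
Lemma supersolution_decay (e : R) : 0 < e -> exists T : R, forall t, t <= T -> phi t <= e.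
Proof.
move=> e0; apply: contrapT => hn.
have he (T : R) : exists2 t, t <= T & e < phi t.
  apply: contrapT => h; apply: hn; exists T => t tT; rewrite leNgt; apply/negP => et.
  by apply: h; exists t.
have e2 : 0 < e / 2 by lra.
have [r r0 hr] := uc e2.
pose r2 := r / 2; have r20 : 0 < r2 by rewrite /r2; lra.
(* By uniform continuity each time where [phi > e] starts an interval of length [r2] on which
   [phi >= e / 2]. Infinitely many disjoint ones would make the integral exceed the bound of
   [L_bounded]. *)
have step (n : nat) : exists2 a, a <= - (S + S) & n%:R * (e / 2 * r2) <= fine (L a (- (S + S))).
  elim: n => [|n [a aS IH]].
    by exists (- (S + S)) => //; rewrite mul0r fine_ge0.
  have [t ta et] := he (a - r2).
  have h1 : t <= t + r2 by lra.
  have h2 : t + r2 <= a by lra.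
  have h3 : t <= - (S + S) by lra.
  exists t => //; rewrite (L_split h1 (le_trans h2 aS)) (L_split h2 aS).
  rewrite -(fineK (L_fin h1)) -(fineK (L_fin h2)) -(fineK (L_fin aS)) -!EFinD /=.
  have : ((e / 2 * (t + r2 - t))%:E <= L t (t + r2))%E.
    apply: L_ge => //; first exact: ltW.
    move=> u /andP[tu ur].
    have : `|t - u| < r by rewrite ltr_norml; rewrite /r2 in ur; apply/andP; split; lra.
    by move=> /hr; rewrite ler_norml => /andP[]; lra.
  rewrite -(fineK (L_fin h1)) lee_fin addrAC subrr add0r => h.
  have := fine_ge0 (Lge0 (t + r2) a).
  have -> : n.+1%:R = n%:R + 1 :> R by rewrite natr1.
  rewrite mulrDl mul1r. lra.
have w0 : 0 < e / 2 * r2 by exact: mulr_gt0.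
pose B := 2 * S * vs / (F - 1).
have [n] : exists n : nat, B < n%:R * (e / 2 * r2).
  exists (Num.truncn (B / (e / 2 * r2))).+1; rewrite -ltr_pdivrMr //.
  exact: truncnS_gt.
have [a aS h] := step n; have := L_bounded aS; rewrite -/B; lra.
Qed.
End Decay.

(** * Propagation of zeros *)

Lemma sg_cases : sg = 1 \/ sg = -1.
Proof.
have : (sg - 1) * (sg + 1) = 0 by rewrite -subr_sqr expr1n expr2 sg1 subrr.
by move/eqP; rewrite mulf_eq0 subr_eq0 addr_eq0 => /orP[/eqP ->|/eqP ->]; [left|right].
Qed.

Lemma measurable_sg : measurable_fun [set: RM] (fun x : RM => sg * x : RM).
Proof.
have : measurable_fun [set: R] (fun x : R => sg * x) by exact: measurable_funM.
by [].
Qed.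

Lemma lebesgue_measure_sg (A : set RM) : measurable A ->
  leb ((fun x : R => sg * x) @^-1` A) = leb A.
Proof.
move=> mA; case: sg_cases => ->; last first.
  rewrite -[RHS](lebesgue_measure_reflect 0 mA); congr (leb _).
  by apply/seteqP; split => x /=; rewrite mulN1r sub0r.
by congr (leb _); apply/seteqP; split => x /=; rewrite mul1r.
Qed.

Lemma ae_sg (P : R -> Prop) : {ae leb, forall x, P x} -> {ae leb, forall x, P (sg * x)}.
Proof.
move=> [N [mN N0 PN]]; exists ((fun x : R => sg * x) @^-1` N); split.
- by rewrite -[X in measurable X]setTI; exact: measurable_sg.
- by rewrite lebesgue_measure_sg.
- by move=> x /= h; apply: PN.
Qed.

Let Pm (s : R) : \bar R := (\int[mu]_tau (qh (s, tau))%:E)%E.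

Let mqhE : measurable_fun [set: Y] (EFin \o qh). Proof. exact/measurable_EFinP. Qed.

Let mPm : measurable_fun [set: RM] (Pm : RM -> \bar R).
Proof.
have H := measurable_fun_fubini_tonelli_F (m2 := mu) (EFin \o qh).
by apply: H => [|y]; [exact: mqhE|rewrite lee_fin; exact: qh_ge0].
Qed.

(** The lags that point to the past, once the sign [sg] is applied, and on which the kernel [qh] has
    positive mass. *)
Let Es : set R := [set s | 0 < sg * s /\ (0 < Pm s)%E].

Let mEs : measurable (Es : set RM).
Proof.
rewrite (_ : Es = ((fun x : RM => sg * x) @^-1` `]0, +oo[%classic) `&` (Pm @^-1` `]0%E, +oo[%classic)).
  apply: measurableI.
    by rewrite -[X in measurable X]setTI; apply: measurable_sg => //; exact: measurable_itv.
  rewrite -[X in measurable X]setTI; apply: mPm => //; exact: emeasurable_itv.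
by apply/seteqP; split => s; rewrite /Es /= !in_itv /= !andbT; [case=> -> ->|move=> [-> ->]].
Qed.

(** If this set were null, [qh] would charge only [sg s <= 0], and its first moment could not be
    positive. *)
Let Es_gt0 : (0 < leb Es)%E.
Proof.
rewrite lt0e measure_ge0 andbT; apply/negP => /eqP E0.
pose f (y : Y) := qh y * Num.max 0 (sg * y.1).
have mmax : measurable_fun [set: Y] (fun y : Y => Num.max 0 (sg * y.1) : R).
  have := measurable_maxr (measurable_cst (0 : R)) msg. by [].
have mf : measurable_fun [set: Y] f by exact: measurable_funM.
have f0 y : 0 <= f y by apply: mulr_ge0; [exact: qh_ge0|rewrite le_max lexx].
have : (\int[m]_y (f y)%:E = 0)%E.
  rewrite fubini_tonelli1; last 2 first.
  - exact/measurable_EFinP.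
  - by move=> y; rewrite lee_fin.
  have mF := measurable_fun_fubini_tonelli_F (m2 := mu) (EFin \o f).
  have {}mF : measurable_fun [set: RM] (fubini_F mu (EFin \o f)).
    by apply: mF => [|y]; [exact/measurable_EFinP|rewrite lee_fin].
  have FE s : fubini_F mu (EFin \o f) s = ((Num.max 0 (sg * s))%:E * Pm s)%E.
    rewrite /fubini_F /Pm -(@ge0_integralZl_EFin _ _ _ mu _ measurableT).
    - by apply: eq_integral => tau _; rewrite /f /= EFinM muleC.
    - by move=> tau _; rewrite lee_fin.
    - by apply/measurable_EFinP; exact: (measurableT_comp qh_measurable (measurable_pair1 s)).
    - by rewrite le_max lexx.
  have F0 s : (0 <= fubini_F mu (EFin \o f) s)%E.
    by apply: integral_ge0 => tau _; rewrite lee_fin.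
  transitivity (\int[leb]_s `|fubini_F mu (EFin \o f) s|)%E.
    by apply: eq_integral => s _; rewrite gee0_abs.
  apply/(ae_eq_integral_abs leb measurableT mF).
  exists Es; split => // s /= h; split.
    rewrite ltNge; apply/negP => hs; apply: h => _; rewrite FE max_l // mul0e.
    by [].
  rewrite lt0e; apply/andP; split.
    apply/negP => /eqP hs; apply: h => _; rewrite FE hs mule0.
    by [].
  by apply: integral_ge0 => tau _; rewrite lee_fin.
move=> f_0; have : m1 <= \int[m]_y f y.
  apply: le_Rintegral => //.
    apply: (qh_integrable mmax (ltW S0)) => y yS; rewrite ger0_norm ?le_max ?lexx //.
    by rewrite ge_max (ltW S0) (le_trans (ler_norm _)) // sg_norm.
  by move=> y _; rewrite /f ler_wpM2l // le_max lexx orbT.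
by rewrite /Rintegral f_0 /= leNgt moment_gt0.
Qed.

(** At a zero [u] the nonnegative integrand vanishes almost everywhere, so [phi (u - x) = 0] for
    almost all lags [x] in [E]; the closed zero set then absorbs a half-line. *)
Lemma zero_propagates (phi : R -> R) (t : R) : continuous phi -> (forall t, 0 <= phi t <= Z) ->
  (forall t, opA phi t = phi t) -> phi t = 0 -> exists T : R, forall u, u <= T -> phi u = 0.
Proof.
move=> cphi phiZ Aphi phit.
have mphi : meas phi by exact: continuous_measurable_fun.
have phi0 u : 0 <= phi u by case/andP: (phiZ u).
pose E : set R := (fun x => sg * x) @^-1` Es.
have mE : measurable (E : set RM).
  by rewrite -[X in measurable X]setTI; exact: measurable_sg.
have E0 : (0 < leb E)%E by rewrite lebesgue_measure_sg.
have Epos x : E x -> 0 < x by case; rewrite mulrA sg1 mul1r.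
have cZ : closed [set u | phi u = 0].
  have cZ : {in ~` phi @^-1` [set x | x = 0], continuous phi} by move=> u _; exact: cphi.
  exact: (preimage_closed cZ (@closed_eq R 0)).
have [|V hV] := closed_absorbing mE E0 Epos cZ.
  move=> u /= phiu.
  have mI := integrand_measurable u mphi.
  have mIE : measurable_fun [set: Y] (EFin \o integrand phi u) by exact/measurable_EFinP.
  have I0 : (\int[m]_y (integrand phi u y)%:E = 0)%E.
    have := Aphi u; rewrite phiu /opA /Rintegral => h.
    rewrite -[LHS]fineK ?h //.
    exact: (integrable_fin_num measurableT (integrand_integrable u mphi)).
  have F0 s : (0 <= fubini_F mu (EFin \o integrand phi u) s)%E.
    by apply: integral_ge0 => tau _; rewrite lee_fin integrand_ge0.
  have mF : measurable_fun [set: RM] (fubini_F mu (EFin \o integrand phi u)).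
    apply: measurable_fun_fubini_tonelli_F => [|y]; first exact: mIE.
    by rewrite lee_fin; exact: integrand_ge0.
  have : ae_eq leb setT (fubini_F mu (EFin \o integrand phi u)) (cst 0%E).
    apply/(ae_eq_integral_abs leb measurableT mF).
    transitivity (\int[leb]_s fubini_F mu (EFin \o integrand phi u) s)%E.
      by apply: eq_integral => s _; rewrite gee0_abs.
    rewrite -fubini_tonelli1 // => y; rewrite lee_fin; exact: integrand_ge0.
  move=> /ae_sg.
  apply: (@filterS _ _ (ae_filter_ringOfSetsType leb)) => x /(_ Logic.I) h [_ Px].
  apply/eqP; rewrite eq_le phi0 andbT leNgt; apply/negP => ph.
  (* By [qh_min], [c] times the mass of [qh] on the fibre bounds the fibre integral of the integrand
     from below, and this integral is zero. *)
  pose c := Num.min (phi (u - x)) vs.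
  have c0 : 0 < c by rewrite lt_min ph.
  have : (c%:E * Pm (sg * x)%R <= fubini_F mu (EFin \o integrand phi u) (sg * x)%R)%E.
    rewrite /Pm -(@ge0_integralZl_EFin _ _ _ mu _ measurableT).
    - apply: ge0_le_integral => //.
      + by move=> tau _; apply: mule_ge0; rewrite lee_fin // ltW.
      + apply: measurable_funeM; apply/measurable_EFinP.
        exact: (measurableT_comp qh_measurable (measurable_pair1 (sg * x))).
      + apply/measurable_EFinP.
        exact: (measurableT_comp mI (measurable_pair1 (sg * x))).
      + move=> tau _; rewrite -EFinM lee_fin mulrC /integrand /=.
        by rewrite mulrA sg1 mul1r; have := qh_min (phi (u - x)) (sg * x, tau).
    - by move=> tau _; rewrite lee_fin.
    - by apply/measurable_EFinP; exact: (measurableT_comp qh_measurable (measurable_pair1 (sg * x))).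
    - exact: ltW.
  by rewrite h leNgt mule_gt0.
exists (t - V) => u ut; have := hV t (t - u) phit.
by rewrite subKr; apply; lra.
Qed.
End Minorized.

(** * From the abstract operator to equation (E) *)

Variables (z1 lam : R).
Hypothesis z1Z : 0 < z1 < Z.
Hypothesis G_inv : forall s, z1 <= s <= Z -> z1 <= G s <= Z.
Hypothesis G_min : forall s, z1 <= s <= Z -> G z1 <= G s.
Hypothesis G_gt : forall s, 0 < s <= z1 -> s < G s.
Hypothesis lam0 : 0 < lam.
Hypothesis chi_lam : (chi_int mu K g' (sg * lam) < +oo)%E.
Hypothesis chi_lt1 : fine (chi_int mu K g' (sg * lam)) < 1.

Let z10 : 0 < z1. Proof. by case/andP: z1Z. Qed.

Lemma opA_wavefront : exists phi : R -> R, [/\ ucont phi, (forall t, 0 < phi t <= Z),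
  (forall t, opA phi t = phi t),
  (forall e, 0 < e -> exists T : R, forall t, t <= T -> phi t <= e) &
  (exists a T : R, z1 < a /\ forall t, T <= t -> a <= phi t)].
Proof.
have [qh [S [vs [[S0 vs0 mqh qhb] [qhs qhm qhmin]]]]] := minorant.
have chi0 : 0 <= fine (chi_int mu K g' (sg * lam)).
  rewrite chi_intE fine_ge0 // integral_ge0 // => y _.
  by rewrite lee_fin mulr_ge0 ?expR_ge0 ?qker_ge0.
have m10 := moment_gt0 S0 mqh qhb qhs qhm lam0 chi_lam chi_lt1.
have rho01 : 0 <= fine (chi_int mu K g' (sg * lam)) < 1 by rewrite chi0.
have Ggt1 : z1 < G z1 by apply: G_gt; rewrite z10 lexx.
apply: (wavefront_exists z1Z lam0 rho01 S0 vs0 qhm m10) Ggt1 G_min G_gt.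
- exact: opA_shift.
- exact: opA_range.
- exact: opA_equicont.
- exact: opA_unif.
- exact: opA_pointwise.
- by move=> phi B t mphi B0 h; exact: opA_exp.
- by move=> phi c nu t; exact: (opA_low S0 mqh qhb qhs qhmin).
- exact: opA_env_low.
- by move=> phi; exact: (supersolution_decay S0 vs0 mqh qhb qhs qhm qhmin).
- by move=> phi t; exact: (zero_propagates S0 vs0 mqh qhb qhs qhm qhmin lam0 chi_lam chi_lt1).
Qed.

Lemma rhsE_opA (phi : R -> R) (t : R) : meas phi -> (forall u, 0 <= phi u <= Z) ->
  rhsE mu K g (fun u => phi (sg * u)) t = (opA phi (sg * t))%:E.
Proof.
move=> mphi phiZ; rewrite /opA /Rintegral fineK; last first.
  exact: (integrable_fin_num measurableT (integrand_integrable _ mphi)).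
rewrite fubini_tonelli2; last 2 first.
- by apply/measurable_EFinP; exact: integrand_measurable.
- by move=> y; rewrite lee_fin integrand_ge0.
apply: eq_integral => tau _; apply: eq_integral => s _.
by rewrite /integrand /gclamp /= clamp_id // mulrBr.
Qed.

Lemma G_attracted (k : R) : globally_attracting G Z k -> forall phi : R -> R,
  ucont phi -> (forall t, 0 <= phi t <= Z) -> (forall t, opA phi t = phi t) ->
  (exists a T : R, z1 < a /\ forall t, T <= t -> a <= phi t) -> phi t @[t --> +oo] --> k.
Proof.
move=> Gk phi uc phiZ Aphi [a [T [z1a haT]]].
have [_ z1ltZ] := andP z1Z.
(* [G] after projection onto [[z1, Z]]: the continuous map of the whole line that [wavefront_limit]
   asks for. *)
pose H x := G (clamp (Num.max z1 x)).
have clH x : z1 <= clamp (Num.max z1 x) <= Z.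
  rewrite /clamp le_min (ltW z1ltZ) ge_min lexx /= andbT.
  by rewrite le_max; apply/orP; right; rewrite le_max lexx.
have Hc : continuous H.
  have mc : continuous (fun x => Num.max z1 x).
    apply: ucont_continuous => e e0; exists e => // t t' /ltW.
    move=> h; apply: le_trans h; apply: le_trans (max_lip _ _ _ _) _.
    by rewrite subrr normr0 ge_max normr_ge0 /=.
  by move=> x; exact: (cvg_comp _ _ (mc x) (@G_clamp_continuous (Num.max z1 x))).
have HG x : z1 <= x <= Z -> H x = G x.
  by move=> /andP[h1 h2]; rewrite /H max_r // clamp_id // (le_trans (ltW z10) h1).
have z1G : z1 < G z1 by apply: G_gt; rewrite z10 lexx.
apply: (wavefront_limit z1Z opA_shift opA_pointwise opA_env_low opA_env_up z1G uc phiZ Aphi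
  z1a haT Hc _ HG).
- by move=> x; apply: G_inv.
- by move=> x /andP[h1 h2]; apply: Gk; rewrite h2 (lt_le_trans z10 h1).
Qed.
(** Stated for the profile in the variable [sg t], so that the two cases of the theorem are
    instances of it. *)
Lemma solution_exists : exists phi : R -> R,
  [/\ solution_E mu K g (fun t => phi (sg * t)), (forall t, 0 < phi t <= Z),
    phi t @[t --> -oo] --> 0, (exists a T : R, z1 < a /\ forall t, T <= t -> a <= phi t) &
    forall k, globally_attracting G Z k -> phi t @[t --> +oo] --> k].
Proof.
have [phi [uc phiZ Aphi phi0 hlim]] := opA_wavefront.
have phiZ' t : 0 <= phi t <= Z by have /andP[h1 h2] := phiZ t; rewrite (ltW h1).
have cphi := ucont_continuous uc.
have mphi : meas phi by have /continuous_measurable_fun := cphi.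
exists phi; split => //.
- split; last split.
  + move=> t; have h : (sg * u) @[u --> t] --> sg * t by apply: cvgMr; exact: cvg_id.
    exact: (cvg_comp _ _ h (cphi (sg * t))).
  + by move=> t; case/andP: (phiZ' (sg * t)).
  + by move=> t; rewrite rhsE_opA // Aphi.
- apply/cvgrPdist_le => e /phi0[T hT]; exists T; split; first exact: num_real.
  move=> t /ltW /hT h; rewrite sub0r normrN ger0_norm //.
  by case/andP: (phiZ' t).
- by move=> k Gk; exact: G_attracted.
Qed.
End Operator.

(** * The two directions of time *)

Lemma limf_einf_gt {R : realType} (f : R -> R) (F : set_system R) (x a : R) : x < a ->
  F [set t | a <= f t] -> (x%:E < limf_einf (fun t => (f t)%:E) F)%E.
Proof.
move=> xa Fa; rewrite limf_einfE; apply: (@lt_le_trans _ _ a%:E); first by rewrite lte_fin.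
apply: (@le_trans _ _ (ereal_inf ((fun t => (f t)%:E) @` [set t | a <= f t]))).
  by apply: le_ereal_inf_tmp => _ [t /= h <-]; rewrite lee_fin.
by apply: ereal_sup_ubound; exists [set t | a <= f t].
Qed.

Unset Implicit Arguments.

Theorem theorem1p7 (R : realType) (d : measure_display) (X : measurableType d)
  (mu : {finite_measure set X -> \bar R})
  (K : R -> X -> R) (g : R -> X -> R) (g' : X -> R)
  (* standing assumptions on K *)
  (HK0 : forall s tau, 0 <= K s tau)
  (HKint : ((@lebesgue_measure R) \x mu)%E.-integrable setT
              (fun p : R * X => (K p.1 p.2)%:E))
  (HKpos : forall tau, (0 < \int[@lebesgue_measure R]_s (K s tau)%:E)%E)
  (* standing assumptions on g *)
  (Hgmeas : measurable_fun ([set v : R | 0 <= v] `*` [set: X]) (fun p : R * X => g p.1 p.2))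
  (Hg0 : forall v tau, 0 <= v -> 0 <= g v tau)
  (Hgzero : forall tau, g 0 tau = 0)
  (Hgcont : forall tau, {within [set v : R | 0 <= v], continuous (fun v => g v tau)})
  (Hgder : forall tau, (g h tau - g 0 tau) / h @[h --> 0^'+] --> g' tau)
  (Hgderpos : forall tau, 0 < g' tau)
  (* hypotheses of the theorem *)
  (tau0 : X) (zeta2 zeta1 : R)
  (HN : condN mu K g tau0 zeta2)
  (HGder : exists l : R,
      (Gmap mu K g tau0 zeta2 h - Gmap mu K g tau0 zeta2 0) / h @[h --> 0^'+] --> l)
  (Hglin : forall s tau, 0 <= s -> g s tau <= g' tau * s)
  (Hzeta1 : 0 < zeta1 < zeta2)
  (HGinv : forall s, zeta1 <= s <= zeta2 ->
      zeta1 <= Gmap mu K g tau0 zeta2 s <= zeta2)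
  (HGmin : forall s, zeta1 <= s <= zeta2 ->
      Gmap mu K g tau0 zeta2 zeta1 <= Gmap mu K g tau0 zeta2 s)
  (HGgt : forall s, 0 < s <= zeta1 -> s < Gmap mu K g tau0 zeta2 s)
  (Hchi0 : chi_defined mu K g' 0 /\ chi mu K g' 0 < 0) :
  ((exists w : R, 0 < w /\ chi_defined_changes_sign_on mu K g' `]0, w[) ->
   exists phi : R -> R,
     [/\ semi_wavefront mu K g phi,
         phi t @[t --> -oo] --> 0,
         (forall s, phi s <= zeta2),
         (zeta1%:E < limf_einf (fun t => (phi t)%:E) (@pinfty_nbhs R))%E &
         (forall kappa : R, kappa <> 0 ->
            [set s | 0 <= s /\ Gmap mu K g tau0 zeta2 s = s] = [set 0; kappa] ->
            globally_attracting (Gmap mu K g tau0 zeta2) zeta2 kappa ->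
            phi t @[t --> +oo] --> kappa)])
  /\
  ((exists w : R, 0 < w /\ chi_defined_changes_sign_on mu K g' `]- w, 0[) ->
   exists phi : R -> R,
     [/\ semi_wavefront mu K g phi,
         phi t @[t --> +oo] --> 0,
         (forall s, phi s <= zeta2),
         (zeta1%:E < limf_einf (fun t => (phi t)%:E) (@ninfty_nbhs R))%E &
         (forall kappa : R, kappa <> 0 ->
            [set s | 0 <= s /\ Gmap mu K g tau0 zeta2 s = s] = [set 0; kappa] ->
            globally_attracting (Gmap mu K g tau0 zeta2) zeta2 kappa ->
            phi t @[t --> -oo] --> kappa)]).

Proof.
have [mtau0 [mu_tau0 [g_mono [g_gt0 [Z0 [Th_incr [M [[vM [vM0 g_vM]] [g_le_M CM_lt]]]]]]]]] := HN.
have [chi0 chi0_lt0] := Hchi0.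
have chi0_gt1 : 1 < fine (chi_int mu K g' 0) by rewrite -subr_lt0.
(* The sign change supplies [z] with [chi z > 0]. Taking [sg = 1], [lam = z] for [z > 0], and
   [sg = -1], [lam = - z] for [z < 0], keeps [lam] positive with [sg * lam = z]. *)
pose wave lam sg (sg1 : sg * sg = 1) := solution_exists (lam := lam) HK0 HKint Hgmeas Hg0 Hgzero
  Hgcont Hgder Hgderpos Hglin chi0 Z0 sg1 mtau0 mu_tau0 g_mono g_gt0 Th_incr vM0 g_vM
  g_le_M CM_lt chi0_gt1 Hzeta1 HGinv HGmin HGgt.
split=> -[w [w0 [chi_fin [_ [z [_ [wz [_ chi_z]]]]]]]].
- have /andP[z0 _] : 0 < z < w by move: wz; rewrite /= in_itv.
  have sg1 : 1 * 1 = 1 :> R by rewrite mulr1.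
  have [||phi [sol phiZ phi0 [a [T [ha hT]]] hk]] := wave z 1 sg1 z0.
  + by rewrite mul1r; exact: chi_fin.
  + by rewrite mul1r -subr_gt0.
  have phiE : (fun t => phi (1 * t)) = phi by apply/funext => t; rewrite mul1r.
  rewrite phiE in sol; exists phi; split => //.
  + split=> //; split; first by move=> t; case/andP: (phiZ t).
    by split; [exists zeta2 => t; case/andP: (phiZ t)|left].
  + by move=> t; case/andP: (phiZ t).
  + apply: (limf_einf_gt ha); exists T; split; first exact: num_real.
    by move=> t /ltW /hT.
  + by move=> k _ _; exact: hk.
- have /andP[_ z0] : - w < z < 0 by move: wz; rewrite /= in_itv.
  have sg1 : -1 * -1 = 1 :> R by rewrite mulrNN mulr1.
  have nz0 : 0 < - z by rewrite oppr_gt0.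
  have [||phi [sol phiZ phi0 [a [T [ha hT]]] hk]] := wave (- z) (-1) sg1 nz0.
  + by rewrite mulN1r opprK; exact: chi_fin.
  + by rewrite mulN1r opprK -subr_gt0.
  have phiE : (fun t => phi (-1 * t)) = (fun t => phi (- t)) by apply/funext => t; rewrite mulN1r.
  rewrite phiE in sol; exists (fun t => phi (- t)).
  have phiNy : phi (- t) @[t --> +oo] --> 0 by apply/cvgNy_compNP.
  split => //.
  + split=> //; split; first by move=> t; case/andP: (phiZ (- t)).
    by split; [exists zeta2 => t; case/andP: (phiZ (- t))|right].
  + by move=> t; case/andP: (phiZ (- t)).
  + apply: (limf_einf_gt ha); exists (- T); split; first exact: num_real.
    by move=> t tT; apply: hT; rewrite lerNr ltW.
  + by move=> k _ _ /hk h; apply/cvgNy_compNP; under eq_cvg do rewrite /= opprK.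
Qed.
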